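(* Let $H_1=\begin{bmatrix} f_1&u_1\\ g_1&v_1\end{bmatrix}$ and $H_2=\begin{bmatrix} f_2&u_2\\ g_2&v_2\end{bmatrix}$ be $2\times 2$ matrices with entries in $L^\infty$. Consider the equation $$\begin{bmatrix} V(\bar f_1)_-\\ (g_1)_-\end{bmatrix}\otimes\begin{bmatrix} V(f_2)_-\\ (\bar u_2)_-\end{bmatrix}-\begin{bmatrix} V(\bar u_1)_-\\ (v_1)_-\end{bmatrix}\otimes\begin{bmatrix} V(g_2)_-\\ (\bar v_2)_-\end{bmatrix}=\begin{bmatrix} V(\bar f_2)_-\\ (g_2)_-\end{bmatrix}\otimes\begin{bmatrix} V(f_1)_-\\ (\bar u_1)_-\end{bmatrix}-\begin{bmatrix} V(\bar u_2)_-\\ (v_2)_-\end{bmatrix}\otimes\begin{bmatrix} V(g_1)_-\\ (\bar v_1)_-\end{bmatrix}.\quad(\ast)$$ Assume that both sides of $(\ast)$ are rank one operators. Then $R_{H_1}R_{H_2}=R_{H_2}R_{H_1}$ if and only if there exist constants $\lambda,\mu,\alpha$ with $\alpha\ne0$ such that, for one of the following sixteen lists, all functions in the list belong to $H^\infty$. (1) $\bar f_1-\bar\lambda\bar u_1,\ g_1-\lambda v_1,\ \bar f_2-\bar\mu\bar u_2,\ g_2-\mu v_2,\ \bar u_1-\bar\alpha\bar u_2,\ v_1-\alpha v_2,\ \mu f_1-g_1-\alpha(\lambda f_2-g_2),\ \bar\mu\bar u_1-\bar v_1-\bar\alpha(\bar\lambda\bar u_2-\bar v_2),\ g_2(v_1-\alpha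 v_2)+v_2(\alpha\lambda f_2-\mu f_1),\ \bar u_2\bar f_1-\bar u_1\bar f_2+\bar\mu\bar u_1\bar u_2-\bar v_1\bar u_2+\bar\alpha\bar v_2\bar u_2-\bar\lambda\bar\alpha\bar u_2^2$. (2) $\bar u_1-\bar\lambda\bar f_1,\ v_1-\lambda g_1,\ \bar f_2-\bar\mu\bar u_2,\ g_2-\mu v_2,\ \bar f_1-\bar\alpha\bar u_2,\ g_1-\alpha v_2,\ \mu f_1-g_1-\alpha(f_2-\lambda g_2),\ \bar\mu\bar u_1-\bar v_1-\bar\alpha(\bar u_2-\bar\lambda\bar v_2),\ g_2(v_1-\lambda\alpha v_2)+v_2(\alpha f_2-\mu f_1),\ \bar u_2\bar f_1-\bar u_1\bar f_2-\bar\alpha\bar u_2^2+\bar\lambda\bar\alpha\bar v_2\bar u_2+\bar\mu\bar u_1\bar u_2-\bar v_1\bar u_2$. (3) $f_2-\bar\lambda g_2,\ \bar u_2-\lambda\bar v_2,\ \bar f_2-\bar\mu\bar u_2,\ g_2-\mu v_2,\ \lambda\bar f_1-\bar u_1-\bar\alpha\bar u_2,\ \bar\lambda g_1-v_1-\alpha v_2,\ \mu f_1-g_1-\alpha g_2,\ \bar\mu\bar u_1-\bar v_1-\bar\alpha\bar v_2,\ g_1f_2+v_1g_2-\bar\lambda g_1g_2+\alpha v_2g_2-\mu v_2f_1,\ \lambda\bar v_2\bar f_1+\bar\mu\bar u_1\bar u_2-\bar v_1\bar u_2-\bar\alpha\bar v_2\bar u_2-\bar u_1\bar f_2$. (4)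 $g_2-\bar\lambda f_2,\ \bar v_2-\lambda\bar u_2,\ \bar f_2-\bar\mu\bar u_2,\ g_2-\mu v_2,\ \bar f_1-\lambda\bar u_1-\bar\alpha\bar u_2,\ g_1-\bar\lambda v_1-\alpha v_2,\ \mu f_1-g_1-\alpha f_2,\ \bar\mu\bar u_1-\bar v_1-\bar\alpha\bar u_2,\ \bar\lambda v_1f_2-\mu v_2f_1+\alpha v_2f_2,\ \bar v_2\bar u_1-\bar u_1\bar f_2+\bar u_2\bar f_1-\lambda\bar u_1\bar u_2+\bar\mu\bar u_1\bar u_2-\bar u_2\bar v_1-\bar\alpha\bar u_2^2$. (5) $\bar f_1-\bar\lambda\bar u_1,\ g_1-\lambda v_1,\ \bar u_2-\bar\mu\bar f_2,\ v_2-\mu g_2,\ \bar u_1-\bar\alpha\bar f_2,\ v_1-\alpha g_2,\ f_1-\mu g_1-\alpha(\lambda f_2-g_2),\ \bar u_1-\bar\mu\bar v_1-\bar\alpha(\bar\lambda\bar u_2-\bar v_2),\ \bar u_2\bar f_1-\bar\mu\bar v_1\bar f_2+\bar\alpha\bar v_2\bar f_2-\bar\lambda\bar\alpha\bar u_2\bar f_2,\ v_1g_2-v_2g_1-f_1g_2+\mu g_1g_2-\alpha g_2^2+\lambda\alpha g_2f_2$. (6) $\bar u_1-\bar\lambda\bar f_1,\ v_1-\lambda g_1,\ \bar u_2-\bar\mu\bar f_2,\ v_2-\mu g_2,\ \bar f_1-\bar\alpha\bar f_2,\ g_1-\alpha g_2,\ f_1-\mu g_1-\alpha(f_2-\lambda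 g_2),\ \bar u_1-\bar\mu\bar v_1-\bar\alpha(\bar u_2-\bar\lambda\bar v_2),\ \bar u_2\bar f_1-\bar\mu\bar v_1\bar f_2-\bar\alpha\bar u_2\bar f_2+\bar\lambda\bar\alpha\bar v_2\bar f_2,\ v_1g_2-v_2g_1-g_2f_1+\mu g_1g_2+\alpha g_2f_2-\lambda\alpha g_2^2$. (7) $f_2-\bar\lambda g_2,\ \bar u_2-\lambda\bar v_2,\ \bar u_2-\bar\mu\bar f_2,\ v_2-\mu g_2,\ \lambda\bar f_1-\bar u_1-\bar\alpha\bar f_2,\ \bar\lambda g_1-v_1-\alpha g_2,\ f_1-\mu g_1-\alpha g_2,\ \bar u_1-\bar\mu\bar v_1-\bar\alpha\bar v_2,\ \lambda\bar v_2\bar f_1-\bar\mu\bar v_1\bar f_2-\bar\alpha\bar v_2\bar f_2,\ g_1f_2-v_2g_1+(v_1-\bar\lambda g_1)g_2+g_2(\mu g_1-f_1)+\alpha g_2^2$. (8) $g_2-\bar\lambda f_2,\ \bar v_2-\lambda\bar u_2,\ \bar u_2-\bar\mu\bar f_2,\ v_2-\mu g_2,\ \bar f_1-\lambda\bar u_1-\bar\alpha\bar f_2,\ g_1-\bar\lambda v_1-\alpha g_2,\ f_1-\mu g_1-\alpha f_2,\ \bar u_1-\bar\mu\bar v_1-\bar\alpha\bar u_2,\ \bar v_2\bar u_1+\bar u_2\bar f_1-\lambda\bar u_1\bar u_2-\bar\mu\bar v_1\bar f_2-\bar\alpha\bar u_2\bar f_2,\ g_1v_2+g_2f_1-\bar\lambda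 v_1f_2-\mu g_1g_2-\alpha g_2f_2$. (9) $\bar f_1-\bar\lambda\bar u_1,\ g_1-\lambda v_1,\ f_1-\bar\mu g_1,\ \bar u_1-\mu\bar v_1,\ \bar u_1-\bar\alpha(\mu\bar f_2-\bar u_2),\ v_1-\alpha(\bar\mu g_2-v_2),\ g_1-\alpha(\lambda f_2-g_2),\ \bar v_1-\bar\alpha(\bar\lambda\bar u_2-\bar v_2),\ \bar u_2\bar f_1-\bar v_1\bar u_2+\bar\alpha(\bar\lambda\bar u_2-\bar v_2)(\bar u_2-\mu\bar f_2),\ v_1g_2-g_2f_1+\alpha(\bar\mu g_2-v_2)(\lambda f_2-g_2)$. (10) $\bar u_1-\bar\lambda\bar f_1,\ v_1-\lambda g_1,\ f_1-\bar\mu g_1,\ \bar u_1-\mu\bar v_1,\ \bar f_1-\bar\alpha(\mu\bar f_2-\bar u_2),\ g_1-\alpha(\bar\mu g_2-v_2),\ g_1-\alpha(f_2-\lambda g_2),\ \bar v_1-\bar\alpha(\bar u_2-\bar\lambda\bar v_2),\ \bar u_2\bar f_1-\bar v_1\bar u_2+\bar\alpha(\bar\lambda\bar v_2-\bar u_2)(\mu\bar f_2-\bar u_2),\ v_1g_2-g_2f_1+\alpha(\bar\mu g_2-v_2)(f_2-\lambda g_2)$. (11) $f_2-\bar\lambda g_2,\ \bar u_2-\lambda\bar v_2,\ f_1-\bar\mu g_1,\ \bar u_1-\mu\bar v_1,\ \lambda\bar f_1-\bar u_1-\bar\alpha(\mu\bar f_2-\bar u_2),\ \bar\lambda g_1-v_1-\alpha(\bar\mu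 g_2-v_2),\ g_1-\alpha g_2,\ \bar v_1-\bar\alpha\bar v_2,\ \bar v_1\bar u_2-\lambda\bar v_2\bar f_1-\bar\alpha\bar v_2\bar u_2+\bar\alpha\mu\bar v_2\bar f_2,\ g_1f_2-g_2f_1+(v_1-\bar\lambda g_1)g_2+\alpha g_2(\bar\mu g_2-v_2)$. (12) $g_2-\bar\lambda f_2,\ \bar v_2-\lambda\bar u_2,\ f_1-\bar\mu g_1,\ \bar u_1-\mu\bar v_1,\ \bar f_1-\lambda\bar u_1-\bar\alpha(\mu\bar f_2-\bar u_2),\ g_1-\bar\lambda v_1-\alpha(\bar\mu g_2-v_2),\ g_1-\alpha f_2,\ \bar v_1-\bar\alpha\bar u_2,\ \bar v_2\bar u_1-\bar v_1\bar u_2+\bar u_2(\bar f_1-\lambda\bar u_1)+\bar\alpha\bar u_2(\bar u_2-\mu\bar f_2),\ g_2f_1-\bar\lambda v_1f_2-\bar\mu\alpha f_2g_2+\alpha v_2f_2$. (13) $\bar f_1-\bar\lambda\bar u_1,\ g_1-\lambda v_1,\ g_1-\bar\mu f_1,\ \bar v_1-\mu\bar u_1,\ \bar u_1-\bar\alpha(\bar f_2-\mu\bar u_2),\ v_1-\alpha(g_2-\bar\mu v_2),\ f_1-\alpha(\lambda f_2-g_2),\ \bar u_1-\bar\alpha(\bar\lambda\bar u_2-\bar v_2),\ \bar u_2\bar f_1-\bar v_1\bar u_2+\bar\alpha(\bar v_2-\bar\lambda\bar u_2)(\bar f_2-\mu\bar u_2),\ v_1g_2-g_2f_1+\alpha(g_2-\bar\mu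 v_2)(\lambda f_2-g_2)$. (14) $\bar u_1-\bar\lambda\bar f_1,\ v_1-\lambda g_1,\ g_1-\bar\mu f_1,\ \bar v_1-\mu\bar u_1,\ \bar f_1-\bar\alpha(\bar f_2-\mu\bar u_2),\ g_1-\alpha(g_2-\bar\mu v_2),\ f_1-\alpha(f_2-\lambda g_2),\ \bar u_1-\bar\alpha(\bar u_2-\bar\lambda\bar v_2),\ (\bar f_1-\bar v_1)\bar u_2+\bar\alpha(\bar\lambda\bar v_2-\bar u_2)(\bar f_2-\mu\bar u_2),\ (v_1-f_1)g_2+\alpha(g_2-\bar\mu v_2)(f_2-\lambda g_2)$. (15) $f_2-\bar\lambda g_2,\ \bar u_2-\lambda\bar v_2,\ g_1-\bar\mu f_1,\ \bar v_1-\mu\bar u_1,\ \lambda\bar f_1-\bar u_1-\bar\alpha(\bar f_2-\mu\bar u_2),\ \bar\lambda g_1-v_1-\alpha(g_2-\bar\mu v_2),\ f_1-\alpha g_2,\ \bar u_1-\bar\alpha\bar v_2,\ \bar v_1\bar u_2-\lambda\bar f_1\bar v_2-\bar\alpha\bar v_2(\mu\bar u_2-\bar f_2),\ g_1f_2-g_2f_1+(v_1-\bar\lambda g_1)g_2+\alpha g_2(g_2-\bar\mu v_2)$. (16) $g_2-\bar\lambda f_2,\ \bar v_2-\lambda\bar u_2,\ g_1-\bar\mu f_1,\ \bar v_1-\mu\bar u_1,\ \bar f_1-\lambda\bar u_1-\bar\alpha(\bar f_2-\mu\bar u_2),\ g_1-\bar\lambda v_1-\alpha(g_2-\bar\mu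 v_2),\ f_1-\alpha f_2,\ \bar u_1-\bar\alpha\bar u_2,\ \bar u_1\bar v_2-\bar v_1\bar u_2+\bar u_2(\bar f_1-\lambda\bar u_1)+\bar\alpha\bar u_2(\mu\bar u_2-\bar f_2),\ f_1g_2-\bar\lambda v_1f_2+\alpha f_2(\bar\mu v_2-g_2)$.
   Context: $L^2$ and $L^\infty$ are the Lebesgue spaces of the unit circle $\mathbb T$ with normalized Lebesgue measure. $H^2\subset L^2$ is the Hardy space (functions whose negative Fourier coefficients vanish), $P_+$ is the orthogonal projection of $L^2$ onto $H^2$, $P_-=I-P_+$, and $H^\infty=L^\infty\cap H^2$. A bar denotes complex conjugation. For $x\in L^2$, $x_-=P_-x$. $V$ is the anti-unitary operator on $L^2$ given by $Vx=\bar z\bar x$; $V(x)_-$ means $V(P_-x)$. For vectors $p,q$ in a Hilbert space, $p\otimes q$ is the operator $x\mapsto\langle x,q\rangle p$; columns $\begin{bmatrix} x\\ y\end{bmatrix}$ with $x,y\in L^2$ are vectors of $L^2\oplus L^2$. For $H=\begin{bmatrix} f&u\\ g&v\end{bmatrix}$ with entries in $L^\infty$, the generalized Cauchy singular integral operator with symbol $H$ is the operator on $L^2$ given by $R_Hx=P_+fP_+x+P_-gP_+x+P_+uP_-x+P_-vP_-x$. *)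

(* Defs.v *)
From HB Require Import structures.
From mathcomp Require Import all_boot all_order all_algebra.
From mathcomp Require Import all_classical all_reals all_analysis.
From mathcomp Require Import complex.

Set Implicit Arguments.
Unset Strict Implicit.
Unset Printing Implicit Defensive.

Import Order.TTheory GRing.Theory Num.Theory.

Local Open Scope classical_set_scope.
Local Open Scope ring_scope.
Local Open Scope complex_scope.

Definition circle (R : realType) := {z : R[i] | `|z| == 1}.

HB.instance Definition _ (R : realType) := SubType.on (circle R).
HB.instance Definition _ (R : realType) := Choice.on (circle R).

Section Circle.
Context {R : realType}.

Lemma expi_subproof (t : R) :
  `|cos (2 * pi * t) +i* sin (2 * pi * t)| == 1 :> R[i].
Proof. by rewrite normc_def /= cos2Dsin2 sqrtr1. Qed.

(* t |-> exp (2 i pi t) *)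
Definition expi (t : R) : circle R :=
  exist (fun z : R[i] => `|z| == 1) _ (expi_subproof t).

HB.instance Definition _ := isPointed.Build (circle R) (expi 0).

(* A is measurable iff its preimage by expi is Borel; since expi restricts to
   a Borel isomorphism from [0, 1[, these are the Borel sets of the circle. *)
Definition circle_measurable : set_system (circle R) :=
  image_set_system setT expi (measurable : set_system (measurableTypeR R)).

Let circle_sigma_algebra : sigma_algebra setT circle_measurable.
Proof. exact/sigma_algebra_image/sigma_algebra_measurable. Qed.

Let circle_measurable0 : circle_measurable set0.
Proof. by case: circle_sigma_algebra. Qed.

Let circle_measurableC A : circle_measurable A -> circle_measurable (~` A).
Proof.
by case: circle_sigma_algebra => _ mC _ /mC; rewrite setTD.
Qed.

Let circle_measurable_bigcup (F : (set (circle R))^nat) :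
  (forall i, circle_measurable (F i)) -> circle_measurable (\bigcup_i F i).
Proof. by case: circle_sigma_algebra => _ _; exact. Qed.

Definition circle_display : measure_display.
Proof. by constructor. Qed.

HB.instance Definition _ :=
  @isMeasurable.Build circle_display (circle R) circle_measurable
    circle_measurable0 circle_measurableC circle_measurable_bigcup.

Lemma measurable_expi :
  measurable_fun [set: measurableTypeR R] (expi : measurableTypeR R -> circle R).
Proof. by move=> _ A. Qed.

(* normalized Lebesgue measure: image of Lebesgue measure on [0, 1[ by expi *)
Definition mcircle : set (circle R) -> \bar R :=
  pushforward (mrestr (@lebesgue_measure R) (measurable_itv `[0, 1[)) expi.

Let mcircle0 : mcircle set0 = 0%E.
Proof. by rewrite /mcircle /pushforward preimage_set0 measure0. Qed.

Let mcircle_ge0 A : (0 <= mcircle A)%E.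
Proof. exact: measure_ge0. Qed.

Let mcircle_sigma_additive : semi_sigma_additive mcircle.
Proof.
have mexpi := measurable_expi; exact: measure_semi_sigma_additive.
Qed.

HB.instance Definition _ := isMeasure.Build _ _ _ mcircle
  mcircle0 mcircle_ge0 mcircle_sigma_additive.

Let mcircle_setT : mcircle [set: circle R] = 1%E.
Proof.
rewrite /mcircle /pushforward preimage_setT /mrestr setTI.
by rewrite lebesgue_measure_itv/= lte_fin ltr01 oppr0 adde0.
Qed.

HB.instance Definition _ := Measure_isProbability.Build _ _ _ mcircle
  mcircle_setT.

End Circle.

Section Hardy.
Context {R : realType}.
Local Notation T := (circle R).
Local Notation C := R[i].
Implicit Types f g x y : T -> C.

(* Elements of the Lebesgue spaces are represented by functions; equality in
   these spaces is equality almost everywhere. *)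
Definition ae_equal f g : Prop := \forall z \ae mcircle, f z = g z.

Definition modulus f : T -> R := fun z => Normc.normc (f z).

Definition Lspace (p : \bar R) : set (T -> C) :=
  [set f | [/\ measurable_fun setT (fun z => complex.Re (f z)),
               measurable_fun setT (fun z => complex.Im (f z)) &
               ('N[mcircle]_p[EFin \o modulus f] < +oo)%E]].

Definition L2 : set (T -> C) := Lspace 2%:E.
Definition Linfty : set (T -> C) := Lspace +oo%E.

Definition cintegral f : C :=
  (\int[mcircle]_z complex.Re (f z)) +i* (\int[mcircle]_z complex.Im (f z)).

Definition bar f : T -> C := fun z => (f z)^*.

Definition inner f g : C := cintegral (f * bar g).

Definition zcoord : T -> C := fun z => val z.

Definition fourier f (n : int) : C := inner f (fun z => zcoord z ^ n).

Definition Hardy2 : set (T -> C) :=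
  [set f | L2 f /\ forall n : int, n < 0 -> fourier f n = 0].

Definition Hinfty : set (T -> C) := Linfty `&` Hardy2.

(* Pplus x is (a representative of) the point of Hardy2 such that x - Pplus x
   is orthogonal to Hardy2; the default value 0 is only used when x is not in L2. *)
Definition Pplus x : T -> C :=
  xget 0 [set y | Hardy2 y /\ forall h, Hardy2 h -> inner (x - y) h = 0].

Definition Pminus x : T -> C := x - Pplus x.

Definition V x : T -> C := bar zcoord * bar x.

(* H = [f u; g v] *)
Definition cauchyR (H : 'M[T -> C]_2) x : T -> C :=
  Pplus (H 0 0 * Pplus x) + Pminus (H 1 0 * Pplus x) +
  Pplus (H 0 1 * Pminus x) + Pminus (H 1 1 * Pminus x).

(* the Hilbert space L2 (+) L2; columns [x; y] are pairs (x, y) *)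
Local Notation T2 := ((T -> C) * (T -> C))%type.

Definition L2L2 : set T2 := [set p | L2 p.1 /\ L2 p.2].

Definition ae_equal2 (p q : T2) : Prop :=
  ae_equal p.1 q.1 /\ ae_equal p.2 q.2.

Definition inner2 (p q : T2) : C := inner p.1 q.1 + inner p.2 q.2.

Definition tensor (p q : T2) : T2 -> T2 := fun r => inner2 r q *: p.

(* the range of A, as a linear map on L2 (+) L2, is one-dimensional *)
Definition rank_one (A : T2 -> T2) : Prop :=
  exists2 p, L2L2 p /\ ~ ae_equal2 p 0 &
    forall q, L2L2 q ->
      (exists2 r, L2L2 r & ae_equal2 q (A r)) <->
      (exists c : C, ae_equal2 q (c *: p)).

Definition all_Hinfty (s : seq (T -> C)) : Prop :=
  foldr (fun f P => Hinfty f /\ P) True s.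

End Hardy.

(* Main.v *)
Require Import Defs.
From mathcomp Require Import all_boot all_order all_algebra.
From mathcomp Require Import all_classical all_reals all_analysis.
From mathcomp Require Import measurable_realfun ess_sup_inf complex.
From mathcomp Require Import ring lra zify.
Import Order.TTheory GRing.Theory Num.Theory.
Local Open Scope classical_set_scope.
Local Open Scope ring_scope.
Local Open Scope complex_scope.

Set Implicit Arguments.
Unset Strict Implicit.
Unset Printing Implicit Defensive.

(** Split L2 into the Hardy space and its orthogonal complement, and index the
two summands [Hs s] by a boolean, [true] for the Hardy space.  The theorem
compares the two products of the operators with symbols H1 and H2 block by
block: the block in row r and column t of a product is x |-> P_r (sum over u of
H1(r,u) P_u (H2(u,t) x)), and the operators commute iff each difference of two
such blocks vanishes ([commute_blocks]).  One of the two inner projections can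
be replaced by the identity minus the other one; so, up to a sign, a block of
the commutator is a combination of four sandwich products a P_s(b x), with s
opposite to r, plus a multiplication operator ([mix_sandwich]).

Commutation gives the equation between operators on pairs: P_s commutes with
multiplication by z or its inverse up to an operator of rank one
([proj_outward]).  Subtracting the block relation at x, multiplied by this
character, from the relation at the shifted vector removes the multiplication
operator and leaves a combination of rank one terms whose vectors are the
images of a constant or of the inverse of z under the Hankel operators of the
symbols: these are the entries of the columns in the theorem
([blocks_tensor]).

Now linear algebra takes over.  If a difference of two tensors has rank one,
then one of its left vectors is a multiple of the other, or one of its right
vectors is a multiple of the other ([rank_one_form]); this makes four cases for
each side of the equation, hence sixteen lists, with one constant for each side.
In each case the difference is a single tensor, and equal nonzero tensors have
proportional factors, which gives the third constant ([rank_one_forms]).  A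
bounded symbol whose Hankel vector vanishes is a multiplier of the opposite
summand ([hankel_edge_eq0]); so all these proportionalities say that the eight
linear functions of a list belong to the Hardy algebra ([vectors_compatible]).

Conversely, and also to find the last two functions, assume these eight
memberships.  A sandwich product whose left symbol is a multiplier of [Hs s]
takes its values in [Hs s], and one whose right symbol is a multiplier of the
source is trivial or a plain product.  Hence the commutator reduces to
multiplication by an explicit function on the two blocks with s = t and to zero
on the two others ([sandwich_symbol]), and it vanishes iff these two functions
are multipliers of the respective summands ([blocks_symbol]).  In each of the
sixteen cases they are, up to sign and conjugation, the last two functions of
the list.

The projections are defined by orthogonality.  That they exist, and that the
complement of the Hardy space is described by Fourier coefficients, rests on
the completeness of L2 ([L2_complete]) and of the trigonometric system
([coef_free_eq0]). *)

(** * Square-integrable functions on the circle *)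

Section CircleIntegral.
Context {R : realType}.
Local Notation T := (circle R).
Local Notation C := R[i].
Local Notation mu := (@mcircle R).
Local Notation cj := (@conjc R).
Implicit Types f g x y : T -> C.

Definition cmeas f := measurable_fun setT (fun z => complex.Re (f z)) /\
  measurable_fun setT (fun z => complex.Im (f z)).

Definition sqn (c : C) : R := complex.Re c ^+ 2 + complex.Im c ^+ 2.

Lemma sqn_ge0 c : 0 <= sqn c.
Proof. by rewrite addr_ge0 ?sqr_ge0. Qed.

Lemma sqnM c d : sqn (c * d) = sqn c * sqn d.
Proof. by case: c d => [a b] [a' b']; rewrite /sqn /=; ring. Qed.

Lemma normc_sqr c : Normc.normc c ^+ 2 = sqn c.
Proof. by case: c => a b; rewrite /sqn /= sqr_sqrtr ?addr_ge0 ?sqr_ge0. Qed.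

Lemma ReD (c d : C) : complex.Re (c + d) = complex.Re c + complex.Re d.
Proof. by case: c d => ? ? []. Qed.
Lemma ImD (c d : C) : complex.Im (c + d) = complex.Im c + complex.Im d.
Proof. by case: c d => ? ? []. Qed.
Lemma ReN (c : C) : complex.Re (- c) = - complex.Re c.
Proof. by case: c. Qed.
Lemma ImN (c : C) : complex.Im (- c) = - complex.Im c.
Proof. by case: c. Qed.
Lemma ReM (c d : C) : complex.Re (c * d) =
  complex.Re c * complex.Re d - complex.Im c * complex.Im d.
Proof. by case: c d => ? ? []. Qed.
Lemma ImM (c d : C) : complex.Im (c * d) =
  complex.Re c * complex.Im d + complex.Im c * complex.Re d.
Proof. by case: c d => ? ? []. Qed.
Lemma ReJ (c : C) : complex.Re (cj c) = complex.Re c.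
Proof. by case: c. Qed.
Lemma ImJ (c : C) : complex.Im (cj c) = - complex.Im c.
Proof. by case: c. Qed.
Lemma complex_eqP (c d : C) : complex.Re c = complex.Re d ->
  complex.Im c = complex.Im d -> c = d.
Proof. by case: c d => ? ? [? ?] /= -> ->. Qed.

Lemma sqnJ c : sqn (cj c) = sqn c.
Proof. by rewrite /sqn ReJ ImJ sqrrN. Qed.

Lemma cmeas_cst c : cmeas (fun=> c).
Proof. by split; exact: measurable_cst. Qed.

Lemma cmeasD f g : cmeas f -> cmeas g -> cmeas (f + g).
Proof.
move=> [f1 f2] [g1 g2]; split.
- under eq_fun do rewrite ReD; exact: measurable_funD.
- under eq_fun do rewrite ImD; exact: measurable_funD.
Qed.

Lemma cmeasM f g : cmeas f -> cmeas g -> cmeas (f * g).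
Proof.
move=> [f1 f2] [g1 g2]; split.
- under eq_fun do rewrite ReM.
  by apply: measurable_funB; exact: measurable_funM.
- under eq_fun do rewrite ImM.
  by apply: measurable_funD; exact: measurable_funM.
Qed.

Lemma cmeas_bar f : cmeas f -> cmeas (bar f).
Proof.
move=> [f1 f2]; split.
- by under eq_fun do rewrite ReJ.
- under eq_fun do rewrite ImJ; exact: measurableT_comp.
Qed.

Lemma cmeasZ c f : cmeas f -> cmeas (c *: f).
Proof. by move=> mf; apply: (cmeasM (cmeas_cst c) mf). Qed.

Lemma cmeas_sqn f : cmeas f -> measurable_fun setT (fun z => sqn (f z)).
Proof. by move=> [f1 f2]; apply: measurable_funD; exact: measurable_funX. Qed.

Lemma L2P f : L2 f <-> cmeas f /\
  mu.-integrable setT (EFin \o (fun z => sqn (f z))).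
Proof.
have E : ((\int[mu]_z `|(EFin \o modulus f) z| `^ 2)%E =
         \int[mu]_z `|(sqn (f z))%:E|)%E.
  apply: eq_integral => z _ /=.
  rewrite (ger0_norm (sqn_ge0 _)) -normc_sqr powR_mulrn ?normr_ge0 //.
  by rewrite real_normK ?num_real.
split.
- move=> [f1 f2 N]; split=> //.
  apply/integrableP; split.
    by apply/measurable_EFinP; apply: cmeas_sqn.
  rewrite -[ltLHS]E -(@poweR_Lnorm _ _ _ mu) ?pnatr_eq0 //.
  by apply: poweR_lty.
- move=> [[f1 f2] /integrableP[_ N]]; split=> //.
  rewrite unlock /Lnorm; apply: poweR_lty; rewrite E.
  exact: N.
Qed.

Lemma LinftyP f : Linfty f <-> cmeas f /\
  exists M : R, \forall z \ae mu, sqn (f z) <= M.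
Proof.
have mu0 : (0 < mu setT)%E by rewrite probability_setT.
split.
- move=> [f1 f2]; rewrite unlock /= mu0 => N; split=> //.
  have [M HM] : exists M : R, (ess_sup mu (abse \o (EFin \o modulus f)) <= M%:E)%E.
    by move: N; case: ess_sup => [r _|//|_]; [exists r | exists 0; rewrite leNye].
  exists (M ^+ 2); move/ess_supP: HM; apply: filterS => z /=.
  rewrite lee_fin => le; rewrite -normc_sqr.
  have m0 : 0 <= Normc.normc (f z) by case: (f z) => ? ? /=; exact: sqrtr_ge0.
  by rewrite ler_pXn2r // ?nnegrE ?(le_trans _ le) // -[leLHS]ger0_norm.
- move=> [[f1 f2] [M HM]]; split=> //; rewrite unlock /= mu0.
  apply: (@le_lt_trans _ _ (Num.sqrt M)%:E); last exact: ltry.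
  apply/ess_supP; move: HM; apply: filterS => z /= le.
  rewrite lee_fin ger0_norm; last by rewrite /modulus; case: (f z) => ? ? /=; exact: sqrtr_ge0.
  rewrite /modulus; have -> : Normc.normc (f z) = Num.sqrt (sqn (f z)).
    by case: (f z).
  by rewrite ler_wsqrtr.
Qed.

End CircleIntegral.

Section CircleL2.
Context {R : realType}.
Local Notation T := (circle R).
Local Notation C := R[i].
Local Notation mu := (@mcircle R).
Local Notation cj := (@conjc R).
Implicit Types f g x y w : T -> C.
Implicit Types (h k : T -> R).

Definition rint h := mu.-integrable setT (EFin \o h).

Lemma rint_meas h : rint h -> measurable_fun setT h.
Proof. by move=> /(measurable_int mu)/measurable_EFinP. Qed.

Lemma rintD h k : rint h -> rint k -> rint (fun z => h z + k z).
Proof. by move=> ih ik; apply: (integrableD _ ih ik). Qed.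

Lemma rintZ c h : rint h -> rint (fun z => c * h z).
Proof. by move=> ih; apply: (integrableZl _ _ ih). Qed.

Lemma rint_ae_le h k : measurable_fun setT h ->
  (\forall z \ae mu, `|h z| <= k z) -> rint k -> rint h.
Proof.
move=> mh hk ik; have /integrableP[mk Ik] := ik.
apply/integrableP; split; first exact/measurable_EFinP.
apply: le_lt_trans Ik; apply: ae_ge0_le_integral => //.
- by apply/measurable_EFinP; exact: measurableT_comp.
- by apply/measurable_EFinP; apply: measurableT_comp => //; exact/measurable_EFinP.
- move: hk; apply: filterS => z /= hz _; rewrite lee_fin.
  by rewrite (le_trans hz) // ler_norm.
Qed.

Lemma rint_le h k : measurable_fun setT h ->
  (forall z, `|h z| <= k z) -> rint k -> rint h.
Proof. by move=> mh hk; apply: rint_ae_le => //; exact: aeW. Qed.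

Lemma rint_cst c : rint (fun=> c).
Proof. exact: finite_measure_integrable_cst. Qed.

Lemma Rintegral_ae h k : measurable_fun setT h -> measurable_fun setT k ->
  (\forall z \ae mu, h z = k z) -> \int[mu]_z h z = \int[mu]_z k z.
Proof.
move=> mh mk hk; congr fine; apply: ae_eq_integral => //; try exact/measurable_EFinP.
by move: hk; apply: filterS => z /= -> _.
Qed.

Definition cint f := rint (fun z => complex.Re (f z)) /\
  rint (fun z => complex.Im (f z)).

Lemma cint_meas f : cint f -> cmeas f.
Proof. by move=> [/rint_meas ? /rint_meas ?]. Qed.

Lemma cintegralD f g : cint f -> cint g ->
  cintegral (f + g) = cintegral f + cintegral g.
Proof.
move=> [f1 f2] [g1 g2]; apply: complex_eqP; rewrite ?ReD ?ImD /=.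
- by rewrite -RintegralD //; apply: eq_Rintegral => z _; rewrite -ReD.
- by rewrite -RintegralD //; apply: eq_Rintegral => z _; rewrite -ImD.
Qed.

Lemma cintegralZ c f : cint f -> cintegral (c *: f) = c * cintegral f.
Proof.
move=> [f1 f2]; apply: complex_eqP; rewrite ?ReM ?ImM /=.
- rewrite -!RintegralZl // -RintegralB //; try exact: rintZ.
  by apply: eq_Rintegral => z _; rewrite -ReM.
- rewrite -!RintegralZl // -RintegralD //; try exact: rintZ.
  by apply: eq_Rintegral => z _; rewrite -ImM.
Qed.

Lemma cintegral_bar f : cint f -> cintegral (bar f) = cj (cintegral f).
Proof.
move=> [f1 f2]; apply: complex_eqP; rewrite ?ReJ ?ImJ /=.
- by apply: eq_Rintegral => z _; exact: ReJ.
- rewrite -mulN1r -RintegralZl //.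
  by apply: eq_Rintegral => z _; rewrite mulN1r; exact: ImJ.
Qed.

Lemma cintegral_ae f g : cmeas f -> cmeas g -> ae_equal f g ->
  cintegral f = cintegral g.
Proof.
move=> [f1 f2] [g1 g2] fg; apply: complex_eqP => /=; apply: Rintegral_ae => //.
all: by move: fg; rewrite /ae_equal; apply: filterS => z ->.
Qed.

Lemma L2_meas x : L2 x -> cmeas x. Proof. by move=> /L2P[]. Qed.
Lemma L2_int x : L2 x -> rint (fun z => sqn (x z)). Proof. by move=> /L2P[]. Qed.
Lemma Linfty_meas x : Linfty x -> cmeas x. Proof. by move=> /LinftyP[]. Qed.

Lemma normRe_le (c d : C) : `|complex.Re (c * d)| <= sqn c + sqn d.
Proof.
case: c d => [a b] [a' b']; rewrite /sqn /= ler_norml.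
have := (sqr_ge0 (a - a'), sqr_ge0 (a + a'), (sqr_ge0 (b - b'), sqr_ge0 (b + b'))).
by move=> [[h1 h2] [h3 h4]]; apply/andP; split; lra.
Qed.

Lemma normIm_le (c d : C) : `|complex.Im (c * d)| <= sqn c + sqn d.
Proof.
case: c d => [a b] [a' b']; rewrite /sqn /= ler_norml.
have := (sqr_ge0 (a - b'), sqr_ge0 (a + b'), (sqr_ge0 (b - a'), sqr_ge0 (b + a'))).
by move=> [[h1 h2] [h3 h4]]; apply/andP; split; lra.
Qed.

Lemma L2_cintM x y : L2 x -> L2 y -> cint (x * y).
Proof.
move=> Lx Ly; have [m1 m2] := cmeasM (L2_meas Lx) (L2_meas Ly).
have i := rintD (L2_int Lx) (L2_int Ly).
by split; apply: rint_le i => // z; [exact: normRe_le|exact: normIm_le].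
Qed.

Lemma sqnD_le (c d : C) : sqn (c + d) <= 2 * (sqn c + sqn d).
Proof.
case: c d => [a b] [a' b']; rewrite /sqn /=.
by have := (sqr_ge0 (a - a'), sqr_ge0 (b - b')); move=> [h1 h2]; lra.
Qed.

Lemma L2D x y : L2 x -> L2 y -> L2 (x + y).
Proof.
move=> Lx Ly; have m := cmeasD (L2_meas Lx) (L2_meas Ly).
apply/L2P; split=> //.
apply: rint_le (rintZ 2 (rintD (L2_int Lx) (L2_int Ly))).
  exact: cmeas_sqn.
by move=> z; rewrite ger0_norm ?sqn_ge0 // sqnD_le.
Qed.

Lemma Linfty_L2M x y : Linfty x -> L2 y -> L2 (x * y).
Proof.
move=> /LinftyP[mx [M HM]] Ly; have m := cmeasM mx (L2_meas Ly).
apply/L2P; split=> //.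
apply: rint_ae_le (rintZ M (L2_int Ly)); first exact: cmeas_sqn.
move: HM; apply: filterS => z le.
by rewrite ger0_norm ?sqn_ge0 // sqnM ler_wpM2r // sqn_ge0.
Qed.

Lemma Linfty_cst c : Linfty (fun=> c : C).
Proof.
by apply/LinftyP; split; [exact: cmeas_cst|exists (sqn c); exact: aeW].
Qed.

Lemma LinftyM x y : Linfty x -> Linfty y -> Linfty (x * y).
Proof.
move=> /LinftyP[mx [M HM]] /LinftyP[my [N HN]]; apply/LinftyP; split.
  exact: cmeasM.
exists (M * N); move: HM HN; apply: filterS2 => z le1 le2.
by rewrite sqnM ler_pM ?sqn_ge0.
Qed.

Lemma LinftyD x y : Linfty x -> Linfty y -> Linfty (x + y).
Proof.
move=> /LinftyP[mx [M HM]] /LinftyP[my [N HN]]; apply/LinftyP; split.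
  exact: cmeasD.
exists (2 * (M + N)); move: HM HN; apply: filterS2 => z le1 le2.
by rewrite (le_trans (sqnD_le _ _)) // ler_pM2l // lerD.
Qed.

Lemma LinftyZ c x : Linfty x -> Linfty (c *: x).
Proof. by move=> Lx; apply: (LinftyM (Linfty_cst c) Lx). Qed.

Lemma LinftyN x : Linfty x -> Linfty (- x).
Proof. by rewrite -scaleN1r; exact: LinftyZ. Qed.

Lemma Linfty_bar x : Linfty x -> Linfty (bar x).
Proof.
move=> /LinftyP[mx [M HM]]; apply/LinftyP; split; first exact: cmeas_bar.
by exists M; move: HM; apply: filterS => z; rewrite sqnJ.
Qed.

Lemma L2_cst c : L2 (fun=> c : C).
Proof. by apply/L2P; split; [exact: cmeas_cst|exact: rint_cst]. Qed.

Lemma Linfty_L2 x : Linfty x -> L2 x.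
Proof.
by move=> Lx; rewrite -[x]mulr1; apply: Linfty_L2M => //; exact: (L2_cst 1).
Qed.

Lemma L2_0 : L2 (0 : T -> C). Proof. exact: (L2_cst 0). Qed.

Lemma L2Z c x : L2 x -> L2 (c *: x).
Proof. by move=> Lx; apply: (Linfty_L2M (Linfty_cst c) Lx). Qed.

Lemma L2N x : L2 x -> L2 (- x).
Proof. by rewrite -scaleN1r; exact: L2Z. Qed.

Lemma L2B x y : L2 x -> L2 y -> L2 (x - y).
Proof. by move=> Lx Ly; apply: L2D => //; exact: L2N. Qed.

Lemma L2_bar x : L2 x -> L2 (bar x).
Proof.
move=> Lx; apply/L2P; split; first by apply: cmeas_bar; exact: L2_meas.
rewrite (_ : (fun _ => _) = (fun z => sqn (x z))); first exact: L2_int.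
by apply/funext => z; rewrite sqnJ.
Qed.

Lemma L2_sum (I : Type) (s : seq I) (P : pred I) (F : I -> T -> C) :
  (forall i, L2 (F i)) -> L2 (\sum_(i <- s | P i) F i).
Proof.
by move=> L; elim/big_ind: _ => [|x y|i _]; [exact: L2_0|exact: L2D|exact: L].
Qed.

Lemma conjD (c d : C) : cj (c + d) = cj c + cj d. Proof. exact: rmorphD. Qed.
Lemma conjM (c d : C) : cj (c * d) = cj c * cj d. Proof. exact: rmorphM. Qed.
Lemma conjN (c : C) : cj (- c) = - cj c. Proof. exact: rmorphN. Qed.

Lemma barD x y : bar (x + y) = bar x + bar y.
Proof. by apply/funext => z; rewrite /bar /= rmorphD. Qed.
Lemma barM x y : bar (x * y) = bar x * bar y.
Proof. by apply/funext => z; rewrite /bar /= rmorphM. Qed.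
Lemma barK x : bar (bar x) = x.
Proof. by apply/funext => z; rewrite /bar conjcK. Qed.
Lemma barN x : bar (- x) = - bar x.
Proof. by apply/funext => z; rewrite /bar /= rmorphN. Qed.
Lemma barZ c x : bar (c *: x) = cj c *: bar x.
Proof. by apply/funext => z; rewrite /bar /= rmorphM. Qed.

Lemma inner_cint x y : L2 x -> L2 y -> cint (x * bar y).
Proof. by move=> Lx Ly; apply: L2_cintM => //; exact: L2_bar. Qed.

Lemma innerDl x y w : L2 x -> L2 y -> L2 w ->
  inner (x + y) w = inner x w + inner y w.
Proof. by move=> *; rewrite /inner mulrDl cintegralD //; exact: inner_cint. Qed.

Lemma innerZl c x w : L2 x -> L2 w -> inner (c *: x) w = c * inner x w.
Proof.
move=> *; rewrite /inner -cintegralZ; last exact: inner_cint.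
by congr cintegral; apply/funext => z; rewrite !fctE /= -scalerAl.
Qed.

Lemma innerC x y : L2 x -> L2 y -> inner y x = cj (inner x y).
Proof.
move=> *; rewrite /inner -cintegral_bar; last exact: inner_cint.
by rewrite barM barK mulrC.
Qed.

Lemma innerDr x y w : L2 x -> L2 y -> L2 w ->
  inner w (x + y) = inner w x + inner w y.
Proof.
move=> Lx Ly Lw; rewrite (innerC (L2D Lx Ly) Lw) (innerDl Lx Ly Lw) conjD.
by rewrite (innerC Lx Lw) (innerC Ly Lw).
Qed.

Lemma innerZr c x w : L2 x -> L2 w -> inner w (c *: x) = cj c * inner w x.
Proof.
by move=> Lx Lw; rewrite (innerC (L2Z c Lx) Lw) (innerZl c Lx Lw) conjM (innerC Lx Lw).
Qed.

Lemma innerNl x w : L2 x -> L2 w -> inner (- x) w = - inner x w.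
Proof. by move=> *; rewrite -scaleN1r innerZl // mulN1r. Qed.

Lemma innerNr x w : L2 x -> L2 w -> inner w (- x) = - inner w x.
Proof. by move=> *; rewrite -scaleN1r innerZr // conjN conjc1 mulN1r. Qed.

Lemma innerBl x y w : L2 x -> L2 y -> L2 w ->
  inner (x - y) w = inner x w - inner y w.
Proof. by move=> *; rewrite innerDl ?innerNl //; exact: L2N. Qed.

Lemma innerBr x y w : L2 x -> L2 y -> L2 w ->
  inner w (x - y) = inner w x - inner w y.
Proof. by move=> *; rewrite innerDr ?innerNr //; exact: L2N. Qed.

Lemma inner0l w : inner 0 w = 0.
Proof.
rewrite /inner mul0r; apply: complex_eqP => /=; rewrite /Rintegral.
all: by under eq_integral do rewrite /=; rewrite integral0.
Qed.

Lemma innerMl a x y : inner (a * x) y = inner x (bar a * y).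
Proof. by rewrite /inner barM barK mulrA (mulrC x). Qed.

Lemma inner_ae x x' y y' : L2 x -> L2 x' -> L2 y -> L2 y' ->
  ae_equal x x' -> ae_equal y y' -> inner x y = inner x' y'.
Proof.
move=> Lx Lx' Ly Ly' xx' yy'; apply: cintegral_ae.
- exact/cint_meas/inner_cint.
- exact/cint_meas/inner_cint.
by move: xx' yy'; apply: filterS2 => z xz yz; rewrite /= /bar /= !fctE xz yz.
Qed.

Lemma inner_suml (I : Type) (s : seq I) (P : pred I) (F : I -> T -> C) w :
  (forall i, L2 (F i)) -> L2 w ->
  inner (\sum_(i <- s | P i) F i) w = \sum_(i <- s | P i) inner (F i) w.
Proof.
move=> LF Lw; elim: s => [|i s IH]; first by rewrite !big_nil inner0l.
rewrite !big_cons; case: ifP => // _; rewrite innerDl ?IH //.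
exact: L2_sum.
Qed.

Definition normsq x : R := \int[mu]_z sqn (x z).

Lemma normsq_ge0 x : 0 <= normsq x .
Proof. by apply: Rintegral_ge0 => z _; exact: sqn_ge0. Qed.

Lemma innerxx x : inner x x = (normsq x)%:C.
Proof.
rewrite /inner /normsq; apply: complex_eqP => /=; rewrite /Rintegral.
- congr fine; apply: eq_integral => z _; congr (_%:E); rewrite /bar fctE.
  by case: (x z) => a b; rewrite /sqn /=; ring.
- under eq_integral => z _.
    rewrite (_ : complex.Im _ = 0); last first.
      by rewrite /bar fctE; case: (x z) => a b /=; ring.
    over.
  by rewrite integral0.
Qed.

Lemma normsq_eq0 x : L2 x -> normsq x = 0 -> ae_equal x 0.
Proof.
move=> Lx n0; have i := L2_int Lx.
have : (\int[mu]_z `|(sqn (x z))%:E| = 0)%E.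
  have -> : (\int[mu]_z `|(sqn (x z))%:E| = \int[mu]_z ((sqn (x z))%:E))%E.
    by apply: eq_integral => z _; rewrite /= ger0_norm // sqn_ge0.
  have := n0; rewrite /normsq /Rintegral => /eqP; rewrite fine_eq0.
    by move/eqP.
  exact: integrable_fin_num i.
move/ae_eq_integral_abs => /(_ measurableT).
move/(_ (measurable_int _ i)); apply: filterS => z /= /(_ I) [].
rewrite /sqn => /eqP; rewrite paddr_eq0 ?sqr_ge0 // !sqrf_eq0.
by move=> /andP[/eqP a /eqP b]; apply: complex_eqP.
Qed.

Lemma ae_refl f : ae_equal f f. Proof. exact: aeW. Qed.

(** The norm of <y,y> x - <x,y> y is nonnegative. *)
Lemma cauchy_schwarz x y : L2 x -> L2 y ->
  sqn (inner x y) <= normsq x * normsq y.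
Proof.
move=> Lx Ly.
have [y0|y0] := eqVneq (normsq y) 0.
  rewrite y0 mulr0 (@inner_ae x x y 0) //; [|exact: L2_0|exact: ae_refl|exact: normsq_eq0].
  by rewrite innerC ?inner0l ?conjc0 ?/sqn /= ?expr0n ?addr0 //; exact: L2_0.
set a := normsq y; set c := inner x y.
have := innerxx (a%:C *: x - c *: y).
have La := L2Z a%:C Lx; have Lc := L2Z c Ly.
rewrite (innerBl La Lc (L2B La Lc)) (innerBr La Lc La) (innerBr La Lc Lc).
rewrite !innerZl // !innerZr // !innerxx (innerC Lx Ly) -/a -/c.
set n := normsq (_ - _); have n0 : 0 <= n by exact: normsq_ge0.
have a0 : 0 < a by rewrite lt_neqAle eq_sym y0 normsq_ge0.
move=> /(congr1 (@complex.Re R)); clearbody n; case: (c) => c1 c2.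
rewrite /sqn /= => E.
have {}E : n = a * (normsq x * a - (c1 ^+ 2 + c2 ^+ 2)).
  by rewrite -E; ring.
by move: n0; rewrite E pmulr_rge0 // subr_ge0.
Qed.

Lemma ae_sym f g : ae_equal f g -> ae_equal g f.
Proof. by apply: filterS => z ->. Qed.
Lemma ae_trans f g x : ae_equal f g -> ae_equal g x -> ae_equal f x.
Proof. by apply: filterS2 => z -> ->. Qed.
Lemma aeD f f' g g' : ae_equal f f' -> ae_equal g g' ->
  ae_equal (f + g) (f' + g').
Proof. by apply: filterS2 => z; rewrite !fctE => -> ->. Qed.
Lemma aeM f f' g g' : ae_equal f f' -> ae_equal g g' ->
  ae_equal (f * g) (f' * g').
Proof. by apply: filterS2 => z; rewrite !fctE => -> ->. Qed.
Lemma aeZ c f f' : ae_equal f f' -> ae_equal (c *: f) (c *: f').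
Proof. by apply: filterS => z; rewrite !fctE => ->. Qed.
Lemma aeN f f' : ae_equal f f' -> ae_equal (- f) (- f').
Proof. by apply: filterS => z; rewrite !fctE => ->. Qed.
Lemma aeB f f' g g' : ae_equal f f' -> ae_equal g g' ->
  ae_equal (f - g) (f' - g').
Proof. by move=> h1 h2; apply: aeD => //; exact: aeN. Qed.
Lemma ae_subr0 f g : ae_equal (f - g) 0 -> ae_equal f g.
Proof. by apply: filterS => z; rewrite !fctE => /eqP; rewrite subr_eq0 => /eqP. Qed.
Lemma ae_sub0 f g : ae_equal f g -> ae_equal (f - g) 0.
Proof. by apply: filterS => z; rewrite !fctE => ->; rewrite subrr. Qed.

End CircleL2.

(** * Completeness of L2 *)

Import numFieldNormedType.Exports.

Section Completeness.
Context {R : realType}.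
Local Notation T := (circle R).
Local Notation C := R[i].
Local Notation mu := (@mcircle R).
Implicit Types f g x y w : T -> C.

(** As |c + d|^2 is at most 2 |c|^2 + 2 |d|^2, every further step of the
telescoping sum doubles the weight of the increments that follow: hence the
weights 2^k. *)
Lemma weighted_increments (s : nat -> C) (W : R) :
  (forall N, \sum_(0 <= k < N) 2 ^+ k * sqn (s k.+1 - s k) <= W) ->
  forall n p, sqn (s (n + p)%N - s n) <= 2 * 2^-1 ^+ n * W.
Proof.
move=> HW n p.
suff H : forall p n, sqn (s (n + p)%N - s n) <=
    2 * 2^-1 ^+ n * \sum_(n <= k < n + p) 2 ^+ k * sqn (s k.+1 - s k).
  apply: (le_trans (H p n)); apply: ler_wpM2l.
    by rewrite mulr_ge0 // exprn_ge0 // invr_ge0.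
  apply: le_trans (HW (n + p)%N).
  rewrite [leRHS](big_cat_nat (n := n)) ?leq_addr //= lerDr.
  by apply: sumr_ge0 => i _; rewrite mulr_ge0 ?exprn_ge0 ?sqn_ge0.
elim=> [|{}p IH] {}n.
  by rewrite addn0 subrr big_geq // mulr0 /sqn /= expr0n addr0.
rewrite big_ltn; last by rewrite addnS ltnS leq_addr.
have -> : s (n + p.+1)%N - s n = (s n.+1 - s n) + (s (n.+1 + p)%N - s n.+1).
  by rewrite addSnnS [RHS]addrC addrA subrK.
apply: (le_trans (sqnD_le _ _)); rewrite [leLHS]mulrDr [leRHS]mulrDr.
apply: lerD.
  by rewrite !mulrA -(mulrA 2 (2^-1 ^+ n)) -exprMn mulVf // expr1n mulr1.
rewrite -mulrA ler_pM2l //; apply: (le_trans (IH n.+1)).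
by rewrite addSnnS exprS !mulrA mulfV // mul1r.
Qed.

Lemma weighted_increments_cvg (s : nat -> C) (W : R) :
  (forall N, \sum_(0 <= k < N) 2 ^+ k * sqn (s k.+1 - s k) <= W) ->
  exists c : C, [/\ (fun n => complex.Re (s n)) @ \oo --> complex.Re c,
    (fun n => complex.Im (s n)) @ \oo --> complex.Im c &
    forall n, sqn (c - s n) <= 2 * 2^-1 ^+ n * W].
Proof.
move=> HW; have inc := weighted_increments HW.
have geo : (fun n => 2 * 2^-1 ^+ n * W) @ \oo --> (0 : R).
  rewrite (_ : (fun _ => _) = geometric (2 * W) 2^-1).
    by apply: cvg_geometric; rewrite ger0_norm // ?invr_ge0 // invf_lt1 // ltr1n.
  by apply/funext => n /=; rewrite mulrAC.
(* F is the real or the imaginary part. *)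
have cau (F : C -> R) : (forall c d, F (c - d) = F c - F d) ->
    (forall c, F c ^+ 2 <= sqn c) -> cvg ((fun n => F (s n)) @ \oo).
  move=> FB Fle; apply: cauchy_cvg; apply: cauchy_exP => e e0.
  have e20 : 0 < e ^+ 2 by rewrite exprn_gt0.
  have /cvgrPdist_lt/(_ _ e20) := geo.
  case=> N _ /(_ N (leqnn N)) /=; rewrite sub0r normrN => small.
  exists (F (s N)); exists N => // m /= Nm.
  rewrite /ball /= distrC -FB -(@ltr_pXn2r _ 2) ?nnegrE ?normr_ge0 ?ltW //.
  rewrite real_normK ?num_real //; apply: le_lt_trans (Fle _) _.
  apply: le_lt_trans _ small; rewrite -(subnKC Nm).
  exact: le_trans (inc _ _) (ler_norm _).
have cR : cvg ((fun n => complex.Re (s n)) @ \oo).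
  apply: cau => [c d|c]; first by rewrite ReD ReN.
  by rewrite /sqn lerDl sqr_ge0.
have cI : cvg ((fun n => complex.Im (s n)) @ \oo).
  apply: cau => [c d|c]; first by rewrite ImD ImN.
  by rewrite /sqn lerDr sqr_ge0.
exists (lim ((fun n => complex.Re (s n)) @ \oo) +i*
        lim ((fun n => complex.Im (s n)) @ \oo)); split=> // n.
set c := _ +i* _.
have dR : (fun m => complex.Re (s m - s n)) @ \oo --> complex.Re (c - s n).
  under eq_fun do rewrite ReD ReN; rewrite ReD ReN.
  by apply: cvgD; [exact: cR|exact: cvg_cst].
have dI : (fun m => complex.Im (s m - s n)) @ \oo --> complex.Im (c - s n).
  under eq_fun do rewrite ImD ImN; rewrite ImD ImN.
  by apply: cvgD; [exact: cI|exact: cvg_cst].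
have d : (fun m => sqn (s m - s n)) @ \oo --> sqn (c - s n).
  by have := cvgD (cvgM dR dR) (cvgM dI dI); exact.
apply: (cvgr_to_le d); exists n => // m /= nm.
by rewrite -(subnKC nm).
Qed.

Lemma normsqE x : L2 x -> ((normsq x)%:E = \int[mu]_z (sqn (x z))%:E)%E.
Proof.
by move=> Lx; rewrite /normsq /Rintegral fineK //; exact: integrable_fin_num (L2_int Lx).
Qed.

Lemma sum_quarter_le n : \sum_(0 <= k < n) (4^-1 : R) ^+ k <= 2.
Proof.
suff H : \sum_(0 <= k < n) (4^-1 : R) ^+ k <= 2 - 2 * 4^-1 ^+ n.
  by apply: (le_trans H); rewrite gerBl mulr_ge0 // exprn_ge0 // invr_ge0.
elim: n => [|n IH]; first by rewrite big_geq // expr0; lra.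
rewrite big_nat_recr //= exprS.
have : 0 <= (4^-1 : R) ^+ n by rewrite exprn_ge0 // invr_ge0.
by move: IH; set q := _ ^+ n; set S := \sum_(_ <= _ < _) _; lra.
Qed.

(** The sum W of the 2^k |s_(k+1) - s_k|^2 has integral at most the sum of the
4^-k, so it is finite almost everywhere; there the sequence converges at a rate
proportional to W, and integrating this rate bounds the distance in L2. *)
Lemma L2_complete (s : nat -> T -> C) : (forall n, L2 (s n)) ->
  (forall n, normsq (s n.+1 - s n) <= 8^-1 ^+ n) ->
  exists2 y, L2 y & exists K, forall n, normsq (y - s n) <= 2 * 2^-1 ^+ n * K.
Proof.
move=> Ls Hs.
pose g k z := (2 ^+ k * sqn (s k.+1 z - s k z))%:E.
have g0 k z : (0 <= g k z)%E by rewrite lee_fin mulr_ge0 ?exprn_ge0 ?sqn_ge0.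
have Lg k : L2 (s k.+1 - s k) by exact: L2B.
have mg k : measurable_fun setT (g k).
  by apply/measurable_EFinP; apply: measurable_funM => //;
    apply: cmeas_sqn; exact: L2_meas (Lg k).
pose W z := (\sum_(0 <= k <oo) g k z)%E.
have mW : measurable_fun setT W.
  apply: ge0_emeasurable_sum => // k z _ _; exact: g0.
have W0 z : (0 <= W z)%E by apply: nneseries_ge0 => k _ _; exact: g0.
have IW : (\int[mu]_z W z <= 2%:E)%E.
  rewrite integral_nneseries //; apply: lime_le.
    by apply: is_cvg_nneseries => n _ _; apply: integral_ge0.
  apply: nearW => n; apply: le_trans (_ : ((\sum_(0 <= k < n) (4^-1 ^+ k))%:E <= _)%E).
    rewrite -sumEFin; apply: lee_sum => k _.
    rewrite /g; under eq_integral do rewrite EFinM.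
    rewrite ge0_integralZl_EFin ?exprn_ge0 //.
    + rewrite -(normsqE (Lg k)) -EFinM lee_fin.
      apply: (@le_trans _ _ (2 ^+ k * 8^-1 ^+ k)).
        by rewrite ler_pM2l ?exprn_gt0.
      by rewrite -exprMn lerXn2r ?nnegrE //; lra.
    + by move=> z _; rewrite lee_fin sqn_ge0.
    + by apply/measurable_EFinP; apply: cmeas_sqn; exact: L2_meas (Lg k).
  by rewrite lee_fin sum_quarter_le.
pose E := [set z | (W z < +oo)%E].
have mE : measurable E.
  by rewrite -[E]setTI; apply: emeasurable_fun_infty_o.
have HE z : E z -> exists r : R, W z = r%:E.
  move=> Ez; exists (fine (W z)); rewrite fineK // ge0_fin_numE //; exact: W0.
have bound z (r : R) : W z = r%:E ->
    forall N, \sum_(0 <= k < N) 2 ^+ k * sqn (s k.+1 z - s k z) <= r.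
  move=> Wr N; rewrite -lee_fin -sumEFin -Wr.
  by apply: nneseries_lim_ge => k _ _; exact: g0.
have /choice[y Hy] : forall z, exists c : C, (~ E z -> c = 0) /\
   forall r : R, W z = r%:E -> [/\ (fun n => complex.Re (s n z)) @ \oo --> complex.Re c,
    (fun n => complex.Im (s n z)) @ \oo --> complex.Im c &
    forall n, sqn (c - s n z) <= 2 * 2^-1 ^+ n * r].
  move=> z; have [Ez|nE] := pselect (E z); last first.
    by exists 0; split=> // r Wr; exfalso; apply: nE; rewrite /E /= Wr ltry.
  have [r Wr] := HE _ Ez.
  have [c Hc] := weighted_increments_cvg (bound _ _ Wr).
  by exists c; split=> // r'; rewrite Wr => -[<-].
have my : cmeas y.
  split.
  - apply: (@measurable_fun_cvg _ _ _ _ (fun n z => complex.Re (s n z) * \1_E z)).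
      move=> n; apply: measurable_funM; first by case: (L2_meas (Ls n)).
      exact: measurable_indic.
    move=> z _; have [Ez|nE] := pselect (E z).
      have [r Wr] := HE _ Ez; rewrite indicE mem_set //.
      under eq_fun do rewrite mulr1.
      by have [_ /(_ _ Wr)[]] := Hy z.
    rewrite indicE memNset //; under eq_fun do rewrite mulr0.
    by have [/(_ nE) -> _] := Hy z; exact: cvg_cst.
  - apply: (@measurable_fun_cvg _ _ _ _ (fun n z => complex.Im (s n z) * \1_E z)).
      move=> n; apply: measurable_funM; first by case: (L2_meas (Ls n)).
      exact: measurable_indic.
    move=> z _; have [Ez|nE] := pselect (E z).
      have [r Wr] := HE _ Ez; rewrite indicE mem_set //.
      under eq_fun do rewrite mulr1.
      by have [_ /(_ _ Wr)[]] := Hy z.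
    rewrite indicE memNset //; under eq_fun do rewrite mulr0.
    by have [/(_ nE) -> _] := Hy z; exact: cvg_cst.
have le n : (\int[mu]_z (sqn ((y - s n) z))%:E <= (2 * 2^-1 ^+ n * 2)%:E)%E.
  have c0 : 0 < 2 * 2^-1 ^+ n :> R by rewrite mulr_gt0 // exprn_gt0 // invr_gt0.
  apply: (@le_trans _ _ (\int[mu]_z ((2 * 2^-1 ^+ n)%:E * W z))%E).
    apply: ge0_le_integral => //.
    + by move=> z _; rewrite lee_fin sqn_ge0.
    + apply/measurable_EFinP; apply: cmeas_sqn.
      by apply: cmeasD => //; rewrite -scaleN1r; apply: cmeasZ; exact: L2_meas.
    + by apply: measurable_funeM.
    + move=> z _; have [Ez|nE] := pselect (E z).
        have [r Wr] := HE _ Ez; rewrite Wr -EFinM lee_fin.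
        by have [_ /(_ _ Wr)[_ _ ->]] := Hy z.
      have -> : W z = +oo%E.
        by apply/eqP; move/negP: nE; rewrite -leNgt leye_eq.
      by rewrite gt0_muley ?lte_fin // leey.
  rewrite ge0_integralZl_EFin ?(ltW c0) // [leRHS]EFinM.
  by apply: lee_wpmul2l => //; rewrite lee_fin ltW.
have LB n : L2 (y - s n).
  have m : cmeas (y - s n).
    by apply: cmeasD => //; rewrite -scaleN1r; apply: cmeasZ; exact: L2_meas.
  apply/L2P; split=> //; apply/integrableP; split.
    by apply/measurable_EFinP; exact: cmeas_sqn.
  under eq_integral do rewrite /= ger0_norm ?sqn_ge0 //.
  by apply: le_lt_trans (le n) _; rewrite ltry.
exists y; first by rewrite -[y](subrK (s 0)); exact: L2D.
by exists 2 => n; rewrite -lee_fin (normsqE (LB n)).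
Qed.

End Completeness.

(** * The characters of the circle *)

Section Trigonometric.
Context {R : realType}.
Local Notation T := (circle R).
Local Notation C := R[i].
Local Notation mu := (@mcircle R).
Local Notation leb := (@lebesgue_measure R).
Local Notation cj := (@conjc R).
Implicit Types (f g x y w : T -> C) (n m : int).

Definition zpow n : T -> C := fun z => zcoord z ^ n.

Lemma fourierE f n : fourier f n = inner f (zpow n). Proof. by []. Qed.

Lemma sqn_zcoord (z : T) : sqn (zcoord z) = 1.
Proof.
have /eqP := valP z; rewrite normc_def => -[] /(congr1 (fun r => r ^+ 2)).
by rewrite sqr_sqrtr ?addr_ge0 ?sqr_ge0 // expr1n.
Qed.

Lemma zcoord_neq0 (z : T) : zcoord z != 0.
Proof.
apply/eqP => z0; have := sqn_zcoord z; rewrite z0 /sqn /= expr0n addr0.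
by move/eqP; rewrite eq_sym oner_eq0.
Qed.

Lemma cj_zcoord (z : T) : cj (zcoord z) = (zcoord z)^-1.
Proof.
apply: (mulfI (zcoord_neq0 z)); rewrite divff ?zcoord_neq0 //.
apply: complex_eqP; rewrite ?ReM ?ImM ReJ ImJ /=; last by ring.
by rewrite -[RHS](sqn_zcoord z) /sqn; ring.
Qed.

Lemma zpow0 : zpow 0 = 1. Proof. by apply/funext => z; rewrite /zpow expr0z. Qed.
Lemma zpow1 : zpow 1 = zcoord. Proof. by apply/funext => z; rewrite /zpow expr1z. Qed.

Lemma zpowD n m : zpow (n + m) = zpow n * zpow m.
Proof. by apply/funext => z; rewrite /zpow expfzDr ?zcoord_neq0. Qed.

Lemma bar_zpow n : bar (zpow n) = zpow (- n).
Proof.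
apply/funext => z; rewrite /bar /zpow.
have -> : cj (zcoord z ^ n) = cj (zcoord z) ^ n.
  by apply: rmorphXz; rewrite unitfE zcoord_neq0.
by rewrite cj_zcoord exprz_inv.
Qed.

(** A function is measurable on the circle as soon as its lift to the line is,
because the measurable sets are those with measurable lift. *)
Lemma measurable_circle (h : T -> R) :
  measurable_fun setT (fun t : measurableTypeR R => h (expi t)) ->
  measurable_fun setT h.
Proof.
move=> mh _ A mA; rewrite setTI.
have := mh measurableT _ mA; rewrite setTI => mhA.
by rewrite /measurable /= /circle_measurable /image_set_system /= setTI.
Qed.

Lemma continuous_dilation (F : R -> R) (k : R) : continuous F ->
  continuous (fun t => F (k * t)).
Proof.
move=> cF t; apply: (@continuous_comp _ _ _ ( *%R k) F); last exact: cF.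
exact: mulrl_continuous.
Qed.

Lemma measurable_trig (F : R -> R) : continuous F ->
  measurable_fun setT (fun t : measurableTypeR R => F (2 * pi * t)).
Proof.
by move=> cF; apply: continuous_measurable_fun; exact: continuous_dilation.
Qed.

Lemma cmeas_zcoord : cmeas (@zcoord R).
Proof.
split; apply: measurable_circle.
- exact: (measurable_trig (@continuous_cos R)).
- exact: (measurable_trig (@continuous_sin R)).
Qed.

Lemma zpow_nat (n : nat) : zpow n = zcoord ^+ n.
Proof. by elim: n => [|n IH]; [exact: zpow0|rewrite intS zpowD IH zpow1 exprS]. Qed.

Lemma Linfty_zpow n : Linfty (zpow n).
Proof.
have Lz : Linfty (@zcoord R).
  apply/LinftyP; split; first exact: cmeas_zcoord.
  by exists 1; apply: aeW => z; rewrite sqn_zcoord.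
have Ln (k : nat) : Linfty (zpow k).
  elim: k => [|k IH]; first by rewrite zpow0; exact: (Linfty_cst 1).
  by rewrite intS zpowD zpow1; exact: LinftyM.
case: n => k; first exact: Ln.
by rewrite NegzE -bar_zpow; apply/Linfty_bar/Ln.
Qed.

Lemma L2_zpow n : L2 (zpow n). Proof. exact/Linfty_L2/Linfty_zpow. Qed.

Lemma measurable_expi_comp d (Y : measurableType d) (h : T -> Y) :
  measurable_fun setT h ->
  measurable_fun setT (fun t : measurableTypeR R => h (expi t)).
Proof. by move=> mh; apply: measurableT_comp mh _; exact: measurable_expi. Qed.

Local Notation I01 := (measurable_itv `[0 : R, 1[).

Lemma ge0_integral_circle (h : T -> \bar R) : measurable_fun setT h ->
  (forall z, 0 <= h z)%E ->
  (\int[mu]_z h z = \int[leb]_(t in `[0%R, 1%R[) h (expi t))%E.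
Proof.
move=> mh h0.
pose m := mrestr leb I01.
have mD : measurable `[0 : R, 1[ by exact: measurable_itv.
have mh' := measurable_expi_comp mh.
rewrite (ge0_integral_pushforward (measurable_expi) m) //=.
rewrite preimage_setT (@ge0_negligible_integral _ _ _ m setT (~` `[0 : R, 1[)) //=.
- rewrite setTD setCK; apply: (eq_measure_integral leb) => A mA AD.
  by rewrite -[LHS]/(leb (A `&` `[0 : R, 1[)) setIidl.
- exact: measurableC.
- by rewrite -[LHS]/(leb (~` `[0 : R, 1[ `&` `[0 : R, 1[)) setICl measure0.
Qed.

Lemma integral_circle (h : T -> R) : measurable_fun setT h ->
  \int[mu]_z h z = \int[leb]_(t in `[0, 1[) h (expi t).
Proof.
move=> mh; have mE : measurable_fun setT (EFin \o h) by exact/measurable_EFinP.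
rewrite /Rintegral integralE [in RHS]integralE; congr (fine (_ - _)%E).
- rewrite ge0_integral_circle; last by move=> z; exact: funepos_ge0.
    apply: eq_integral => t _.
    by rewrite !unlock.
  exact: measurable_funepos.
- rewrite ge0_integral_circle; last by move=> z; exact: funeneg_ge0.
    apply: eq_integral => t _.
    by rewrite !unlock.
  exact: measurable_funeneg.
Qed.

Lemma rint_circle (h : T -> R) : rint h ->
  leb.-integrable `[0, 1[ (EFin \o (fun t => h (expi t))).
Proof.
move=> ih; have mh := rint_meas ih; apply/integrableP; split.
  apply/measurable_EFinP; apply: measurable_funTS; exact: measurable_expi_comp.
have /integrableP[_] := ih; rewrite ge0_integral_circle //.
by apply: measurableT_comp => //; exact/measurable_EFinP.
Qed.

Lemma zcoord_expiX (n : nat) (t : R) :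
  zcoord (expi t) ^+ n = cos (n%:R * (2 * pi * t)) +i* sin (n%:R * (2 * pi * t)).
Proof.
elim: n => [|n IH]; first by rewrite expr0 mul0r cos0 sin0.
rewrite exprS IH -(natr1 n) (mulrDl n%:R 1) mul1r cosD sinD.
by apply: complex_eqP; rewrite ?ReM ?ImM /= ; ring.
Qed.

(** The phase p lets one lemma serve the cosine and, with p = - pi / 2, the
sine. *)
Lemma integral_cos (k p : R) : k != 0 -> sin (k + p) = sin p ->
  \int[leb]_(t in `[0, 1[) cos (k * t + p) = 0.
Proof.
move=> k0 sk.
have dF (t : R) :
    is_derive t 1 (fun t => k^-1 * sin (k * t + p)) (cos (k * t + p)).
  apply: is_derive_eq.
  by rewrite /GRing.scale /= mulr1 addr0 mulrCA mulVf // mulr1.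
have cF (t : R) : {for t, continuous (fun t : R => k^-1 * sin (k * t + p))}.
  by apply: differentiable_continuous; apply/derivable1_diffP; case: (dF t).
have cf : continuous (fun t : R => cos (k * t + p)).
  apply: (@continuous_dilation (fun t => cos (t + p))) => t.
  apply: (@continuous_comp _ _ _ (fun t => t + p) cos); last exact: continuous_cos.
  by apply: cvgD; [exact: cvg_id|exact: cvg_cst].
rewrite /Rintegral integral_itv_bndo_bndc; last first.
  by apply: measurable_funTS; apply/measurable_EFinP; exact: continuous_measurable_fun.
rewrite (@continuous_FTC2 _ _ (fun t => k^-1 * sin (k * t + p)) 0 1) //.
- by rewrite mulr1 sk mulr0 add0r subee.
- exact: continuous_subspaceT.
- split=> [t _| |]; first by case: (dF t).
  + exact: cvg_at_right_filter (cF 0).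
  + exact: cvg_at_left_filter (cF 1).
- by move=> t _; rewrite derive1E; apply: derive_val.
Qed.

Lemma cmeas_zpow n : cmeas (zpow n).
Proof. exact/Linfty_meas/Linfty_zpow. Qed.

Lemma cintegral_zpow n : cintegral (zpow n) = (n == 0)%:R.
Proof.
have pos (k : nat) : cintegral (zpow k.+1) = 0.
  have [m1 m2] := cmeas_zpow k.+1.
  have k0 : 2 * pi * k.+1%:R != 0 :> R.
    by rewrite !mulf_neq0 // gt_eqF // pi_gt0.
  have per (p : R) : sin (2 * pi * k.+1%:R + p) = sin p.
    rewrite addrC -(periodicn (@sinD2pi R) k.+1 p); congr (sin (_ + _)).
    by rewrite -mulrnA -[RHS]mulr_natr natrM; ring.
  apply: complex_eqP; rewrite /= integral_circle //.
  - apply: eq_trans (integral_cos k0 (per 0)); apply: eq_Rintegral => t _.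
    rewrite -[LHS]/(complex.Re (zpow k.+1 (expi t))).
    rewrite zpow_nat fctE zcoord_expiX /= addr0; congr cos; ring.
  - apply: eq_trans (integral_cos k0 (per (- (pi / 2)))); apply: eq_Rintegral => t _.
    rewrite -[LHS]/(complex.Im (zpow k.+1 (expi t))).
    rewrite zpow_nat fctE zcoord_expiX /= cosBpihalf; congr sin; ring.
case: n => k.
- case: k => [|k]; last exact: pos.
  rewrite zpow0; apply: complex_eqP; rewrite /= Rintegral_cst //= ?mul0r //.
  by rewrite probability_setT mulr1.
- rewrite NegzE -bar_zpow cintegral_bar ?pos ?conjc0 //.
  have := L2_cintM (L2_zpow k.+1) (L2_cst 1).
  by rewrite (_ : _ * _ = zpow k.+1) //; apply/funext => z; rewrite fctE mulr1.
Qed.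

Lemma inner_zpow n m : inner (zpow n) (zpow m) = (n == m)%:R.
Proof. by rewrite /inner bar_zpow -zpowD cintegral_zpow subr_eq0. Qed.

End Trigonometric.

(** * Completeness of the trigonometric system *)

Section Steep.
Context {R : realType}.
Implicit Types s : R.

Lemma bernoulli_le (x : R) (n : nat) : 0 <= x -> 1 + n%:R * x <= (1 + x) ^+ n.
Proof.
move=> x0; elim: n => [|n IH]; first by rewrite mul0r addr0 expr0.
rewrite exprS -(natr1 n); apply: (le_trans _ (ler_wpM2l _ IH)); last by rewrite addr_ge0.
have : 0 <= n%:R * x * x by rewrite !mulr_ge0.
by move: (n%:R : R) => k; nra.
Qed.

Lemma bernoulliB_le (x : R) (n : nat) : 0 <= x <= 1 -> 1 - n%:R * x <= (1 - x) ^+ n.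
Proof.
move=> /andP[x0 x1]; elim: n => [|n IH]; first by rewrite mul0r subr0 expr0.
rewrite exprS -(natr1 n); apply: (le_trans _ (ler_wpM2l _ IH)); last by rewrite subr_ge0.
have : 0 <= n%:R * x * x by rewrite !mulr_ge0.
by move: (n%:R : R) => k; nra.
Qed.

Lemma cvg_natM_geometric (x : R) : 0 <= x < 1 ->
  (fun n => n%:R * x ^+ n) @ \oo --> (0 : R).
Proof.
move=> /andP[x0 x1]; (* x is at most y^2 with y < 1, and n y^n is bounded. *)
pose y := (1 + x) / 2.
have y0 : 0 < y by rewrite /y; lra.
have y1 : y < 1 by rewrite /y; lra.
have xy : x <= y * y by rewrite /y; have := sqr_ge0 (1 - x); nra.
have d0 : 0 < y^-1 - 1 by rewrite subr_gt0 invf_gt1.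
have ny n : n%:R * y ^+ n <= (y^-1 - 1)^-1.
  rewrite -[leRHS]mul1r ler_pdivlMr // mulrAC.
  have := bernoulli_le n (ltW d0).
  rewrite addrCA subrr addr0 => h.
  rewrite -ler_pdivlMr ?exprn_gt0 // div1r -exprVn.
  by apply: le_trans h; rewrite lerDr.
apply: (@squeeze_cvgr _ _ _ _ (fun=> 0) (geometric ((y^-1 - 1)^-1) y)).
- apply: nearW => n; rewrite mulr_ge0 ?exprn_ge0 //=.
  apply: (@le_trans _ _ (n%:R * (y * y) ^+ n)).
    by rewrite ler_wpM2l // lerXn2r ?nnegrE // mulr_ge0 // ltW.
  by rewrite exprMn mulrA ler_wpM2r // exprn_ge0 // ltW.
- exact: cvg_cst.
- by apply: cvg_geometric; rewrite ger0_norm // ltW.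
Qed.

(** These polynomials converge on [0, 1] to the indicator of s < 1/2: the
exponent n 2^n is negligible against s^-n if s < 1/2, and dominates it
otherwise. *)
Definition steep (n : nat) s := (1 - s ^+ n) ^+ (n * 2 ^ n).

Lemma steep_itv n s : 0 <= s <= 1 -> 0 <= steep n s <= 1.
Proof.
move=> /andP[s0 s1].
have h0 : 0 <= 1 - s ^+ n by rewrite subr_ge0 exprn_ile1.
have h1 : 1 - s ^+ n <= 1 by rewrite gerBl exprn_ge0.
by rewrite exprn_ge0 ?exprn_ile1.
Qed.

Lemma steep_cvg s : 0 <= s <= 1 ->
  (steep ^~ s) @ \oo --> ((s < 2^-1)%R%:R : R).
Proof.
move=> s01; have /andP[s0 s1] := s01; case: ltP => s2.
- apply: (@squeeze_cvgr _ _ _ _ (fun n => 1 - n%:R * (2 * s) ^+ n) (fun=> 1)).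
  + apply: nearW => n; have /andP[_ ->] := steep_itv n s01; rewrite andbT.
    apply: le_trans (bernoulliB_le _ _); last by rewrite exprn_ge0 ?exprn_ile1.
    by rewrite natrM natrX exprMn mulrA.
  + rewrite -[X in _ --> X]subr0; apply: cvgB; first exact: cvg_cst.
    by apply: cvg_natM_geometric; lra.
  + exact: cvg_cst.
- apply: (@squeeze_cvgr _ _ _ _ (fun=> 0) (@harmonic R)).
  + apply: nearW => n; have /andP[-> _] := steep_itv n s01.
    rewrite /= /harmonic /=.
    have hle : steep n s <= steep n 2^-1.
      rewrite /steep; apply: lerXn2r; rewrite ?nnegrE ?subr_ge0 ?exprn_ile1 //;
        try lra.
      by rewrite lerB // lerXn2r // ?nnegrE //; lra.
    apply: (le_trans hle); set q : R := 2^-1 ^+ n.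
    have q0 : 0 < q by rewrite exprn_gt0 // invr_gt0.
    have q1 : q <= 1 by rewrite exprn_ile1 //; lra.
    have b := bernoulli_le (n * 2 ^ n) (ltW q0).
    have nq : (n * 2 ^ n)%:R * q = n%:R.
      by rewrite natrM natrX -mulrA -exprMn mulfV // expr1n mulr1.
    rewrite nq addrC natr1 in b.
    have p0 : 0 < (1 + q) ^+ (n * 2 ^ n) by rewrite exprn_gt0 // addr_gt0.
    rewrite -[leRHS]mul1r ler_pdivlMr //.
    apply: (@le_trans _ _ (steep n 2^-1 * (1 + q) ^+ (n * 2 ^ n))).
      rewrite ler_wpM2l //; first by have /andP[] := @steep_itv n 2^-1 ltac:(lra).
    rewrite /steep -/q -exprMn exprn_ile1 //.
      by rewrite mulr_ge0 // ?subr_ge0 // addr_ge0 // ltW.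
    have : 0 <= q * q by rewrite mulr_ge0 // ltW.
    by nra.
  + exact: cvg_cst.
  + exact: cvg_harmonic.
Qed.

End Steep.

Section Uniqueness.
Context {R : realType}.
Local Notation T := (circle R).
Local Notation C := R[i].
Local Notation mu := (@mcircle R).
Local Notation cj := (@conjc R).
Implicit Types (f g x y w : T -> C) (j m : int) (h k : T -> R) (n : nat).

#[local] Hint Resolve L2_zpow : core.

(** The functions orthogonal to all characters; completeness of the
trigonometric system is the statement that they vanish. *)
Definition coef_free w := L2 w /\ forall j, fourier w j = 0.

Definition toC h : T -> C := fun z => (h z)%:C.

(** Real functions that preserve the orthogonality to all characters. They turn
out to include the indicators of arcs, which is what makes such a function
vanish. *)
Definition multiplier h := measurable_fun setT h /\
  forall w, coef_free w -> coef_free (w * toC h).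

Lemma coef_freeD w x : coef_free w -> coef_free x -> coef_free (w + x).
Proof.
move=> [Lw w0] [Lx x0]; split; first exact: L2D.
by move=> n; rewrite fourierE innerDl // -!fourierE w0 x0 addr0.
Qed.

Lemma coef_freeZ c w : coef_free w -> coef_free (c *: w).
Proof.
move=> [Lw w0]; split; first exact: L2Z.
by move=> n; rewrite fourierE innerZl // -!fourierE w0 mulr0.
Qed.

Lemma coef_free_zpowM m w : coef_free w -> coef_free (zpow m * w).
Proof.
move=> [Lw w0]; split; first exact: Linfty_L2M (Linfty_zpow m) Lw.
by move=> n; rewrite fourierE innerMl bar_zpow -zpowD -fourierE w0.
Qed.

Lemma multiplierD h k : multiplier h -> multiplier k ->
  multiplier (fun z => h z + k z).
Proof.
move=> [mh Hh] [mk Hk]; split; first exact: measurable_funD.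
move=> w w0; have := coef_freeD (Hh _ w0) (Hk _ w0).
rewrite -mulrDr (_ : toC h + toC k = toC (fun z => h z + k z)) //.
by apply/funext => z; rewrite /toC fctE rmorphD.
Qed.

Lemma multiplierM h k : multiplier h -> multiplier k ->
  multiplier (fun z => h z * k z).
Proof.
move=> [mh Hh] [mk Hk]; split; first exact: measurable_funM.
move=> w w0; have := Hk _ (Hh _ w0).
rewrite -mulrA (_ : toC h * toC k = toC (fun z => h z * k z)) //.
by apply/funext => z; rewrite /toC fctE rmorphM.
Qed.

Lemma multiplier_cst (c : R) : multiplier (fun=> c).
Proof.
split; first exact: measurable_cst.
move=> w /(coef_freeZ c%:C); rewrite (_ : _ *: w = w * toC (fun=> c)) //.
by apply/funext => z; rewrite fctE /= mulrC.
Qed.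

Lemma multiplierB h k : multiplier h -> multiplier k ->
  multiplier (fun z => h z - k z).
Proof.
move=> Mh Mk; under eq_fun do rewrite -mulN1r.
exact: multiplierD Mh (multiplierM (multiplier_cst (-1)) Mk).
Qed.

Lemma multiplierX h (n : nat) : multiplier h -> multiplier (fun z => h z ^+ n).
Proof.
move=> Mh; elim: n => [|n IH].
  by under eq_fun do rewrite expr0; exact: multiplier_cst.
by under eq_fun do rewrite exprS; exact: multiplierM.
Qed.

Lemma multiplier_Re : multiplier (fun z => complex.Re (zcoord z)).
Proof.
split; first by case: (@cmeas_zcoord R).
move=> w w0; have := coef_freeZ (2^-1) (coef_freeD
  (coef_free_zpowM 1 w0) (coef_free_zpowM (- 1) w0)).
rewrite (_ : _ *: _ = w * toC (fun z => complex.Re (zcoord z))) //.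
apply/funext => z; rewrite -bar_zpow zpow1 !fctE /bar /toC ReJ_add /=.
by rewrite -[LHS]/(2^-1 * (zcoord z * w z + cj (zcoord z) * w z)); ring.
Qed.

Lemma multiplier_Im : multiplier (fun z => complex.Im (zcoord z)).
Proof.
split; first by case: (@cmeas_zcoord R).
move=> w w0; have := coef_freeZ (2^-1 * 'i%C) (coef_freeD
  (coef_freeZ (- 1) (coef_free_zpowM 1 w0)) (coef_free_zpowM (- 1) w0)).
rewrite (_ : _ *: _ = w * toC (fun z => complex.Im (zcoord z))) //.
apply/funext => z; rewrite -bar_zpow zpow1 !fctE /bar /toC ImJ_sub /=.
rewrite -[LHS]/(2^-1 * 'i%C * (- 1 * (zcoord z * w z) + cj (zcoord z) * w z)).
by ring.
Qed.

Lemma sqn_real (r : R) : sqn (r%:C) = r ^+ 2.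
Proof. by rewrite /sqn /= expr0n addr0. Qed.

Lemma cmeas_toC h : measurable_fun setT h -> cmeas (toC h).
Proof. by move=> mh; split=> //=; exact: measurable_cst. Qed.

Lemma Linfty_toC h : measurable_fun setT h -> (forall z, 0 <= h z <= 1) ->
  Linfty (toC h).
Proof.
move=> mh h01; apply/LinftyP; split; first exact: cmeas_toC.
exists 1; apply: aeW => z; rewrite sqn_real.
by have /andP[? ?] := h01 z; rewrite exprn_ile1.
Qed.

(** Dominated convergence gives convergence of the products in L2, hence of
their Fourier coefficients by the Cauchy-Schwarz inequality. *)
Lemma multiplier_lim (hn : nat -> T -> R) h : (forall n, multiplier (hn n)) ->
  (forall n z, 0 <= hn n z <= 1) -> (forall z, 0 <= h z <= 1) ->
  (forall z, hn ^~ z @ \oo --> h z) -> multiplier h.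
Proof.
move=> Mn n01 h01 cvh.
have mn n : measurable_fun setT (hn n) by case: (Mn n).
have mh : measurable_fun setT h.
  by apply: (measurable_fun_cvg mn) => z _; exact: cvh.
split=> // w w0; have [Lw _] := w0.
have L : L2 (w * toC h) by rewrite mulrC; apply: Linfty_L2M => //; exact: Linfty_toC.
have Ln n : L2 (w * toC (hn n)).
  by rewrite mulrC; apply: Linfty_L2M => //; exact: Linfty_toC.
split=> // j.
have cN : (fun n => normsq (w * toC h - w * toC (hn n))) @ \oo --> 0.
  have [] := @dominated_convergence _ _ _ mu setT measurableT
    (fun n z => (sqn ((w * toC h - w * toC (hn n)) z))%:E) (fun=> 0%:E)
    (fun z => (sqn (w z))%:E).
  - by move=> n; apply/measurable_EFinP; apply: cmeas_sqn; exact/L2_meas/L2B.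
  - exact: measurable_cst.
  - apply: aeW => z _; apply/cvg_EFin; first exact: nearW.
    rewrite [X in X @ _](_ : _ = fun n => sqn (w z) * (h z - hn n z) ^+ 2); last first.
      apply/funext => n /=.
      by rewrite -mulrBr -sqn_real -sqnM /toC fctE rmorphB.
    rewrite -[X in _ --> X](mulr0 (sqn (w z))); apply: cvgMr.
    rewrite -[X in _ --> X](mulr0 0); under eq_fun do rewrite expr2.
    have c0 : (fun n => h z - hn n z) @ \oo --> 0.
      by rewrite -(subrr (h z)); apply: cvgB; [exact: cvg_cst|exact: cvh].
    by apply: cvgM.
  - exact: L2_int.
  - apply: aeW => z n _; rewrite lee_fin ger0_norm ?sqn_ge0 //.
    rewrite (_ : (_ - _) z = w z * (h z - hn n z)%:C); last first.
      by rewrite -mulrBr /toC !fctE rmorphB.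
    rewrite sqnM sqn_real ler_piMr ?sqn_ge0 //.
    have /andP[? ?] := h01 z; have /andP[? ?] := n01 n z.
    by rewrite -ler_sqrt ?ler01 // sqrtr_sqr sqrtr1 ler_norml; lra.
  move=> _ _; rewrite integral0 => /fine_cvgP[_].
  by apply: cvg_trans; apply: near_eq_cvg; apply: nearW.
suff : sqn (fourier (w * toC h) j) <= 0.
  move=> le; have /eqP : sqn (fourier (w * toC h) j) = 0.
    by apply/eqP; rewrite eq_le le sqn_ge0.
  rewrite /sqn paddr_eq0 ?sqr_ge0 // !sqrf_eq0 => /andP[/eqP a /eqP b].
  exact: complex_eqP.
apply: (cvgr_to_ge cN); apply: nearW => n.
have [_ /(_ j) wn0] := (Mn n).2 _ w0.
have -> : fourier (w * toC h) j = inner (w * toC h - w * toC (hn n)) (zpow j).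
  by rewrite innerBl // -(fourierE (w * toC (hn n))) wn0 subr0.
apply: le_trans (cauchy_schwarz _ (L2_zpow j)) _; first exact: L2B.
have [E] : 1%:C = (normsq (zpow j))%:C :> C.
  by rewrite -innerxx inner_zpow eqxx.
by rewrite -E mulr1.
Qed.

(** The indicator is the limit of [steep] evaluated at the affine image 1/2 -
q/4 of q, which takes its values in [0, 1]. *)
Lemma multiplier_gt0 (q : T -> R) : multiplier q -> (forall z, -2 <= q z <= 2) ->
  multiplier (fun z => ((0 < q z)%R%:R)).
Proof.
move=> Mq q2.
pose s z := 2^-1 - 4^-1 * q z.
have s01 z : 0 <= s z <= 1 by have := q2 z; rewrite /s; lra.
have Ms : multiplier s.
  apply: multiplierB; first exact: multiplier_cst.
  by apply: multiplierM => //; exact: multiplier_cst.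
apply: (@multiplier_lim (fun n z => steep n (s z))).
- move=> n; rewrite /steep; apply: multiplierX; apply: multiplierB.
    exact: multiplier_cst.
  exact: multiplierX.
- by move=> n z; exact: steep_itv.
- by move=> z; case: (0 < q z); rewrite /= ?lexx ?ler01.
- move=> z; have := steep_cvg (s01 z).
  by rewrite /s gtrBl pmulr_rgt0 // invr_gt0.
Qed.

End Uniqueness.

Section Uniqueness2.
Context {R : realType}.
Local Notation T := (circle R).
Local Notation C := R[i].
Local Notation leb := (@lebesgue_measure R).
Implicit Types (f g x y w : T -> C) (j m : int) (h k : T -> R) (n : nat).

(** The circle is treated as two half circles, the upper one for [false] and the
lower one for [true], on each of which the cosine is monotone in the angle. *)
Definition arc_start (e : bool) : R := if e then 2^-1 else 0.
Definition arc_sign (e : bool) : R := if e then -1 else 1.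

Let turn (u : R) : 2 * pi * (u + 2^-1) = 2 * pi * u + pi.
Proof. by field. Qed.

Lemma sin_arc (e : bool) (t : R) :
  arc_sign e * sin (2 * pi * t) = sin (2 * pi * (t - arc_start e)).
Proof.
case: e; rewrite /arc_start /arc_sign ?subr0 ?mul1r //.
by rewrite -{1}(subrK 2^-1 t) turn sinDpi mulrNN mul1r.
Qed.

Lemma cos_arc (e : bool) (t : R) :
  arc_sign e * cos (2 * pi * t) = cos (2 * pi * (t - arc_start e)).
Proof.
case: e; rewrite /arc_start /arc_sign ?subr0 ?mul1r //.
by rewrite -{1}(subrK 2^-1 t) turn cosDpi mulrNN mul1r.
Qed.

Lemma sin_turn_gt0 (u : R) : - 2^-1 <= u < 1 ->
  (0 < sin (2 * pi * u)) = (0 < u < 2^-1).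
Proof.
move=> /andP[u1 u2]; have pi0 := pi_gt0 R.
have [u0|u0] := leP u 0.
  rewrite ltNge; apply/negbF; rewrite -oppr_ge0 -sinN -mulrN.
  by apply: sin_ge0_pi; apply/andP; split; nra.
have [uh|uh] := ltP u 2^-1.
  by rewrite sin_gt0_pi //; apply/andP; split; nra.
rewrite ltNge; apply/negbF; rewrite -(subrK 2^-1 u) turn sinDpi oppr_le0.
by apply: sin_ge0_pi; apply/andP; split; nra.
Qed.

(** Brings an angle back to the half circle, so that the comparison of cosines
in [cos_turn_clip] makes sense for all real y. *)
Definition arc_clip (y : R) : R := Num.max 0 (Num.min y 2^-1).

Lemma cos_turn_clip (u y : R) : 0 < u < 2^-1 ->
  (cos (2 * pi * u) < cos (2 * pi * arc_clip y)) = (y < u).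
Proof.
move=> /andP[u1 u2]; have pi0 := pi_gt0 R.
have c0 : 0 <= arc_clip y by rewrite /arc_clip le_max lexx.
have c1 : arc_clip y <= 2^-1 by rewrite /arc_clip ge_max ge_min lexx orbT invr_ge0 ler0n.
rewrite ltr_cos ?in_itv /=; [|by apply/andP; split; nra..].
rewrite ltr_pM2l ?mulr_gt0 // /arc_clip gt_max u1 /= gt_min.
by rewrite (ltNge 2^-1) (ltW u2) orbF.
Qed.

Lemma mul_toC w h (z : T) : (w * toC h) z = w z * (h z)%:C.
Proof. by []. Qed.

(** Multiplying w by the indicators of a half circle and of a half plane with
vertical boundary keeps its mean equal to 0. In the angle these sets are
intervals with a free endpoint, so the primitive of Re w on the half circle
vanishes, and Re w = 0 there by differentiation. *)
Lemma coef_free_arc w (e : bool) : coef_free w ->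
  {ae leb, forall t, `[0, 1[%classic t -> 0 < arc_sign e * complex.Im (zcoord (expi t)) ->
    complex.Re (w (expi t)) = 0}.
Proof.
move=> w0.
pose A (z : T) : R := (0 < arc_sign e * complex.Im (zcoord z))%R%:R.
have bnd (z : T) : (-1 <= complex.Re (zcoord z) <= 1) /\ (-1 <= complex.Im (zcoord z) <= 1).
  have := sqn_zcoord z; rewrite /sqn.
  by move: (complex.Re _) (complex.Im _) => a b ab; split; apply/andP; split; nra.
have MA : multiplier A.
  apply: multiplier_gt0.
    by apply: multiplierM; [exact: multiplier_cst|exact: multiplier_Im].
  by move=> z; have [_] := bnd z; rewrite /arc_sign; case: (e); lra.
pose B (c : R) (z : T) : R := (0 < c - arc_sign e * complex.Re (zcoord z))%R%:R.
have MB c : -1 <= c <= 1 -> multiplier (B c).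
  move=> c1; apply: multiplier_gt0.
    apply: multiplierB; first exact: multiplier_cst.
    by apply: multiplierM; [exact: multiplier_cst|exact: multiplier_Re].
  by move=> z; have [+ _] := bnd z; rewrite /arc_sign; case: (e); lra.
have intRe x : L2 x -> rint (fun z => complex.Re (x z)).
  move=> Lx; have := L2_cintM Lx (L2_cst 1).
  by rewrite (_ : _ * _ = x); [case|apply/funext => z; rewrite fctE mulr1].
have zero x : coef_free x ->
    \int[leb]_(t in `[0, 1[) complex.Re (x (expi t)) = 0.
  move=> [Lx /(_ 0)]; rewrite fourierE zpow0 /inner.
  rewrite (_ : _ * _ = x); last by apply/funext => z; rewrite fctE /bar conjc1 mulr1.
  move=> /(congr1 (@complex.Re R)) /= E; apply: eq_trans E.
  by rewrite integral_circle //; exact: rint_meas (intRe _ Lx).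
pose K := (fun t => complex.Re ((w * toC A) (expi t))) \_ `[0, 1[.
have wA0 := MA.2 _ w0.
have iK : leb.-integrable setT (EFin \o K).
  have := rint_circle (intRe _ wA0.1).
  rewrite integrable_mkcond // restrict_EFin; exact.
have F0 (x : R) : \int[leb]_(t in `]-oo, x]) K t = 0.
  (* On the half circle, the condition t <= x is arc_sign e * Re z >= c. *)
  pose c := cos (2 * pi * arc_clip (x - arc_start e)).
  have c1 : -1 <= c <= 1 by rewrite cos_geN1 cos_le1.
  have Mh : multiplier (fun z => 1 - B c z).
    by apply: multiplierB; [exact: multiplier_cst|exact: MB].
  apply: eq_trans (zero _ (Mh.2 _ wA0)).
  rewrite Rintegral_mkcond [RHS]Rintegral_mkcond.
  apply: eq_Rintegral => t _; rewrite /K !patchE.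
  have [t01|] := boolP (t \in `[0, 1[%classic); last by case: ifP.
  rewrite !mul_toC.
  have [At|At] := boolP (0 < arc_sign e * complex.Im (zcoord (expi t))); last first.
    by rewrite /A (negbTE At) mulr0 mul0r /=; case: ifP.
  have /andP[u1 u2] : 0 < t - arc_start e < 2^-1.
    rewrite -sin_turn_gt0 -?sin_arc //.
    move: t01; rewrite inE /= in_itv /= => /andP[t0 t1].
    by rewrite /arc_start; case: (e); lra.
  rewrite /B /= subr_gt0 cos_arc cos_turn_clip ?u1 // ltrD2r.
  case: (leP t x) => tx; last first.
    by rewrite subrr mulr0 memNset //= in_itv /= => /(lt_le_trans tx); rewrite ltxx.
  by rewrite subr0 mulr1 mem_set //= in_itv.
have iKx (y : R) : leb.-integrable `]-oo, y] (EFin \o K) by exact: integrableS iK.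
have loc : locally_integrable setT K.
  exact: integrable_locally (rint_circle (intRe _ wA0.1)).
have := FTC1Ny iKx loc; cbv zeta.
have -> : (fun x : R => \int[leb]_(t in `]-oo, x]) K t) = cst 0.
  by apply/funext => x; exact: F0.
apply: filterS; first exact: (ae_filter_ringOfSetsType leb).
move=> t; rewrite derive1_cst => -[_ K0] t01 At.
move: K0; rewrite /K patchE mem_set // => /esym.
rewrite mul_toC /A At.
by rewrite mulr1.
Qed.

Lemma arc_sign_sin_gt0 (e : bool) (t : R) : `[0, 1[%classic t ->
  arc_start e < t < arc_start e + 2^-1 ->
  0 < arc_sign e * complex.Im (zcoord (expi t)).
Proof.
rewrite /= in_itv /= => /andP[t0 t1] /andP[h1 h2].
rewrite /= sin_arc sin_turn_gt0 ?subr_gt0 ?h1 ?ltrBlDl //.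
by move: h1 h2; rewrite /arc_start; case: (e); lra.
Qed.

(** [coef_free_arc] applies to the real part of w and to that of - 'i w on both
half circles. *)
Lemma coef_free_eq0 w : coef_free w -> ae_equal w 0.
Proof.
move=> w0; have [Lw _] := w0; apply: normsq_eq0 => //.
have iw0 := coef_freeZ (- 'i%C) w0.
have point (a : R) : {ae leb, forall t, t != a}.
  exists [set a]; split; [exact: measurable_set1|exact: lebesgue_measure_set1|].
  by move=> t /= /negP; rewrite negbK => /eqP.
have main : {ae leb, forall t, `[0, 1[%classic t -> (sqn (w (expi t)))%:E = 0%E}.
  have fl := ae_filter_ringOfSetsType leb.
  near=> t.
  move=> t01; have := t01; rewrite /= in_itv /= => /andP[t0 t1].
  have [e he] : exists e, arc_start e < t < arc_start e + 2^-1.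
    have tn0 : t != 0 by near: t; exact: point.
    have tn1 : t != 2^-1 by near: t; exact: point.
    rewrite /arc_start; case: (ltgtP t 2^-1) tn1 => // th _.
      by exists false; rewrite add0r th lt_neqAle eq_sym tn0 t0.
    by exists true; rewrite th; lra.
  have He := arc_sign_sin_gt0 t01 he.
  have re : complex.Re (w (expi t)) = 0.
    by move: t01 He; case: (e); near: t; exact: coef_free_arc.
  have im : complex.Im (w (expi t)) = 0.
    have : complex.Re ((- 'i%C *: w) (expi t)) = 0.
      by move: t01 He; case: (e); near: t; exact: coef_free_arc.
    by rewrite -[(_ *: w) _]/(- 'i%C * w (expi t)) ReM /= oppr0 mul0r sub0r mulN1r opprK.
  by rewrite /sqn re im expr0n addr0.
have ms : measurable_fun setT (fun z : T => sqn (w z)) by apply: cmeas_sqn; exact: L2_meas.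
rewrite /normsq integral_circle // /Rintegral.
rewrite (@ae_eq_integral _ _ _ leb `[0, 1[ (cst 0%E)) //; first by rewrite integral0.
by apply/measurable_EFinP; apply: measurable_funTS; exact: measurable_expi_comp ms.
Unshelve. all: by end_near.
Qed.

End Uniqueness2.

(** * The Riesz projections *)

Section Projections.
Context {R : realType}.
Local Notation T := (circle R).
Local Notation C := R[i].
Local Notation cj := (@conjc R).
Implicit Types (f g x y w a b : T -> C) (h : T -> C) (j m p : int) (n k l q : nat).
Implicit Types (s : bool).

#[local] Hint Resolve L2_zpow : core.

(** The frequencies of the summand s, counted from the one next to the other
summand. *)
Definition freq s k : int := if s then k%:Z else - k.+1%:Z.

Lemma freq_inj s k l : (freq s k == freq s l) = (k == l).
Proof. by case: s; rewrite /freq ?eqr_opp. Qed.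

Lemma freqN s k l : (freq s k == freq (~~ s) l) = false.
Proof. by case: s; rewrite /freq /=; lia. Qed.

Lemma freq_cases j : exists s k, j = freq s k.
Proof. by case: j => k; [exists true, k|exists false, k; rewrite /freq NegzE]. Qed.

(** [Hs true] is the Hardy space and [Hs false] its orthogonal complement, each
described by the vanishing of the frequencies of the other. *)
Definition Hs s x := L2 x /\ forall k, fourier x (freq (~~ s) k) = 0.

Lemma Hs_L2 s x : Hs s x -> L2 x. Proof. by case. Qed.

Lemma Hardy2E x : Hardy2 x <-> Hs true x.
Proof.
split=> -[Lx x0]; split=> //.
- by move=> k; apply: x0; rewrite /freq /=; lia.
- by move=> [k|k] // _; rewrite NegzE; exact: x0.
Qed.

Lemma HsD s x y : Hs s x -> Hs s y -> Hs s (x + y).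
Proof.
move=> [Lx x0] [Ly y0]; split; first exact: L2D.
by move=> k; rewrite fourierE innerDl // -!fourierE x0 y0 addr0.
Qed.

Lemma HsZ s c x : Hs s x -> Hs s (c *: x).
Proof.
move=> [Lx x0]; split; first exact: L2Z.
by move=> k; rewrite fourierE innerZl // -!fourierE x0 mulr0.
Qed.

Lemma HsN s x : Hs s x -> Hs s (- x).
Proof. by rewrite -scaleN1r; exact: HsZ. Qed.

Lemma HsB s x y : Hs s x -> Hs s y -> Hs s (x - y).
Proof. by move=> Hx Hy; apply: HsD => //; exact: HsN. Qed.

Lemma Hs0 s : Hs s 0.
Proof. by split; [exact: L2_0|move=> k; rewrite fourierE inner0l]. Qed.

Lemma Hs_ae s x y : L2 y -> ae_equal x y -> Hs s x -> Hs s y.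
Proof.
move=> Ly xy [Lx x0]; split=> // k; rewrite -(x0 k).
by rewrite !fourierE; apply: inner_ae => //; [exact: ae_sym|exact: ae_refl].
Qed.

Lemma Hs_zpow s k : Hs s (zpow (freq s k)).
Proof. by split=> // l; rewrite fourierE inner_zpow freqN. Qed.

(** All Fourier coefficients of x vanish. *)
Lemma Hs_meet s x : Hs s x -> Hs (~~ s) x -> ae_equal x 0.
Proof.
move=> [Lx x0] [_ x1]; apply: coef_free_eq0; split=> // j.
have [s' [k ->]] := freq_cases j.
have [->|] := eqVneq s' (~~ s); first exact: x0.
by case: s s' x0 x1 => -[] x0 x1 // _; exact: x1.
Qed.

Lemma fourier_sum s (c : nat -> C) n q k :
  fourier (\sum_(n <= l < q) c l *: zpow (freq s l)) (freq s k) =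
  if (n <= k < q)%N then c k else 0.
Proof.
rewrite fourierE inner_suml //; last by move=> l; exact: L2Z.
rewrite -(@big_nat1_eq C 0 +%R c k n q) [RHS]big_mkcond /=; apply: eq_bigr => l _.
by rewrite innerZl // inner_zpow freq_inj; case: eqP; rewrite ?mulr1 ?mulr0.
Qed.

Lemma L2_partial_sum s (c : nat -> C) n q :
  L2 (\sum_(n <= l < q) c l *: zpow (freq s l)).
Proof. by apply: L2_sum => l; exact: L2Z. Qed.

Lemma inner_partial_sum s (c : nat -> C) n q w : L2 w ->
  inner (\sum_(n <= l < q) c l *: zpow (freq s l)) w =
  \sum_(n <= l < q) c l * cj (fourier w (freq s l)).
Proof.
move=> Lw; rewrite inner_suml //; last by move=> l; exact: L2Z.
by apply: eq_bigr => l _; rewrite innerZl // (innerC Lw).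
Qed.

Lemma mulc_cj (c : C) : c * cj c = (sqn c)%:C.
Proof. by case: c => u v; apply: complex_eqP; rewrite /sqn /=; ring. Qed.

Lemma sum_real (F : nat -> R) n q :
  \sum_(n <= l < q) (F l)%:C = (\sum_(n <= l < q) F l)%:C :> C.
Proof. by rewrite (big_morph (real_complex R) (id1 := 0) (op1 := +%R)) // => ? ?; rewrite rmorphD. Qed.

Lemma parseval_partial_sum s (c : nat -> C) n q :
  normsq (\sum_(n <= l < q) c l *: zpow (freq s l)) = \sum_(n <= l < q) sqn (c l).
Proof.
suff [] : (normsq (\sum_(n <= l < q) c l *: zpow (freq s l)))%:C =
   (\sum_(n <= l < q) sqn (c l))%:C :> C by [].
rewrite -innerxx inner_partial_sum; last exact: L2_partial_sum.
rewrite -sum_real; apply: eq_big_nat => l nl.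
by rewrite fourier_sum nl mulc_cj.
Qed.

Lemma bessel s x n : L2 x ->
  \sum_(0 <= l < n) sqn (fourier x (freq s l)) <= normsq x.
Proof.
move=> Lx; pose c l := fourier x (freq s l).
have := cauchy_schwarz (L2_partial_sum s c 0 n) Lx.
rewrite parseval_partial_sum inner_partial_sum // /c.
under eq_bigr do rewrite mulc_cj.
rewrite sum_real sqn_real; set P := \sum_(_ <= _ < _) _.
have : 0 <= P by apply: sumr_ge0 => l _; exact: sqn_ge0.
rewrite le_eqVlt => /predU1P[<- _|P0]; first exact: normsq_ge0.
by rewrite expr2 ler_pM2l.
Qed.

Lemma bounded_tails (c : nat -> R) (M : R) : (forall n, 0 <= c n) ->
  (forall n, \sum_(0 <= l < n) c l <= M) ->
  forall e : R, 0 < e -> exists N, forall q, \sum_(N <= l < q) c l <= e.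
Proof.
move=> c0 cM e e0.
pose S := [set r | exists n, r = \sum_(0 <= l < n) c l].
have supS : has_sup S.
  split; first by exists (\sum_(0 <= l < 0) c l), 0%N.
  by exists M => _ [n ->]; exact: cM.
have [_ [N ->] HN] := sup_adherent e0 supS.
exists N => q; have [mN|Nm] := leqP q N; first by rewrite big_geq // ltW.
have : \sum_(0 <= l < q) c l <= sup S by apply: ub_le_sup => //; [case: supS|exists q].
rewrite (big_cat_nat (n := N)) ?(ltnW Nm) //=; lra.
Qed.

(** The partial Fourier sums over one half of the frequencies are Cauchy by
Bessel's inequality; y is their limit along a subsequence fast enough for
[L2_complete]. *)
Lemma fourier_part s x : L2 x -> exists y, [/\ Hs s y,
  (forall k, fourier y (freq s k) = fourier x (freq s k)) &
  forall w, Hs (~~ s) w -> inner y w = 0].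
Proof.
move=> Lx; pose c l := fourier x (freq s l).
have e8 (j : nat) : 0 < (8^-1 : R) ^+ j by rewrite exprn_gt0 // invr_gt0.
have /choice[N HN] : forall j : nat, exists N, forall q,
    \sum_(N <= l < q) sqn (c l) <= (8^-1 : R) ^+ j.
  move=> j; apply: (@bounded_tails (fun l => sqn (c l)) (normsq x)) => // n.
    exact: sqn_ge0.
  exact: bessel.
(* N' increases strictly and dominates N, so N' j also exceeds j. *)
pose N' (j : nat) := \sum_(0 <= i < j.+1) (N i).+1.
have N'S (j : nat) : N' j.+1 = (N' j + (N j.+1).+1)%N by rewrite /N' big_nat_recr.
have NN' (j : nat) : (N j <= N' j)%N.
  by rewrite /N' big_nat_recr //=; lia.
have jN' (j : nat) : (j < N' j)%N.
  by elim: j => [|j IH]; [rewrite /N' big_nat1|rewrite N'S; lia].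
pose S (j : nat) := \sum_(0 <= l < N' j) c l *: zpow (freq s l).
have LS (j : nat) : L2 (S j) by exact: L2_partial_sum.
have dS (j : nat) : normsq (S j.+1 - S j) <= 8^-1 ^+ j.
  rewrite /S (big_cat_nat (n := N' j) (p := N' j.+1)) //=; last by rewrite N'S leq_addr.
  rewrite addrAC subrr add0r parseval_partial_sum; apply: le_trans (HN j (N' j.+1)).
  rewrite [leRHS](big_cat_nat (n := N' j)) ?NN' //=; last by rewrite N'S leq_addr.
  by rewrite lerDr; apply: sumr_ge0 => l _; exact: sqn_ge0.
have [y Ly [K HK]] := L2_complete LS dS.
have lim w v : L2 w -> (exists J, forall j : nat, (J <= j)%N -> inner (S j) w = v) ->
    inner y w = v.
  move=> Lw [J HJ]; apply/eqP; rewrite -subr_eq0.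
  suff le0 : sqn (inner y w - v) <= 0.
    have /eqP : sqn (inner y w - v) = 0 by apply/eqP; rewrite eq_le le0 sqn_ge0.
    rewrite /sqn paddr_eq0 ?sqr_ge0 // !sqrf_eq0 => /andP[/eqP u /eqP v'].
    by apply/eqP; exact: complex_eqP.
  have geo : (fun j : nat => 2 * 2^-1 ^+ j * K * normsq w) @ \oo --> (0 : R).
    rewrite (_ : (fun _ => _) = geometric (2 * K * normsq w) 2^-1).
      by apply: cvg_geometric; rewrite ger0_norm // ?invr_ge0 // invf_lt1 // ltr1n.
    by apply/funext => j /=; ring.
  apply: (cvgr_to_ge geo); exists J => // j /= Jj.
  rewrite -(HJ _ Jj) -innerBl //.
  apply: (le_trans (cauchy_schwarz _ Lw)); first exact: L2B.
  by rewrite ler_wpM2r ?normsq_ge0.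
exists y; split.
- split=> // k; rewrite fourierE; apply: lim => //; exists 0%N => j _.
  rewrite inner_partial_sum // big1 // => l _.
  by rewrite fourierE inner_zpow eq_sym freqN conjc0 mulr0.
- move=> k; rewrite fourierE; apply: lim => //; exists k => j kj.
  by rewrite -fourierE fourier_sum (leq_ltn_trans kj (jN' j)).
- move=> w [Lw w0]; apply: lim => //; exists 0%N => j _.
  rewrite inner_partial_sum // big1 // => l _.
  by have := w0 l; rewrite negbK => ->; rewrite conjc0 mulr0.
Qed.

(** x agrees with its own Fourier series, every partial sum of which is
orthogonal to w. *)
Lemma Hs_orth s x w : Hs s x -> Hs (~~ s) w -> inner x w = 0.
Proof.
move=> Hx Hw; have [y [Hy yx yw]] := fourier_part s (Hs_L2 Hx).
rewrite -(yw _ Hw); apply: inner_ae; try exact: Hs_L2; last exact: ae_refl.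
- exact: Hs_L2 Hx.
- exact: Hs_L2 Hy.
- exact: Hs_L2 Hw.
- exact: Hs_L2 Hw.
apply: ae_subr0; apply: (@Hs_meet s); first exact: HsB.
split; first by apply: L2B; apply: Hs_L2; [exact: Hx|exact: Hy].
move=> k; rewrite negbK fourierE innerBl //; try exact: Hs_L2.
- by rewrite -!fourierE yx subrr.
- exact: Hs_L2 Hx.
- exact: Hs_L2 Hy.
Qed.

Definition proj s x := if s then Pplus x else Pminus x.

Lemma proj_sum x : proj true x + proj false x = x.
Proof. by rewrite /proj /Pminus addrC subrK. Qed.

Lemma proj_split s x : x = proj s x + proj (~~ s) x.
Proof. by case: s; rewrite ?proj_sum // addrC proj_sum. Qed.

Lemma Pplus_spec x : L2 x ->
  Hardy2 (Pplus x) /\ forall h, Hardy2 h -> inner (x - Pplus x) h = 0.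
Proof.
move=> Lx; have [y [Hy yx yw]] := fourier_part true Lx.
apply: (@xgetPex _ 0 [set y | Hardy2 y /\ forall h, Hardy2 h -> inner (x - y) h = 0]).
exists y; split; first exact/Hardy2E.
move=> h /Hardy2E Hh; apply: (@Hs_orth false) => //.
split; first by apply: L2B => //; exact: Hs_L2 Hy.
move=> k; rewrite fourierE innerBl //; last exact: Hs_L2 Hy.
by rewrite -!fourierE yx subrr.
Qed.

Lemma Hs_proj s x : L2 x -> Hs s (proj s x).
Proof.
move=> Lx; have [Hp orth] := Pplus_spec Lx.
have [Lp _] := Hp; case: s; first exact/Hardy2E.
split; first exact: L2B.
by move=> k; rewrite fourierE orth //; apply/Hardy2E; exact: (Hs_zpow true).
Qed.

Lemma L2_proj s x : L2 x -> L2 (proj s x).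
Proof. by move=> /(Hs_proj s)/Hs_L2. Qed.

(** Two decompositions of x differ by an element of both summands, which
vanishes by [Hs_meet]. *)
Lemma proj_uniq s x a b : L2 x -> ae_equal x (a + b) -> Hs s a -> Hs (~~ s) b ->
  ae_equal (proj s x) a.
Proof.
move=> Lx xab Ha Hb; apply: ae_subr0; apply: (@Hs_meet s).
  by apply: HsB => //; exact: Hs_proj.
apply: (@Hs_ae _ (b - proj (~~ s) x)).
- by apply: L2B; [exact: L2_proj|exact: Hs_L2 Ha].
- move: xab; apply: filterS => z; rewrite {1}(proj_split s x) !fctE => E.
  by move/eqP: E; rewrite -subr_eq => /eqP <-; ring.
- by apply: HsB => //; exact: Hs_proj.
Qed.

Lemma proj_id s x : Hs s x -> ae_equal (proj s x) x.
Proof.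
move=> Hx; apply: (@proj_uniq s x x 0) => //; last exact: Hs0.
  exact: Hs_L2 Hx.
by rewrite addr0; exact: ae_refl.
Qed.

Lemma proj_0 s x : Hs (~~ s) x -> ae_equal (proj s x) 0.
Proof.
move=> Hx; apply: (@proj_uniq s x 0 x) => //; last exact: Hs0.
  exact: Hs_L2 Hx.
by rewrite add0r; exact: ae_refl.
Qed.

Lemma proj_ae0 s x : L2 x -> ae_equal (proj s x) 0 -> Hs (~~ s) x.
Proof.
move=> Lx p0; apply: (@Hs_ae _ (proj (~~ s) x)) => //; last exact: Hs_proj.
move: p0; apply: filterS => z; rewrite {3}(proj_split s x) !fctE => ->.
by rewrite add0r.
Qed.

Lemma projD s x y : L2 x -> L2 y ->
  ae_equal (proj s (x + y)) (proj s x + proj s y).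
Proof.
move=> Lx Ly; apply: (@proj_uniq s _ _ (proj (~~ s) x + proj (~~ s) y)).
- exact: L2D.
- by rewrite {1}(proj_split s x) {1}(proj_split s y) addrACA; exact: ae_refl.
- by apply: HsD; exact: Hs_proj.
- by apply: HsD; exact: Hs_proj.
Qed.

Lemma projZ s c x : L2 x -> ae_equal (proj s (c *: x)) (c *: proj s x).
Proof.
move=> Lx; apply: (@proj_uniq s _ _ (c *: proj (~~ s) x)).
- exact: L2Z.
- by rewrite -scalerDr -proj_split; exact: ae_refl.
- by apply: HsZ; exact: Hs_proj.
- by apply: HsZ; exact: Hs_proj.
Qed.

Lemma proj_ae s x y : L2 x -> L2 y -> ae_equal x y -> ae_equal (proj s x) (proj s y).
Proof.
move=> Lx Ly xy; apply: (@proj_uniq s _ _ (proj (~~ s) y)) => //.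
- by rewrite -proj_split.
- exact: Hs_proj.
- exact: Hs_proj.
Qed.

Lemma inner_proj s x w : L2 x -> Hs s w -> inner x w = inner (proj s x) w.
Proof.
move=> Lx Hw; rewrite {1}(proj_split s x) innerDl; try exact: L2_proj.
  by rewrite (@Hs_orth (~~ s) (proj (~~ s) x)) ?addr0 ?negbK //; exact: Hs_proj.
exact: Hs_L2 Hw.
Qed.

(** The bounded multipliers of the summand s: the Hardy algebra, or the
conjugates of its elements. *)
Definition Hinf s a := Hinfty (if s then a else bar a).

Lemma Hinf_Linfty s a : Hinf s a -> Linfty a.
Proof. by case: s => -[La _] //; rewrite -(barK a); exact: Linfty_bar. Qed.

Lemma fourier_bar x j : L2 x -> fourier (bar x) j = cj (fourier x (- j)).
Proof.
move=> Lx; rewrite !fourierE /inner bar_zpow -cintegral_bar.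
  by rewrite barM !bar_zpow opprK.
by apply: L2_cintM => //; rewrite ?bar_zpow; exact: L2_zpow.
Qed.

Lemma fourier_zpowM x j m : fourier (zpow m * x) j = fourier x (j - m).
Proof. by rewrite fourierE innerMl bar_zpow -zpowD addrC. Qed.

(** On the Hardy space, pass a to the other side of the inner product: the
conjugate of a times a negative frequency is orthogonal to x. On the complement,
use the adjoint of the first case. *)
Lemma Hs_mul s a x : Hinf s a -> Hs s x -> Hs s (a * x).
Proof.
have plus a' x' : Hinf true a' -> Hs true x' -> Hs true (a' * x').
  move=> [La /Hardy2E[La2 a0]] Hx; split; first exact: Linfty_L2M La (Hs_L2 Hx).
  move=> k; rewrite fourierE innerMl; apply: (Hs_orth Hx).
  split; first by apply: Linfty_L2M => //; exact: Linfty_bar.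
  move=> l; rewrite mulrC fourier_zpowM fourier_bar //.
  rewrite (_ : - _ = freq (~~ true) (k + l)) ?a0 ?conjc0 //.
  by rewrite /freq /=; lia.
case: s; first exact: plus.
move=> Ha Hx; have La := Hinf_Linfty Ha.
split; first exact: Linfty_L2M La (Hs_L2 Hx).
move=> k; rewrite fourierE innerMl; apply: (Hs_orth Hx).
by apply: plus => //; exact: Hs_zpow.
Qed.

Lemma Hs_Hinf s a : Linfty a -> Hs true (if s then a else bar a) -> Hinf s a.
Proof.
by move=> La Ha; split; [case: s {Ha} => //; exact: Linfty_bar|exact/Hardy2E].
Qed.

Lemma bar_zcoord : bar (@zcoord R) = zpow (- 1).
Proof. by rewrite -zpow1 bar_zpow. Qed.

Lemma L2_V x : L2 x -> L2 (V x).
Proof.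
move=> Lx; rewrite /V bar_zcoord; apply: Linfty_L2M; first exact: Linfty_zpow.
exact: L2_bar.
Qed.

Lemma Hs_V s x : Hs s x -> Hs (~~ s) (V x).
Proof.
move=> [Lx x0]; split=> [|k]; first exact: L2_V.
rewrite /V bar_zcoord fourier_zpowM fourier_bar //.
rewrite (_ : - _ = freq (~~ s) k) ?x0 ?conjc0 //.
by case: s {x0}; rewrite /freq /=; lia.
Qed.

Lemma VD x y : V (x + y) = V x + V y.
Proof. by rewrite /V barD mulrDr. Qed.

Lemma proj_V s x : L2 x -> ae_equal (proj s (V x)) (V (proj (~~ s) x)).
Proof.
move=> Lx; apply: (@proj_uniq s _ _ (V (proj s x))).
- exact: L2_V.
- by rewrite -VD addrC -proj_split; exact: ae_refl.
- by rewrite -{1}(negbK s); apply: Hs_V; exact: Hs_proj.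
- by apply: Hs_V; exact: Hs_proj.
Qed.

End Projections.

(** * The blocks of the commutator *)

Section Entries.
Context {R : realType}.
Local Notation T := (circle R).
Local Notation C := R[i].
Implicit Types (H : 'M[T -> C]_2) (r s t : bool).

Definition slot s : 'I_2 := if s then 0 else 1.
Definition entry H r t : T -> C := H (slot r) (slot t).

Definition bounded H := forall r t, Linfty (entry H r t).

End Entries.

(** Guided by the syntax of the function, which it never unfolds: unification up to
unfolding is prohibitively slow on functions. *)
Ltac solve_lp := lazymatch goal with
  | |- forall _, _ => intro; solve_lp
  | |- L2 (@Algebra.add _ _ _) => apply: L2D; solve_lp
  | |- L2 (@Algebra.opp _ _) => apply: L2N; solve_lp
  | |- L2 (@Algebra.zero _) => exact: L2_0
  | |- L2 (@GRing.scale _ _ _ _) => apply: L2Z; solve_lp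
  | |- L2 (@GRing.mul _ _ _) => apply: Linfty_L2M; solve_lp
  | |- L2 (proj _ _) => apply: L2_proj; solve_lp
  | |- L2 (V _) => apply: L2_V; solve_lp
  | |- L2 (bar _) => first [assumption | apply: L2_bar; solve_lp]
  | |- L2 (zpow _) => exact: L2_zpow
  | |- L2 _ => first [assumption | match goal with Hx : Hs _ _ |- _ => exact (Hs_L2 Hx) end
                     | apply: Linfty_L2; solve_lp]
  | |- Linfty (@Algebra.add _ _ _) => apply: LinftyD; solve_lp
  | |- Linfty (@Algebra.opp _ _) => apply: LinftyN; solve_lp
  | |- Linfty (@Algebra.zero _) => exact: (Linfty_cst 0)
  | |- Linfty (@GRing.scale _ _ _ _) => apply: LinftyZ; solve_lp
  | |- Linfty (@GRing.mul _ _ _) => apply: LinftyM; solve_lp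
  | |- Linfty (bar _) => first [assumption | apply: Linfty_bar; solve_lp]
  | |- Linfty (zpow _) => exact: Linfty_zpow
  | |- Linfty _ => first [assumption | match goal with
       | Hx : Hinf _ ?a |- Linfty ?a => exact (Hinf_Linfty Hx) 
       | Hx : bounded ?H |- Linfty (entry ?H _ _) => exact (Hx _ _) end]
  end.

Section Blocks.
Context {R : realType}.
Local Notation T := (circle R).
Local Notation C := R[i].
Implicit Types (f g x y w a b h : T -> C) (H : 'M[T -> C]_2).
Implicit Types (s r t : bool).

(** The block in row r and column t of the product of the two operators, before
the outer projection. *)
Definition mix H1 H2 r t x : T -> C :=
  entry H1 r true * proj true (entry H2 true t * x) +
  entry H1 r false * proj false (entry H2 false t * x).

Lemma L2_mix H1 H2 r t x : bounded H1 -> bounded H2 -> L2 x ->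
  L2 (mix H1 H2 r t x).
Proof. by move=> b1 b2 Lx; rewrite /mix; solve_lp. Qed.

Lemma cauchyRE H x : cauchyR H x =
  (proj true (entry H true true * proj true x) +
   proj true (entry H true false * proj false x)) +
  (proj false (entry H false true * proj true x) +
   proj false (entry H false false * proj false x)).
Proof. by rewrite [RHS]addrACA [RHS]addrA. Qed.

Definition image_part H s x := proj s (entry H s true * proj true x) +
  proj s (entry H s false * proj false x).

Lemma Hs_image_part H s x : bounded H -> L2 x -> Hs s (image_part H s x).
Proof. by move=> bH Lx; apply: HsD; apply: Hs_proj; solve_lp. Qed.

Lemma L2_cauchyR H x : bounded H -> L2 x -> L2 (cauchyR H x).
Proof. by move=> bH Lx; rewrite cauchyRE; solve_lp. Qed.

Lemma proj_cauchyR H s x : bounded H -> L2 x ->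
  ae_equal (proj s (cauchyR H x)) (image_part H s x).
Proof.
move=> bH Lx; apply: (@proj_uniq _ s _ _ (image_part H (~~ s) x)).
- exact: L2_cauchyR.
- have -> : cauchyR H x = image_part H true x + image_part H false x.
    exact: cauchyRE.
  case: s; first exact: ae_refl.
  by rewrite [X in ae_equal X]addrC; exact: ae_refl.
- exact: Hs_image_part.
- exact: Hs_image_part.
Qed.

Lemma proj_cauchyR_comp H1 H2 r x : bounded H1 -> bounded H2 -> L2 x ->
  ae_equal (proj r (cauchyR H1 (cauchyR H2 x)))
    (proj r (mix H1 H2 r true (proj true x)) +
     proj r (mix H1 H2 r false (proj false x))).
Proof.
move=> b1 b2 Lx; have L2x := L2_cauchyR b2 Lx.
apply: ae_trans (proj_cauchyR _ b1 L2x) _.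
have step t : ae_equal (proj r (entry H1 r t * proj t (cauchyR H2 x)))
    (proj r (entry H1 r t * proj t (entry H2 t true * proj true x)) +
     proj r (entry H1 r t * proj t (entry H2 t false * proj false x))).
  apply: ae_trans (projD _ _ _); [|solve_lp|solve_lp].
  apply: proj_ae; [solve_lp|solve_lp|].
  by rewrite -mulrDr; apply: aeM; [exact: ae_refl|exact: proj_cauchyR].
apply: ae_trans (aeD (step true) (step false)) _.
rewrite addrACA; apply: ae_sym.
by apply: aeD; apply: projD; solve_lp.
Qed.

Lemma projN r x : L2 x -> ae_equal (proj r (- x)) (- proj r x).
Proof.
by move=> Lx; rewrite -(scaleN1r x) -(scaleN1r (proj r x)); exact: projZ.
Qed.

Lemma projB r x y : L2 x -> L2 y ->
  ae_equal (proj r (x - y)) (proj r x - proj r y).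
Proof.
move=> Lx Ly; apply: ae_trans (projD r Lx (L2N Ly)) _.
by apply: aeD; [exact: ae_refl|exact: projN].
Qed.

Lemma proj_zero r x : L2 x -> ae_equal x 0 -> ae_equal (proj r x) 0.
Proof.
move=> Lx x0; apply: proj_0; apply: Hs_ae (ae_sym x0) _ => //; exact: Hs0.
Qed.

Lemma aeM0 a x : ae_equal x 0 -> ae_equal (a * x) 0.
Proof. by move=> x0; rewrite -(mulr0 a); apply: aeM x0; exact: ae_refl. Qed.

Lemma aeD0 x y : ae_equal x 0 -> ae_equal y 0 -> ae_equal (x + y) 0.
Proof. by move=> x0 y0; rewrite -(addr0 0); exact: aeD. Qed.

Lemma aeDr0 x x' y : ae_equal x x' -> ae_equal y 0 -> ae_equal (x + y) x'.
Proof. by move=> xx' y0; rewrite -[x']addr0; exact: aeD. Qed.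

Lemma ae_proj x y : (forall s, ae_equal (proj s x) (proj s y)) -> ae_equal x y.
Proof.
by move=> xy; rewrite -(proj_sum x) -(proj_sum y); apply: aeD; exact: xy.
Qed.

Lemma proj_cauchyR_comp_half H1 H2 r t x :
  bounded H1 -> bounded H2 -> Hs t x ->
  ae_equal (proj r (cauchyR H1 (cauchyR H2 x))) (proj r (mix H1 H2 r t x)).
Proof.
move=> b1 b2 Hx; have Lx := Hs_L2 Hx.
apply: ae_trans (proj_cauchyR_comp r b1 b2 Lx) _.
have pt : ae_equal (proj r (mix H1 H2 r t (proj t x))) (proj r (mix H1 H2 r t x)).
  apply: proj_ae; [by rewrite /mix; solve_lp|by rewrite /mix; solve_lp|].
  have q u : ae_equal (proj u (entry H2 u t * proj t x)) (proj u (entry H2 u t * x)).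
    apply: proj_ae; [solve_lp|solve_lp|].
    by apply: aeM; [exact: ae_refl|exact: proj_id].
  by apply: aeD; apply: aeM (q _); exact: ae_refl.
have p0 : ae_equal (proj r (mix H1 H2 r (~~ t) (proj (~~ t) x))) 0.
  apply: proj_zero; first by rewrite /mix; solve_lp.
  have xt : ae_equal (proj (~~ t) x) 0 by apply: proj_0; rewrite negbK.
  have q u : ae_equal (proj u (entry H2 u (~~ t) * proj (~~ t) x)) 0.
    by apply: proj_zero; [solve_lp|exact: aeM0].
  by apply: aeD0; exact: aeM0.
case: t pt p0 {Hx} => pt p0; first exact: aeDr0.
by rewrite addrC; exact: aeDr0.
Qed.

Lemma commute_blocks H1 H2 : bounded H1 -> bounded H2 ->
  (forall x, L2 x ->
     ae_equal (cauchyR H1 (cauchyR H2 x)) (cauchyR H2 (cauchyR H1 x))) <->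
  (forall r t x, Hs t x -> Hs (~~ r) (mix H1 H2 r t x - mix H2 H1 r t x)).
Proof.
move=> b1 b2; split=> [com r t x Hx|blk x Lx].
- have Lx := Hs_L2 Hx.
  apply: (@proj_ae0 _ r); first by apply: L2B; exact: L2_mix.
  apply: ae_trans (projB r (L2_mix _ _ b1 b2 Lx) (L2_mix _ _ b2 b1 Lx)) _.
  apply: ae_sub0; apply: ae_trans (ae_sym (proj_cauchyR_comp_half r b1 b2 Hx)) _.
  apply: ae_trans (proj_cauchyR_comp_half r b2 b1 Hx).
  by apply: proj_ae; [..|exact: com]; do 2! [apply: L2_cauchyR; first by []].
- have same r : ae_equal (proj r (cauchyR H1 (cauchyR H2 x)))
    (proj r (cauchyR H2 (cauchyR H1 x))).
    apply: ae_trans (proj_cauchyR_comp r b1 b2 Lx) _.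
    apply: ae_sym; apply: ae_trans (proj_cauchyR_comp r b2 b1 Lx) _.
    have q t : ae_equal (proj r (mix H2 H1 r t (proj t x)))
        (proj r (mix H1 H2 r t (proj t x))).
      apply: ae_sym; apply: ae_subr0; have Lt := L2_proj t Lx.
      apply: ae_trans (ae_sym (projB r (L2_mix _ _ b1 b2 Lt) (L2_mix _ _ b2 b1 Lt))) _.
      by apply: proj_0; apply: blk; exact: Hs_proj.
    exact: aeD.
  exact: ae_proj.
Qed.

End Blocks.

(** * Differences of sandwich products *)

Section Forms.
Context {R : realType}.
Local Notation T := (circle R).
Local Notation C := R[i].
Local Notation cj := (@conjc R).
Implicit Types (f g x y w a b h : T -> C) (H : 'M[T -> C]_2).
Implicit Types (s r t : bool) (l m al : C).

(** The four ways in which a difference of two tensors, p (x) q - p' (x) q',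
collapses to a single one: p is a multiple of p', p' of p, q of q', or q' of q.
*)
Variant form := LeftMul | LeftMulRev | RightMul | RightMulRev.

(** With [right_factor], the factors of the single tensor, in terms of symbols.
A tensor is conjugate linear in its right vector, and that vector is attached to
the conjugate of the symbol, whence the conjugates of l. *)
Definition left_factor (i : form) l a a' : T -> C :=
  match i with
  | LeftMul => a' | LeftMulRev => a
  | RightMul => cj l *: a - a' | RightMulRev => a - cj l *: a'
  end.

Definition right_factor (i : form) l b b' : T -> C :=
  match i with
  | LeftMul => l *: b - b' | LeftMulRev => b - l *: b'
  | RightMul => b' | RightMulRev => b
  end.

(** A dependence between right symbols holds only up to a multiplier, which
contributes this multiplication operator. *)
Definition residue (i : form) l a a' b b' : T -> C :=
  match i with
  | LeftMul | LeftMulRev => 0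
  | RightMul => a * (b - cj l *: b') | RightMulRev => - (a' * (b' - cj l *: b))
  end.

Definition dependence (i : form) l (Nl Nr : (T -> C) -> Prop) a a' b b' :=
  match i with
  | LeftMul => Nl (a - l *: a') | LeftMulRev => Nl (a' - l *: a)
  | RightMul => Nr (b - cj l *: b') | RightMulRev => Nr (b' - cj l *: b)
  end.

Definition sandwich s a b x := a * proj s (b * x).

Lemma scalefE c f (z : T) : (c *: f) z = c * f z.
Proof. by []. Qed.

Lemma addcfE f g (z : T) : (f + g) z = f z + g z. Proof. by []. Qed.
Lemma oppcfE f (z : T) : (- f) z = - f z. Proof. by []. Qed.
Lemma mulcfE f g (z : T) : (f * g) z = f z * g z. Proof. by []. Qed.
Lemma zerocfE (z : T) : (0 : T -> C) z = 0. Proof. by []. Qed.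
Definition pointE := (scalefE, addcfE, oppcfE, mulcfE, zerocfE).

Lemma scaleMl c f g : (c *: f) * g = c *: (f * g).
Proof. by apply/funext => z; rewrite !pointE mulrA. Qed.

Lemma proj_mulB s b b' x : Linfty b -> Linfty b' -> L2 x ->
  ae_equal (proj s ((b - b') * x)) (proj s (b * x) - proj s (b' * x)).
Proof. by move=> Lb Lb' Lx; rewrite mulrBl; apply: projB; solve_lp. Qed.

Lemma proj_mulZ s c b x : Linfty b -> L2 x ->
  ae_equal (proj s ((c *: b) * x)) (c *: proj s (b * x)).
Proof. by move=> Lb Lx; rewrite scaleMl; apply: projZ; solve_lp. Qed.

Lemma proj_mulBZ s c b b' x : Linfty b -> Linfty b' -> L2 x ->
  ae_equal (proj s ((b - c *: b') * x)) (proj s (b * x) - c *: proj s (b' * x)).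
Proof.
move=> Lb Lb' Lx; apply: ae_trans (proj_mulB _ _ _ _) _; [solve_lp..|].
by apply: aeB; [exact: ae_refl|exact: proj_mulZ].
Qed.

Lemma proj_mulZB s c b b' x : Linfty b -> Linfty b' -> L2 x ->
  ae_equal (proj s ((c *: b - b') * x)) (c *: proj s (b * x) - proj s (b' * x)).
Proof.
move=> Lb Lb' Lx; apply: ae_trans (proj_mulB _ _ _ _) _; [solve_lp..|].
by apply: aeB; [exact: proj_mulZ|exact: ae_refl].
Qed.

Lemma proj_Hinf s t b x : Hinf t b -> Hs t x ->
  ae_equal (proj s (b * x)) (if s == t then b * x else 0).
Proof.
move=> Hb Hx; have Hbx := Hs_mul Hb Hx; case: eqP => [->|/eqP st].
  exact: proj_id.
by apply: proj_0; rewrite (_ : ~~ s = t) //; case: s t st {Hb Hx Hbx} => -[].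
Qed.

Lemma Linfty_left i l a a' : Linfty a -> Linfty a' ->
  Linfty (left_factor i l a a').
Proof. by move=> La La'; case: i; rewrite /left_factor; solve_lp. Qed.

Lemma Linfty_right i l b b' : Linfty b -> Linfty b' ->
  Linfty (right_factor i l b b').
Proof. by move=> Lb Lb'; case: i; rewrite /right_factor; solve_lp. Qed.

Lemma Linfty_residue i l a a' b b' : Linfty a -> Linfty a' -> Linfty b ->
  Linfty b' -> Linfty (residue i l a a' b b').
Proof. by move=> *; case: i; rewrite /residue; solve_lp. Qed.

(** If the dependence is between the left symbols, the error is a multiplier of
[Hs s] times a projection on [Hs s]. If it is between the right symbols, the
error is a projection of a multiplier of [Hs t] times x, which is the product
itself if s = t and 0 otherwise. *)
Lemma sandwich_form s t (i : form) l a a' b b' x :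
  Linfty a -> Linfty a' -> Linfty b -> Linfty b' -> Hs t x ->
  dependence i l (Hinf s) (Hinf t) a a' b b' ->
  Hs s (sandwich s a b x - sandwich s a' b' x -
    sandwich s (left_factor i l a a') (right_factor i l b b') x -
    (if s == t then residue i l a a' b b' * x else 0)).
Proof.
move=> La La' Lb Lb' Hx; have Lx := Hs_L2 Hx.
have LL : L2 (sandwich s a b x - sandwich s a' b' x -
    sandwich s (left_factor i l a a') (right_factor i l b b') x -
    (if s == t then residue i l a a' b b' * x else 0)).
  have Ll := Linfty_left i l La La'; have Lr := Linfty_right i l Lb Lb'.
  have Lz := Linfty_residue i l La La' Lb Lb'.
  by rewrite /sandwich; case: (s == t); solve_lp.
move: LL; case: i => LL dep.
- apply: (Hs_ae LL (x := (a - l *: a') * proj s (b * x))); last first.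
    by apply: Hs_mul dep _; apply: Hs_proj; solve_lp.
  have := proj_mulZB s l Lb Lb' Lx; apply: filterS => z.
  rewrite /sandwich /left_factor /right_factor /residue mul0r if_same subr0 !pointE => ->; ring.
- apply: (Hs_ae LL (x := - ((a' - l *: a) * proj s (b' * x)))); last first.
    by apply: HsN; apply: Hs_mul dep _; apply: Hs_proj; solve_lp.
  have := proj_mulBZ s l Lb Lb' Lx; apply: filterS => z.
  rewrite /sandwich /left_factor /right_factor /residue mul0r if_same subr0 !pointE => ->; ring.
- apply: (Hs_ae LL (x := 0)); last exact: Hs0.
  have := proj_mulBZ s (cj l) Lb Lb' Lx; have := proj_Hinf s dep Hx.
  apply: filterS2 => z; rewrite /sandwich /left_factor /right_factor /residue.
  case: (s == t); rewrite !pointE => -> E;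
    rewrite -[proj s (b * x) z](subrK (cj l * proj s (b' * x) z)) -E; ring.
- apply: (Hs_ae LL (x := 0)); last exact: Hs0.
  have := proj_mulBZ s (cj l) Lb' Lb Lx; have := proj_Hinf s dep Hx.
  apply: filterS2 => z; rewrite /sandwich /left_factor /right_factor /residue.
  case: (s == t); rewrite !pointE => -> E;
    rewrite -[proj s (b' * x) z](subrK (cj l * proj s (b * x) z)) -E; ring.
Qed.

(** The function by which the commutator multiplies on a block with s = t, apart
from [cross_symbol]. *)
Definition symbol i l j m al a1 a1' b1 b1' a2 a2' b2 b2' : T -> C :=
  left_factor j m a2 a2' *
    (al *: right_factor i l b2 b2' - right_factor j m b1 b1') +
  residue i l a1 a1' b2 b2' - residue j m a2 a2' b1 b1'.

(** [sandwich_form] leaves the two products A P_s(B x) and A' P_s(B' x). The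
first equals al A' P_s(B x) up to [Hs s], and B' - al B is a multiplier of [Hs
t]. *)
Lemma sandwich_symbol s t i l j m al a1 a1' b1 b1' a2 a2' b2 b2' x :
  Linfty a1 -> Linfty a1' -> Linfty b1 -> Linfty b1' ->
  Linfty a2 -> Linfty a2' -> Linfty b2 -> Linfty b2' -> Hs t x ->
  dependence i l (Hinf s) (Hinf t) a1 a1' b2 b2' ->
  dependence j m (Hinf s) (Hinf t) a2 a2' b1 b1' ->
  Hinf s (left_factor i l a1 a1' - al *: left_factor j m a2 a2') ->
  Hinf t (right_factor j m b1 b1' - al *: right_factor i l b2 b2') ->
  Hs s ((sandwich s a1 b2 x - sandwich s a1' b2' x) - (sandwich s a2 b1 x - sandwich s a2' b1' x) -
    (if s == t then symbol i l j m al a1 a1' b1 b1' a2 a2' b2 b2' * x else 0)).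
Proof.
move=> La1 La1' Lb1 Lb1' La2 La2' Lb2 Lb2' Hx di dj HA HB.
have Lx := Hs_L2 Hx.
have E1 := sandwich_form La1 La1' Lb2 Lb2' Hx di.
have E2 := sandwich_form La2 La2' Lb1 Lb1' Hx dj.
have := Linfty_left i l La1 La1'; have := Linfty_right i l Lb2 Lb2'.
have := Linfty_left j m La2 La2'; have := Linfty_right j m Lb1 Lb1'.
have := Linfty_residue i l La1 La1' Lb2 Lb2'.
have := Linfty_residue j m La2 La2' Lb1 Lb1'.
move: E1 E2 HA HB; rewrite /symbol.
move: (left_factor i l a1 a1') (left_factor j m a2 a2') => A A'.
move: (right_factor i l b2 b2') (right_factor j m b1 b1') => B B'.
move: (residue i l _ _ _ _) (residue j m _ _ _ _) => r r'.
move=> E1 E2 HA HB Lr' Lr LB' LA' LB LA.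
have E3 : Hs s ((A - al *: A') * proj s (B * x)).
  by apply: Hs_mul HA _; apply: Hs_proj; solve_lp.
apply: (Hs_ae _ _ (HsD (HsB E1 E2) E3)).
  by rewrite /sandwich; case: (s == t); solve_lp.
have := proj_mulBZ s al LB' LB Lx; have := proj_Hinf s HB Hx.
have sandwichE a b z : sandwich s a b x z = a z * proj s (b * x) z by [].
apply: filterS2 => z.
case: (s == t); rewrite !pointE => -> E; rewrite (sandwichE A) (sandwichE A').
all: rewrite -[proj s (B' * x) z](subrK (al * proj s (B * x) z)) -E.
all: move: (sandwich _ _ _ _ z) (sandwich _ _ _ _ z) (sandwich _ _ _ _ z) (sandwich _ _ _ _ z) (proj s _ z).
all: by move=> p1 p2 p3 p4 p5; ring.
Qed.

End Forms.

(** * The shift and the Hankel vectors *)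

Section Shift.
Context {R : realType}.
Local Notation T := (circle R).
Local Notation C := R[i].
Implicit Types (f g x y w a b h : T -> C) (H : 'M[T -> C]_2).
Implicit Types (s r t : bool) (l m al c : C).

(** The character of the summand s next to the other summand. *)
Definition edge s : T -> C := zpow (freq s 0).

(** The character of degree 1 or -1 by which multiplication moves the summand s
away from the other summand. *)
Definition outward s : T -> C := zpow (if s then 1 else -1).

Lemma Linfty_edge s : Linfty (edge s). Proof. exact: Linfty_zpow. Qed.
Lemma Linfty_outward s : Linfty (outward s). Proof. exact: Linfty_zpow. Qed.

Lemma Hs_edge s : Hs s (edge s). Proof. exact: Hs_zpow. Qed.

Lemma Hinf_outward s : Hinf s (outward s).
Proof.
apply: Hs_Hinf; first exact: Linfty_outward.
by case: s; rewrite /outward ?bar_zpow ?opprK; exact: (Hs_zpow true 1).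
Qed.

Lemma outwardK s y : outward s * (outward (~~ s) * y) = y.
Proof. by rewrite mulrA /outward -zpowD; case: s; rewrite /= ?subrr ?addNr zpow0 mul1r. Qed.

Lemma outward_edge s : outward s * edge (~~ s) = edge s.
Proof. by rewrite /outward /edge -zpowD; congr zpow; case: s; rewrite /freq. Qed.

Lemma bar_outward s : bar (outward s) = outward (~~ s).
Proof. by rewrite /outward bar_zpow; case: s; rewrite /= ?opprK. Qed.

(** A bounded function is a multiplier as soon as it maps the first character of
the summand into it. *)
Lemma Hs_edge_Hinf s a : Linfty a -> Hs s (a * edge s) -> Hinf s a.
Proof.
move=> La; case: s => Ha; apply: Hs_Hinf => //.
  by move: Ha; rewrite /edge /freq zpow0 mulr1.
have := Hs_V Ha; rewrite /V /edge /= barM bar_zpow bar_zcoord.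
by rewrite mulrCA -zpowD addrC subrr zpow0 mulr1.
Qed.

(** The image of the first character of the opposite summand under the Hankel
operator with symbol a ([hankel_edgeE]), in the form in which it enters the
columns of the theorem. *)
Definition hankel_edge r a : T -> C := if r then V (Pminus (bar a)) else Pminus a.

Lemma hankel_edgeE r a : Linfty a -> ae_equal (hankel_edge r a) (proj r (a * edge (~~ r))).
Proof.
move=> La; case: r; rewrite /hankel_edge /edge /=; last first.
  by rewrite zpow0 mulr1; exact: ae_refl.
apply: ae_sym; apply: ae_trans (proj_V true (x := bar a) _); last by solve_lp.
rewrite /V barK bar_zcoord mulrC; exact: ae_refl.
Qed.

Lemma L2_hankel_edge r a : Linfty a -> L2 (hankel_edge r a).
Proof.
move=> La; case: r; rewrite /hankel_edge -/(proj false _); solve_lp.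
Qed.

Lemma Hs_hankel_edge r a : Linfty a -> Hs r (hankel_edge r a).
Proof.
move=> La; apply: Hs_ae (L2_hankel_edge r La) (ae_sym (hankel_edgeE r La)) _.
by apply: Hs_proj; apply: Linfty_L2M => //; exact/Linfty_L2/Linfty_edge.
Qed.

Lemma hankel_edgeB r c a a' : Linfty a -> Linfty a' ->
  ae_equal (hankel_edge r (a - c *: a')) (hankel_edge r a - c *: hankel_edge r a').
Proof.
move=> La La'; have Le := Linfty_L2 (Linfty_edge (~~ r)).
apply: ae_trans (hankel_edgeE r _) _; first by solve_lp.
apply: ae_trans (proj_mulBZ r c La La' Le) _.
by apply: aeB; [|apply: aeZ]; apply: ae_sym; exact: hankel_edgeE.
Qed.

Lemma hankel_edgeZB r c a a' : Linfty a -> Linfty a' ->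
  ae_equal (hankel_edge r (c *: a - a')) (c *: hankel_edge r a - hankel_edge r a').
Proof.
move=> La La'; have Le := Linfty_L2 (Linfty_edge (~~ r)).
apply: ae_trans (hankel_edgeE r _) _; first by solve_lp.
apply: ae_trans (proj_mulZB r c La La' Le) _.
by apply: aeB; [apply: aeZ|]; apply: ae_sym; exact: hankel_edgeE.
Qed.

Lemma hankel_edge_eq0 r a : Linfty a -> ae_equal (hankel_edge r a) 0 -> Hinf (~~ r) a.
Proof.
move=> La a0; apply: (Hs_edge_Hinf La); apply: proj_ae0.
  exact: Linfty_L2M La (Linfty_L2 (Linfty_edge _)).
exact: ae_trans (ae_sym (hankel_edgeE r La)) a0.
Qed.

Lemma Hinf_bar s a : Hinf (~~ s) (bar a) = Hinf s a.
Proof. by case: s; rewrite /Hinf //= barK. Qed.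

(** Multiplication by [outward s] moves exactly one frequency from the
complement of [Hs s] into [Hs s], that of [edge (~~ s)]. *)
Lemma proj_outward s w : L2 w ->
  ae_equal (proj s (outward s * w))
    (outward s * proj s w + inner w (edge (~~ s)) *: edge s).
Proof.
move=> Lw; have Lo := Linfty_outward s; have Le := Linfty_L2 (Linfty_edge s).
have Hn := Hs_proj (~~ s) Lw; have Ln := Hs_L2 Hn.
set k := inner _ _.
apply: (@proj_uniq _ s _ _ (outward s * proj (~~ s) w - k *: edge s)).
- by solve_lp.
- by rewrite addrACA subrr addr0 -mulrDr -proj_split; exact: ae_refl.
- apply: HsD; last by apply: HsZ; exact: Hs_edge.
  by apply: Hs_mul (Hinf_outward s) _; exact: Hs_proj.
- split=> [|q]; first by solve_lp.
  have kE : k = inner (proj (~~ s) w) (edge (~~ s)).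
    by rewrite /k; apply: inner_proj => //; exact: Hs_edge.
  have Lq : L2 (zpow (R := R) (freq (~~ ~~ s) q)) by exact: L2_zpow.
  have Lon : L2 (outward s * proj (~~ s) w) by solve_lp.
  have Lke : L2 (k *: edge s) by solve_lp.
  rewrite fourierE (innerBl Lon Lke Lq).
  rewrite innerZl // /edge inner_zpow negbK freq_inj.
  rewrite -fourierE /outward fourier_zpowM.
  case: q {Lq} => [|q].
    rewrite eqxx mulr1 kE; apply/eqP; rewrite subr_eq0; apply/eqP.
    by congr (inner _ (zpow _)); case: s {Lon Lke k kE Lo Le Hn Ln}.
  rewrite mulr0 subr0; have [_ /(_ q) <-] := Hn.
  by congr (fourier _ _); case: s {Lon Lke k kE Lo Le Hn Ln}; rewrite /freq /=; lia.
Qed.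

End Shift.

(** * From blocks to tensors and symbols *)

Section Commutator.
Context {R : realType}.
Local Notation T := (circle R).
Local Notation C := R[i].
Implicit Types (f g x y w a b h : T -> C) (H : 'M[T -> C]_2).
Implicit Types (s r t : bool) (l m al c : C).

Definition block_sign s : C := if s then 1 else -1.

Definition sandwich_diff s a1 a1' b1 b1' a2 a2' b2 b2' x :=
  (sandwich s a1 b2 x - sandwich s a1' b2' x) - (sandwich s a2 b1 x - sandwich s a2' b1' x).

Definition sandwich_part H1 H2 s t := sandwich_diff s
  (entry H1 (~~ s) true) (entry H1 (~~ s) false) (entry H1 true t) (entry H1 false t)
  (entry H2 (~~ s) true) (entry H2 (~~ s) false) (entry H2 true t) (entry H2 false t).

Definition cross_symbol H1 H2 s t :=
  entry H1 (~~ s) (~~ s) * entry H2 (~~ s) t - entry H2 (~~ s) (~~ s) * entry H1 (~~ s) t.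

Definition block_symbol i l j m al H1 H2 s := symbol i l j m al
  (entry H1 (~~ s) true) (entry H1 (~~ s) false) (entry H1 true s) (entry H1 false s)
  (entry H2 (~~ s) true) (entry H2 (~~ s) false) (entry H2 true s) (entry H2 false s).

(** Replace the projection on [Hs (~~ s)] by the identity minus the projection
on [Hs s]. *)
Lemma mix_sandwich H1 H2 s t x : mix H1 H2 (~~ s) t x - mix H2 H1 (~~ s) t x =
  block_sign s *: sandwich_part H1 H2 s t x + cross_symbol H1 H2 s t * x.
Proof.
rewrite /mix /sandwich_part /sandwich_diff /sandwich /cross_symbol; apply/funext => z.
have E w : proj false w z = w z - proj true w z.
  by rewrite -{2}(proj_sum w) addcfE addrC addKr.
case: s; rewrite !pointE /block_sign [~~ _]/= !E !pointE.
all: move: (proj true _ z) (proj true _ z) (proj true _ z) (proj true _ z) => p1 p2 p3 p4.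
all: by ring.
Qed.

Lemma cross_symbol_neq H1 H2 s : cross_symbol H1 H2 s (~~ s) = 0.
Proof. by rewrite /cross_symbol mulrC subrr. Qed.

(** The memberships of the first eight functions of a list, arranged by block:
the two dependences, then the proportionality of the left and of the right
factors. *)
Record compatible i l j m al H1 H2 : Prop := Compatible {
  compat_dep1 : forall s t, dependence i l (Hinf s) (Hinf t)
    (entry H1 (~~ s) true) (entry H1 (~~ s) false) (entry H2 true t) (entry H2 false t);
  compat_dep2 : forall s t, dependence j m (Hinf s) (Hinf t)
    (entry H2 (~~ s) true) (entry H2 (~~ s) false) (entry H1 true t) (entry H1 false t);
  compat_left : forall s, Hinf s
    (left_factor i l (entry H1 (~~ s) true) (entry H1 (~~ s) false) -
     al *: left_factor j m (entry H2 (~~ s) true) (entry H2 (~~ s) false));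
  compat_right : forall t, Hinf t
    (right_factor j m (entry H1 true t) (entry H1 false t) -
     al *: right_factor i l (entry H2 true t) (entry H2 false t)) }.

Lemma Linfty_block_symbol i l j m al H1 H2 s : bounded H1 -> bounded H2 ->
  Linfty (cross_symbol H1 H2 s s + block_sign s *: block_symbol i l j m al H1 H2 s).
Proof.
move=> b1 b2; rewrite /cross_symbol /block_symbol /symbol.
have Ll := Linfty_left j m (b2 (~~ s) true) (b2 (~~ s) false).
have Lr := Linfty_right j m (b1 true s) (b1 false s).
have Lr' := Linfty_right i l (b2 true s) (b2 false s).
have Lz := Linfty_residue i l (b1 (~~ s) true) (b1 (~~ s) false) (b2 true s) (b2 false s).
have Lz' := Linfty_residue j m (b2 (~~ s) true) (b2 (~~ s) false) (b1 true s) (b1 false s).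
by solve_lp.
Qed.

(** By [sandwich_symbol] the blocks of the commutator are trivial for s <> t and
multiplications for s = t; evaluating a multiplication at the first character
shows that its symbol must be a multiplier. *)
Lemma blocks_symbol i l j m al H1 H2 : bounded H1 -> bounded H2 ->
  compatible i l j m al H1 H2 ->
  (forall r t x, Hs t x -> Hs (~~ r) (mix H1 H2 r t x - mix H2 H1 r t x)) <->
  (forall s, Hinf s (cross_symbol H1 H2 s s + block_sign s *: block_symbol i l j m al H1 H2 s)).
Proof.
move=> b1 b2 [ci cj' cA cB].
have diag s x : Hs s x -> Hs s (sandwich_part H1 H2 s s x - block_symbol i l j m al H1 H2 s * x).
  move=> Hx; have := sandwich_symbol (b1 _ _) (b1 _ _) (b1 _ _) (b1 _ _) (b2 _ _)
    (b2 _ _) (b2 _ _) (b2 _ _) Hx (ci s s) (cj' s s) (cA s) (cB s).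
  by rewrite eqxx.
have off s x : Hs (~~ s) x -> Hs s (sandwich_part H1 H2 s (~~ s) x).
  move=> Hx; have := sandwich_symbol (b1 _ _) (b1 _ _) (b1 _ _) (b1 _ _) (b2 _ _)
    (b2 _ _) (b2 _ _) (b2 _ _) Hx (ci s _) (cj' s _) (cA s) (cB _).
  by rewrite (_ : s == ~~ s = false) ?subr0 //; case: (s).
have LF s := Linfty_block_symbol i l j m al s b1 b2.
have sq s : block_sign s * block_sign s = 1 by case: s; rewrite /block_sign ?mulrNN mulr1.
have mixE s x : mix H1 H2 (~~ s) s x - mix H2 H1 (~~ s) s x =
    block_sign s *: (sandwich_part H1 H2 s s x - block_symbol i l j m al H1 H2 s * x) +
    (cross_symbol H1 H2 s s + block_sign s *: block_symbol i l j m al H1 H2 s) * x.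
  rewrite mix_sandwich; apply/funext => z; rewrite !pointE; ring.
split=> [blk s|Hf r t x Hx].
- have Hx := Hs_edge (R := R) s.
  apply: Hs_edge_Hinf; first exact: LF.
  have := blk (~~ s) s _ Hx; rewrite negbK mixE => /HsB/(_ (HsZ (block_sign s) (diag s _ Hx))).
  by rewrite addrC addKr.
- have [s ->] : exists s, r = ~~ s by exists (~~ r); rewrite negbK.
  rewrite negbK; have [st|/negbTE st] := eqVneq s t.
    rewrite -st in Hx *; rewrite mixE; apply: HsD; first by apply: HsZ; exact: diag.
    exact: Hs_mul (Hf s) Hx.
  have {}st : t = ~~ s by case: s t st {Hx} => -[].
  rewrite {}st in Hx *; rewrite mix_sandwich cross_symbol_neq mul0r addr0.
  by apply: HsZ; exact: off.
Qed.

Lemma inner_projr s x w : Hs s x -> L2 w -> inner x w = inner x (proj s w).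
Proof.
move=> Hx Lw; have Lx := Hs_L2 Hx.
by rewrite (innerC Lw Lx) (inner_proj Lw Hx) (innerC (L2_proj s Lw) Lx).
Qed.

Lemma hankel_edgeZ r c a : Linfty a -> ae_equal (hankel_edge r (c *: a)) (c *: hankel_edge r a).
Proof.
move=> La; have Le := Linfty_L2 (Linfty_edge (R := R) (~~ r)).
apply: ae_trans (hankel_edgeE r _) _; first by solve_lp.
apply: ae_trans (proj_mulZ r c La Le) _.
by apply: aeZ; apply: ae_sym; exact: hankel_edgeE.
Qed.

Lemma hankel_edgeBZ r c c' a a' : Linfty a -> Linfty a' ->
  ae_equal (hankel_edge r (c *: a - c' *: a')) (c *: hankel_edge r a - c' *: hankel_edge r a').
Proof.
move=> La La'; apply: ae_trans (hankel_edgeB r c' (LinftyZ c La) La') _.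
by apply: aeB; [exact: hankel_edgeZ|exact: ae_refl].
Qed.

(** Seen from the summand t, the scalar of the rank one term produced by the
shift on side s is the pairing with a Hankel vector, provided that x is first
shifted by one step when the two sides differ. *)
Lemma inner_edge s t b x : Linfty b -> Hs t x ->
  inner (b * (if s == t then x else outward t * x)) (edge (~~ s)) =
  inner x (hankel_edge t (bar b)).
Proof.
move=> Lb Hx; have Lx := Hs_L2 Hx; have Le := Linfty_edge (R := R) (~~ t).
have Lo := Linfty_outward (R := R) t.
have -> : inner x (hankel_edge t (bar b)) = inner (b * x) (edge (~~ t)).
  rewrite innerMl (@inner_projr t x (bar b * edge (~~ t)) Hx); last by solve_lp.
  apply: inner_ae; [solve_lp|solve_lp|by apply: L2_hankel_edge; exact: Linfty_bar|solve_lp|exact: ae_refl|].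
  by apply: hankel_edgeE; exact: Linfty_bar.
have [->//|st] := eqVneq s t.
have -> : s = ~~ t by case: s t st {Hx Le Lo} => -[].
by rewrite mulrCA (innerMl (outward t)) bar_outward outward_edge.
Qed.

(** The failure of a sandwich product to commute with the shift has rank one, by
[proj_outward]. *)
Lemma sandwich_outward s a b y : Linfty a -> Linfty b -> L2 y ->
  ae_equal (sandwich s a b (outward s * y) - outward s * sandwich s a b y)
    (inner (b * y) (edge (~~ s)) *: (a * edge s)).
Proof.
move=> La Lb Ly; have := @proj_outward _ s (b * y) _; move=> /(_ ltac:(solve_lp)).
rewrite /sandwich (mulrCA b); apply: filterS => z.
rewrite !pointE => ->; ring.
Qed.

Lemma sgn_cancel s f1 f0 g x y :
  block_sign s *: ((block_sign s *: f1 + g * (x * y)) - x * (block_sign s *: f0 + g * y)) = f1 - x * f0.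
Proof.
apply/funext => z; rewrite !pointE.
move: (f1 z) (f0 z) (g z) (x z) (y z) => F1 F0 G X Y.
by case: s; rewrite /block_sign; ring.
Qed.

Lemma defect_sum f1 f2 f3 f4 g1 g2 g3 g4 a1 a2 a3 a4 (c1 c2 c3 c4 : C) x y :
  ae_equal (f1 - x * g1) (c1 *: (a1 * y)) -> ae_equal (f2 - x * g2) (c2 *: (a2 * y)) ->
  ae_equal (f3 - x * g3) (c3 *: (a3 * y)) -> ae_equal (f4 - x * g4) (c4 *: (a4 * y)) ->
  ae_equal (f1 - f2 - (f3 - f4) - x * (g1 - g2 - (g3 - g4)))
    ((c1 *: a1 - c2 *: a2 - 1 *: (c3 *: a3 - c4 *: a4)) * y).
Proof.
move=> E1 E2 E3 E4; have := aeB (aeB E1 E2) (aeB E3 E4).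
apply: filterS => z; rewrite !pointE => E; apply: etrans (etrans E _); ring.
Qed.

(** Subtract the block relation at y, multiplied by the shift, from the relation
at the shifted y. The multiplication operators cancel, and the rank one terms
that remain add up to a function F times [edge s] which lies in [Hs s]; so F is
a multiplier and its Hankel vector vanishes. *)
Lemma blocks_tensor H1 H2 : bounded H1 -> bounded H2 ->
  (forall r t x, Hs t x -> Hs (~~ r) (mix H1 H2 r t x - mix H2 H1 r t x)) ->
  forall r t x, L2 x ->
  ae_equal
    (inner x (hankel_edge t (bar (entry H2 true t))) *: hankel_edge r (entry H1 r true) -
     inner x (hankel_edge t (bar (entry H2 false t))) *: hankel_edge r (entry H1 r false))
    (inner x (hankel_edge t (bar (entry H1 true t))) *: hankel_edge r (entry H2 r true) -
     inner x (hankel_edge t (bar (entry H1 false t))) *: hankel_edge r (entry H2 r false)).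
Proof.
move=> b1 b2 blk r t x0 Lx0.
(* The scalars depend only on the component of x0 in Hs t. *)
have [x [Hx red]] : exists x, Hs t x /\ forall b, Linfty b ->
    inner x0 (hankel_edge t (bar b)) = inner x (hankel_edge t (bar b)).
  exists (proj t x0); split; first exact: Hs_proj.
  by move=> b Lb; apply: inner_proj => //; apply: Hs_hankel_edge; exact: Linfty_bar.
rewrite (red _ (b1 true t)) (red _ (b1 false t)).
rewrite (red _ (b2 true t)) (red _ (b2 false t)).
have [s rs] : exists s, r = ~~ s by exists (~~ r); rewrite negbK.
(* The extra shift compensates the one that separates the edges of the two sides. *)
pose y := if s == t then x else outward t * x.
have Hy : Hs t y.
  by rewrite /y; case: ifP => // _; exact: Hs_mul (Hinf_outward t) Hx.
have Hoy : Hs t (outward s * y).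
  rewrite /y; have [->|st] := eqVneq s t; first exact: Hs_mul (Hinf_outward t) Hx.
  have -> : s = ~~ t by case: s t st {rs red Hx y Hy} => -[].
  by have := outwardK (~~ t) x; rewrite negbK => ->.
have Ly := Hs_L2 Hy.
rewrite rs -(inner_edge s (b1 true t) Hx) -(inner_edge s (b1 false t) Hx).
rewrite -(inner_edge s (b2 true t) Hx) -(inner_edge s (b2 false t) Hx) -/y.
pose k b := inner (b * y) (edge (~~ s)).
rewrite -/(k (entry H1 true t)) -/(k (entry H1 false t)).
rewrite -/(k (entry H2 true t)) -/(k (entry H2 false t)).
pose F := (k (entry H2 true t) *: entry H1 (~~ s) true -
           k (entry H2 false t) *: entry H1 (~~ s) false) -
          1 *: (k (entry H1 true t) *: entry H2 (~~ s) true -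
           k (entry H1 false t) *: entry H2 (~~ s) false).
have LF : Linfty F by rewrite /F; solve_lp.
have HF : Hs s (F * edge s).
  have Le := Linfty_edge (R := R) s.
  have H0 := blk (~~ s) t _ Hy; have H1' := blk (~~ s) t _ Hoy.
  rewrite negbK in H0 H1'.
  have Hd := HsZ (block_sign s) (HsB H1' (Hs_mul (Hinf_outward s) H0)).
  rewrite !mix_sandwich sgn_cancel in Hd.
  apply: (Hs_ae _ _ Hd); first by solve_lp.
  have P a b : Linfty a -> Linfty b -> ae_equal
      (sandwich s a b (outward s * y) - outward s * sandwich s a b y) (k b *: (a * edge s)).
    by move=> La Lb; exact: sandwich_outward.
  have P1 := P _ _ (b1 (~~ s) true) (b2 true t).
  have P2 := P _ _ (b1 (~~ s) false) (b2 false t).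
  have P3 := P _ _ (b2 (~~ s) true) (b1 true t).
  have P4 := P _ _ (b2 (~~ s) false) (b1 false t).
  exact: defect_sum P1 P2 P3 P4.
have F0 : ae_equal (hankel_edge (~~ s) F) 0.
  apply: ae_trans (hankel_edgeE _ LF) _; rewrite negbK; apply: proj_0.
  by rewrite negbK.
apply: ae_subr0; apply: ae_trans F0; apply: ae_sym.
apply: ae_trans (hankel_edgeB (~~ s) 1 _ _) _; [solve_lp|solve_lp|].
by rewrite scale1r; apply: aeB; apply: hankel_edgeBZ; first [exact: b1|exact: b2].
Qed.

End Commutator.

(** * Operators of rank one *)

Section RankOne.
Context {R : realType}.
Local Notation T := (circle R).
Local Notation C := R[i].
Local Notation T2 := ((T -> C) * (T -> C))%type.
Local Notation cj := (@conjc R).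
Implicit Types (p q r v w : T2) (l m al c : C).

Lemma L2L2D p q : L2L2 p -> L2L2 q -> L2L2 (p + q).
Proof. by move=> [p1 p2] [q1 q2]; split; exact: L2D. Qed.

Lemma L2L2Z c p : L2L2 p -> L2L2 (c *: p).
Proof. by move=> [p1 p2]; split; exact: L2Z. Qed.

Lemma L2L2N p : L2L2 p -> L2L2 (- p).
Proof. by move=> [p1 p2]; split; exact: L2N. Qed.

Lemma L2L2B p q : L2L2 p -> L2L2 q -> L2L2 (p - q).
Proof. by move=> Lp Lq; apply: (L2L2D Lp); exact: L2L2N. Qed.

Lemma fstB p q : (p - q).1 = p.1 - q.1. Proof. by []. Qed.
Lemma sndB p q : (p - q).2 = p.2 - q.2. Proof. by []. Qed.
Lemma fstZ c p : (c *: p).1 = c *: p.1. Proof. by []. Qed.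
Lemma sndZ c p : (c *: p).2 = c *: p.2. Proof. by []. Qed.

Lemma ae2_refl p : ae_equal2 p p. Proof. by split; exact: ae_refl. Qed.
Lemma ae2_sym p q : ae_equal2 p q -> ae_equal2 q p.
Proof. by move=> [? ?]; split; exact: ae_sym. Qed.
Lemma ae2_trans p q r : ae_equal2 p q -> ae_equal2 q r -> ae_equal2 p r.
Proof. by move=> [? ?] [? ?]; split; apply: ae_trans; eassumption. Qed.
Lemma ae2Z c p p' : ae_equal2 p p' -> ae_equal2 (c *: p) (c *: p').
Proof. by move=> [? ?]; split; exact: aeZ. Qed.
Lemma ae2B p p' q q' : ae_equal2 p p' -> ae_equal2 q q' ->
  ae_equal2 (p - q) (p' - q').
Proof. by move=> [? ?] [? ?]; split; exact: aeB. Qed.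
Lemma ae2_subr0 p q : ae_equal2 (p - q) 0 -> ae_equal2 p q.
Proof. by move=> [? ?]; split; exact: ae_subr0. Qed.

Lemma ae2_sub0 p q : ae_equal2 p q -> ae_equal2 (p - q) 0.
Proof.
by move=> [e1 e2]; split; rewrite ?fstB ?sndB; [exact: ae_sub0 e1|exact: ae_sub0 e2].
Qed.

Lemma ae2Z_eq0 c p : c != 0 -> ae_equal2 (c *: p) 0 -> ae_equal2 p 0.
Proof.
move=> c0 /(ae2Z c^-1); rewrite scalerA mulVf // scale1r scaler0; exact.
Qed.

Lemma inner2Bl p q r : L2L2 p -> L2L2 q -> L2L2 r ->
  inner2 (p - q) r = inner2 p r - inner2 q r.
Proof.
move=> [p1 p2] [q1 q2] [r1 r2].
by rewrite /inner2 fstB sndB (innerBl p1 q1 r1) (innerBl p2 q2 r2); ring.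
Qed.

Lemma inner2Zl c p r : L2L2 p -> L2L2 r -> inner2 (c *: p) r = c * inner2 p r.
Proof.
move=> [p1 p2] [r1 r2].
by rewrite /inner2 fstZ sndZ (innerZl c p1 r1) (innerZl c p2 r2) mulrDr.
Qed.

Lemma inner2Br p q r : L2L2 p -> L2L2 q -> L2L2 r ->
  inner2 r (p - q) = inner2 r p - inner2 r q.
Proof.
move=> [p1 p2] [q1 q2] [r1 r2].
by rewrite /inner2 fstB sndB (innerBr p1 q1 r1) (innerBr p2 q2 r2); ring.
Qed.

Lemma inner2Zr c p r : L2L2 p -> L2L2 r -> inner2 r (c *: p) = cj c * inner2 r p.
Proof.
move=> [p1 p2] [r1 r2].
by rewrite /inner2 fstZ sndZ (innerZr c p1 r1) (innerZr c p2 r2) mulrDr.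
Qed.

Lemma inner2_aer p q r : L2L2 p -> L2L2 q -> L2L2 r -> ae_equal2 p q ->
  inner2 r p = inner2 r q.
Proof.
move=> [p1 p2] [q1 q2] [r1 r2] [e1 e2]; rewrite /inner2.
by congr (_ + _); apply: inner_ae => //; exact: ae_refl.
Qed.

Lemma inner2xx_eq0 p : L2L2 p -> inner2 p p = 0 -> ae_equal2 p 0.
Proof.
move=> [p1 p2]; rewrite /inner2 !innerxx => -[].
move=> /eqP; rewrite paddr_eq0 ?normsq_ge0 // => /andP[/eqP n1 /eqP n2].
by split; apply: normsq_eq0.
Qed.

Lemma scalar_sep c c' v : ~ ae_equal2 v 0 -> ae_equal2 (c *: v) (c' *: v) -> c = c'.
Proof.
move=> v0 E; apply/eqP; rewrite -subr_eq0; apply/negP => /negP cc; apply: v0.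
apply: (ae2Z_eq0 cc); rewrite scalerBl.
exact: ae2_sub0.
Qed.

Definition left_vector (i : form) l p p' : T2 :=
  match i with
  | LeftMul => p' | LeftMulRev => p
  | RightMul => cj l *: p - p' | RightMulRev => p - cj l *: p'
  end.

Definition right_vector (i : form) l q q' : T2 :=
  match i with
  | LeftMul => cj l *: q - q' | LeftMulRev => q - cj l *: q'
  | RightMul => q' | RightMulRev => q
  end.

Definition vector_dependence (i : form) l p p' q q' :=
  match i with
  | LeftMul => ae_equal2 p (l *: p') | LeftMulRev => ae_equal2 p' (l *: p)
  | RightMul => ae_equal2 q (l *: q') | RightMulRev => ae_equal2 q' (l *: q)
  end.

Lemma L2L2_left i l p p' : L2L2 p -> L2L2 p' -> L2L2 (left_vector i l p p').
Proof.
move=> Lp Lp'; case: i; rewrite /left_vector; try assumption.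
  by apply: L2L2B Lp'; exact: L2L2Z.
by apply: (L2L2B Lp); exact: L2L2Z.
Qed.

Lemma L2L2_right i l q q' : L2L2 q -> L2L2 q' -> L2L2 (right_vector i l q q').
Proof.
move=> Lq Lq'; case: i; rewrite /right_vector; try assumption.
  by apply: L2L2B Lq'; exact: L2L2Z.
by apply: (L2L2B Lq); exact: L2L2Z.
Qed.

Lemma tensor_diff p p' q q' r :
  (tensor p q - tensor p' q') r = inner2 r q *: p - inner2 r q' *: p'.
Proof. by []. Qed.

Lemma dependence_tensor i l p p' q q' r :
  L2L2 p -> L2L2 p' -> L2L2 q -> L2L2 q' -> L2L2 r ->
  vector_dependence i l p p' q q' ->
  ae_equal2 ((tensor p q - tensor p' q') r)
    (inner2 r (right_vector i l q q') *: left_vector i l p p').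
Proof.
move=> Lp Lp' Lq Lq' Lr.
have Ll := L2L2Z l Lq; have Ll' := L2L2Z l Lq'.
have Lc := L2L2Z (cj l) Lq; have Lc' := L2L2Z (cj l) Lq'.
rewrite tensor_diff; case: i; rewrite /vector_dependence /left_vector /right_vector => dep.
- rewrite (inner2Br Lc Lq' Lr) (inner2Zr _ Lq Lr) conjcK.
  by rewrite mulrC scalerBl -scalerA; apply: ae2B; [exact: ae2Z|exact: ae2_refl].
- rewrite (inner2Br Lq Lc' Lr) (inner2Zr _ Lq' Lr) conjcK.
  by rewrite (mulrC l) scalerBl -scalerA; apply: ae2B; [exact: ae2_refl|exact: ae2Z].
- rewrite (inner2_aer Lq Ll' Lr dep) (inner2Zr _ Lq' Lr) scalerBr scalerA mulrC.
  exact: ae2_refl.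
- rewrite (inner2_aer Lq' Ll Lr dep) (inner2Zr _ Lq Lr) scalerBr scalerA mulrC.
  exact: ae2_refl.
Qed.

(** Remove from q its component along q'. *)
Lemma separating_vector q q' : L2L2 q -> L2L2 q' -> ~ (exists l, ae_equal2 q (l *: q')) ->
  ~ ae_equal2 q' 0 -> exists r, [/\ L2L2 r, inner2 r q' = 0 & inner2 r q != 0].
Proof.
move=> Lq Lq' nq q'0; pose k := inner2 q q' / inner2 q' q'.
have n0 : inner2 q' q' != 0 by apply/eqP => /(inner2xx_eq0 Lq').
have Lk := L2L2Z k Lq'; have Lr := L2L2B Lq Lk.
have r0 : inner2 (q - k *: q') q' = 0.
  by rewrite (inner2Bl Lq Lk Lq') (inner2Zl _ Lq' Lq') /k divfK ?subrr.
exists (q - k *: q'); split; [exact: Lr|exact: r0|]; apply/eqP => rq; apply: nq; exists k.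
apply: ae2_subr0; apply: (inner2xx_eq0 Lr).
by rewrite (inner2Br Lq Lk Lr) (inner2Zr _ Lq' Lr) rq r0 mulr0 subrr.
Qed.

(** If neither right vector is a multiple of the other, then each of them can be
isolated by a vector orthogonal to the other, so both left vectors lie in the
range, which is a line. *)
Lemma rank_one_form p p' q q' : L2L2 p -> L2L2 p' -> L2L2 q -> L2L2 q' ->
  rank_one (tensor p q - tensor p' q') ->
  exists i l, vector_dependence i l p p' q q'.
Proof.
move=> Lp Lp' Lq Lq' [e [Le e0] img].
have [[l dep]|nq] := pselect (exists l, ae_equal2 q (l *: q')).
  by exists RightMul, l.
have [[l dep]|nq'] := pselect (exists l, ae_equal2 q' (l *: q)).
  by exists RightMulRev, l.
have z u : ae_equal2 u 0 -> ae_equal2 u (0 *: u) by move=> u0; rewrite scale0r.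
have q'0 : ~ ae_equal2 q' 0 by move=> h; apply: nq'; exists 0; rewrite scale0r.
have q0 : ~ ae_equal2 q 0 by move=> h; apply: nq; exists 0; rewrite scale0r.
have inrange r u c : L2L2 r -> L2L2 u -> c != 0 ->
    (tensor p q - tensor p' q') r = c *: u -> exists k, ae_equal2 u (k *: e).
  move=> Lr Lu c0 E; have [+ _] := img (c *: u) (L2L2Z c Lu).
  case; first by exists r => //; rewrite E; exact: ae2_refl.
  move=> k /(ae2Z c^-1); rewrite !scalerA mulVf // scale1r => h.
  by exists (c^-1 * k).
have [r [Lr rq' rq]] := separating_vector Lq Lq' nq q'0.
have [r' [Lr' r'q r'q']] := separating_vector Lq' Lq nq' q0.
have [k Ek] : exists k, ae_equal2 p (k *: e).
  by apply: (inrange r p _ Lr Lp rq); rewrite tensor_diff rq' scale0r subr0.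
have [k' Ek'] : exists k, ae_equal2 p' (k *: e).
  apply: (inrange r' p' (- inner2 r' q') Lr' Lp'); first by rewrite oppr_eq0.
  by rewrite tensor_diff r'q scale0r sub0r scaleNr.
have [k'0|k'0] := eqVneq k' 0.
  exists LeftMulRev, 0; rewrite /= scale0r.
  by rewrite k'0 scale0r in Ek'.
exists LeftMul, (k / k') => /=; apply: ae2_trans Ek _.
apply: ae2_sym; apply: ae2_trans (ae2Z _ Ek') _.
by rewrite scalerA (divfK k'0); exact: ae2_refl.
Qed.

Lemma rank_one_neq0 p p' q q' : rank_one (tensor p q - tensor p' q') ->
  exists2 r, L2L2 r & ~ ae_equal2 ((tensor p q - tensor p' q') r) 0.
Proof.
move=> [e [Le e0] img]; have [_ [|r Lr E]] := img e Le.
  by exists 1; rewrite scale1r; exact: ae2_refl.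
by exists r => // E0; apply: e0; exact: ae2_trans E E0.
Qed.

(** Both sides are single nonzero tensors a (x) b and a' (x) b'. Evaluating them
at b gives the constant al with a = al a'; evaluating them at b' - al^* b shows
that this vector is orthogonal to itself. *)
Lemma rank_one_forms p1 p1' q1 q1' p2 p2' q2 q2' :
  L2L2 p1 -> L2L2 p1' -> L2L2 q1 -> L2L2 q1' ->
  L2L2 p2 -> L2L2 p2' -> L2L2 q2 -> L2L2 q2' ->
  rank_one (tensor p1 q2 - tensor p1' q2') ->
  rank_one (tensor p2 q1 - tensor p2' q1') ->
  (forall r, L2L2 r -> ae_equal2 ((tensor p1 q2 - tensor p1' q2') r)
                                 ((tensor p2 q1 - tensor p2' q1') r)) ->
  exists i l j m al, [/\ al != 0, vector_dependence i l p1 p1' q2 q2',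
    vector_dependence j m p2 p2' q1 q1',
    ae_equal2 (left_vector i l p1 p1') (al *: left_vector j m p2 p2') &
    ae_equal2 (right_vector j m q1 q1') (cj al *: right_vector i l q2 q2')].
Proof.
move=> Lp1 Lp1' Lq1 Lq1' Lp2 Lp2' Lq2 Lq2' R1 R2 E.
have [i [l di]] := rank_one_form Lp1 Lp1' Lq2 Lq2' R1.
have [j [m dj]] := rank_one_form Lp2 Lp2' Lq1 Lq1' R2.
exists i, l, j, m.
have T1 r : L2L2 r -> _ := fun Lr => dependence_tensor Lp1 Lp1' Lq2 Lq2' Lr di.
have T2' r : L2L2 r -> _ := fun Lr => dependence_tensor Lp2 Lp2' Lq1 Lq1' Lr dj.
have [r0 Lr0 nz1] := rank_one_neq0 R1; have [r0' Lr0' nz2] := rank_one_neq0 R2.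
have La := L2L2_left i l Lp1 Lp1'; have Lb := L2L2_right i l Lq2 Lq2'.
have La' := L2L2_left j m Lp2 Lp2'; have Lb' := L2L2_right j m Lq1 Lq1'.
move: T1 T2' La Lb La' Lb'.
move: (left_vector i l p1 p1') (right_vector i l q2 q2') => a b.
move: (left_vector j m p2 p2') (right_vector j m q1 q1') => a' b'.
move=> T1 T2' La Lb La' Lb'.
have EE r : L2L2 r -> ae_equal2 (inner2 r b *: a) (inner2 r b' *: a').
  move=> Lr; apply: ae2_trans (ae2_sym (T1 r Lr)) _.
  exact: ae2_trans (E r Lr) (T2' r Lr).
have L0 : L2L2 (0 : T2) by split; exact: L2_0.
have a0 : ~ ae_equal2 a 0.
  move=> a0; apply: nz1; apply: ae2_trans (T1 _ Lr0) _.
  by rewrite -(scaler0 _ (inner2 r0 b)); exact: ae2Z.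
have a'0 : ~ ae_equal2 a' 0.
  move=> a0'; apply: nz2; apply: ae2_trans (T2' _ Lr0') _.
  by rewrite -(scaler0 _ (inner2 r0' b')); exact: ae2Z.
have b0 : inner2 b b != 0.
  apply/eqP => /(inner2xx_eq0 Lb) b0; apply: nz1; apply: ae2_trans (T1 _ Lr0) _.
  rewrite (inner2_aer Lb L0 Lr0 b0) -(scale0r (0 : T2)) (inner2Zr _ L0 Lr0).
  by rewrite conjc0 mul0r !scale0r; exact: ae2_refl.
pose al := inner2 b b' / inner2 b b.
have aE : ae_equal2 a (al *: a').
  have := ae2Z (inner2 b b)^-1 (EE b Lb).
  by rewrite !scalerA (mulVf b0) scale1r (mulrC (inner2 b b)^-1); exact.
have al0 : al != 0.
  by apply/eqP => al0; apply: a0; rewrite al0 scale0r in aE.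
have Lc := L2L2Z (cj al) Lb; have Lr := L2L2B Lb' Lc.
exists al; split; [exact: al0|exact: di|exact: dj|exact: aE|].
apply: ae2_subr0; apply: (inner2xx_eq0 Lr).
move: Lr; set r := b' - _ => Lr; have Er := EE r Lr.
have : inner2 r b * al = inner2 r b'.
  apply: (scalar_sep a'0); rewrite -scalerA.
  by apply: ae2_trans Er; apply: ae2_sym; exact: ae2Z.
rewrite {4}/r (inner2Br Lb' Lc Lr) (inner2Zr _ Lb Lr) conjcK => <-.
by rewrite mulrC subrr.
Qed.

End RankOne.

(** * Commutation in terms of symbols *)

Section Lists.
Context {R : realType}.
Local Notation T := (circle R).
Local Notation C := R[i].
Local Notation T2 := ((T -> C) * (T -> C))%type.
Local Notation cj := (@conjc R).
Implicit Types (f g x y w a b h : T -> C) (H : 'M[T -> C]_2).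
Implicit Types (s r t : bool) (l m al c : C) (p q k n v : T2).

Definition column_vector H t : T2 :=
  (hankel_edge true (entry H true t), hankel_edge false (entry H false t)).

Definition row_vector H r : T2 :=
  (hankel_edge true (bar (entry H r true)), hankel_edge false (bar (entry H r false))).

Lemma L2L2_column H t : bounded H -> L2L2 (column_vector H t).
Proof. by move=> bH; split; apply: L2_hankel_edge; exact: bH. Qed.

Lemma L2L2_row H t : bounded H -> L2L2 (row_vector H t).
Proof. by move=> bH; split; apply: L2_hankel_edge; apply: Linfty_bar; exact: bH. Qed.

Lemma hankel_edge_dependent r c a a' : Linfty a -> Linfty a' ->
  ae_equal (hankel_edge r a) (c *: hankel_edge r a') -> Hinf (~~ r) (a - c *: a').
Proof.
move=> La La' E; apply: hankel_edge_eq0; first by solve_lp.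
by apply: ae_trans (hankel_edgeB r c La La') _; exact: ae_sub0.
Qed.

Lemma hankel_edge_dependent_bar t c b b' : Linfty b -> Linfty b' ->
  ae_equal (hankel_edge t (bar b)) (cj c *: hankel_edge t (bar b')) -> Hinf t (b - c *: b').
Proof.
move=> Lb Lb' E; rewrite -Hinf_bar barD barN barZ.
by apply: hankel_edge_dependent; [exact: Linfty_bar|exact: Linfty_bar|].
Qed.

Lemma left_vector_hankel i l H r : bounded H ->
  ae_equal (if r then (left_vector i l (column_vector H true) (column_vector H false)).1
            else (left_vector i l (column_vector H true) (column_vector H false)).2)
    (hankel_edge r (left_factor i l (entry H r true) (entry H r false))).
Proof.
move=> bH; case: i; rewrite /left_vector /left_factor /column_vector.
- by case: r; exact: ae_refl.
- by case: r; exact: ae_refl.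
- by case: r; apply: ae_sym; [exact: (hankel_edgeZB true _ (bH _ _) (bH _ _))|
    exact: (hankel_edgeZB false _ (bH _ _) (bH _ _))].
- by case: r; apply: ae_sym; [exact: (hankel_edgeB true _ (bH _ _) (bH _ _))|
    exact: (hankel_edgeB false _ (bH _ _) (bH _ _))].
Qed.

Lemma right_vector_hankel i l H t : bounded H ->
  ae_equal (if t then (right_vector i l (row_vector H true) (row_vector H false)).1
            else (right_vector i l (row_vector H true) (row_vector H false)).2)
    (hankel_edge t (bar (right_factor i l (entry H true t) (entry H false t)))).
Proof.
move=> bH; have bb r u : Linfty (bar (entry H r u)) by exact/Linfty_bar/bH.
case: i; rewrite /right_vector /right_factor /row_vector.
- by case: t; rewrite barD barN barZ; apply: ae_sym;
    [exact: (hankel_edgeZB true _ (bb _ _) (bb _ _))|exact: (hankel_edgeZB false _ (bb _ _) (bb _ _))].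
- by case: t; rewrite barD barN barZ; apply: ae_sym;
    [exact: (hankel_edgeB true _ (bb _ _) (bb _ _))|exact: (hankel_edgeB false _ (bb _ _) (bb _ _))].
- by case: t; exact: ae_refl.
- by case: t; exact: ae_refl.
Qed.

Lemma vector_dependence_compat i l H1 H2 : bounded H1 -> bounded H2 ->
  vector_dependence i l (column_vector H1 true) (column_vector H1 false)
    (row_vector H2 true) (row_vector H2 false) ->
  forall s t, dependence i l (Hinf s) (Hinf t)
    (entry H1 (~~ s) true) (entry H1 (~~ s) false) (entry H2 true t) (entry H2 false t).
Proof.
move=> b1 b2 dep s t; move: dep; case: i; rewrite /vector_dependence /dependence => -[e1 e2].
- have E r : ae_equal (hankel_edge r (entry H1 r true)) (l *: hankel_edge r (entry H1 r false)).
    by case: r; [exact: e1|exact: e2].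
  by rewrite -[s in Hinf s]negbK; apply: hankel_edge_dependent (E _); exact: b1.
- have E r : ae_equal (hankel_edge r (entry H1 r false)) (l *: hankel_edge r (entry H1 r true)).
    by case: r; [exact: e1|exact: e2].
  by rewrite -[s in Hinf s]negbK; apply: hankel_edge_dependent (E _); exact: b1.
- have E r : ae_equal (hankel_edge r (bar (entry H2 true r))) (l *: hankel_edge r (bar (entry H2 false r))).
    by case: r; [exact: e1|exact: e2].
  apply: hankel_edge_dependent_bar; [exact: b2|exact: b2|].
  by rewrite conjcK; exact: E.
- have E r : ae_equal (hankel_edge r (bar (entry H2 false r))) (l *: hankel_edge r (bar (entry H2 true r))).
    by case: r; [exact: e1|exact: e2].
  apply: hankel_edge_dependent_bar; [exact: b2|exact: b2|].
  by rewrite conjcK; exact: E.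
Qed.

Lemma vectors_compatible i l j m al H1 H2 : bounded H1 -> bounded H2 ->
  vector_dependence i l (column_vector H1 true) (column_vector H1 false)
    (row_vector H2 true) (row_vector H2 false) ->
  vector_dependence j m (column_vector H2 true) (column_vector H2 false)
    (row_vector H1 true) (row_vector H1 false) ->
  ae_equal2 (left_vector i l (column_vector H1 true) (column_vector H1 false))
    (al *: left_vector j m (column_vector H2 true) (column_vector H2 false)) ->
  ae_equal2 (right_vector j m (row_vector H1 true) (row_vector H1 false))
    (cj al *: right_vector i l (row_vector H2 true) (row_vector H2 false)) ->
  compatible i l j m al H1 H2.
Proof.
move=> b1 b2 d1 d2 [l1 l2] [r1 r2]; split.
- exact: vector_dependence_compat.
- exact: vector_dependence_compat.
- move=> s; rewrite -[s in Hinf s]negbK; apply: hankel_edge_dependent.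
  + by apply: Linfty_left; exact: b1.
  + by apply: Linfty_left; exact: b2.
  + apply: ae_trans (ae_sym (left_vector_hankel i l (~~ s) b1)) _.
    apply: ae_trans (aeZ al (left_vector_hankel j m (~~ s) b2)).
    by case: (~~ s); [exact: l1|exact: l2].
- move=> t; apply: hankel_edge_dependent_bar.
  + by apply: Linfty_right; exact: b1.
  + by apply: Linfty_right; exact: b2.
  + apply: ae_trans (ae_sym (right_vector_hankel j m t b1)) _.
    apply: ae_trans (aeZ (cj al) (right_vector_hankel i l t b2)).
    by case: t; [exact: r1|exact: r2].
Qed.

Definition component r (p : T2) := if r then p.1 else p.2.

Lemma ae_tensor_diff p p' q q' k k' n n' v :
  (forall r t, ae_equal
    (inner (component t v) (component t q) *: component r p -
     inner (component t v) (component t q') *: component r p')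
    (inner (component t v) (component t n) *: component r k -
     inner (component t v) (component t n') *: component r k')) ->
  ae_equal2 ((tensor p q - tensor p' q') v) ((tensor k n - tensor k' n') v).
Proof.
move=> E; rewrite !tensor_diff /inner2.
have sum (c1 c2 c1' c2' e1 e2 e1' e2' : C) a a' b b' :
    ae_equal (c1 *: a - c1' *: a') (e1 *: b - e1' *: b') ->
    ae_equal (c2 *: a - c2' *: a') (e2 *: b - e2' *: b') ->
    ae_equal ((c1 + c2) *: a - (c1' + c2') *: a') ((e1 + e2) *: b - (e1' + e2') *: b').
  move=> E1 E2; rewrite !scalerDl !opprD addrACA [X in ae_equal _ X]addrACA.
  exact: aeD.
have E1 := sum _ _ _ _ _ _ _ _ _ _ _ _ (E true true) (E true false).
have E2 := sum _ _ _ _ _ _ _ _ _ _ _ _ (E false true) (E false false).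
by split; [exact: E1|exact: E2].
Qed.

Lemma blocks_tensor_operators H1 H2 : bounded H1 -> bounded H2 ->
  (forall r t x, Hs t x -> Hs (~~ r) (mix H1 H2 r t x - mix H2 H1 r t x)) ->
  forall v, L2L2 v -> ae_equal2
    ((tensor (column_vector H1 true) (row_vector H2 true) -
      tensor (column_vector H1 false) (row_vector H2 false)) v)
    ((tensor (column_vector H2 true) (row_vector H1 true) -
      tensor (column_vector H2 false) (row_vector H1 false)) v).
Proof.
move=> b1 b2 blk v [Lv1 Lv2]; apply: ae_tensor_diff => r t.
have Lv : L2 (component t v) by case: t.
have := blocks_tensor b1 b2 blk r t Lv.
by case: r; case: t {Lv}; exact.
Qed.

(** The rank one hypotheses serve to produce the constants from the commutation,
through [rank_one_forms]. *)
Lemma commute_compatible H1 H2 : bounded H1 -> bounded H2 ->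
  rank_one (tensor (column_vector H1 true) (row_vector H2 true) -
            tensor (column_vector H1 false) (row_vector H2 false)) ->
  rank_one (tensor (column_vector H2 true) (row_vector H1 true) -
            tensor (column_vector H2 false) (row_vector H1 false)) ->
  (forall x, L2 x ->
     ae_equal (cauchyR H1 (cauchyR H2 x)) (cauchyR H2 (cauchyR H1 x))) <->
  exists i l j m al, [/\ al != 0, compatible i l j m al H1 H2 &
    forall s, Hinf s (cross_symbol H1 H2 s s + block_sign s *: block_symbol i l j m al H1 H2 s)].
Proof.
move=> b1 b2 R1 R2; rewrite (commute_blocks b1 b2); split=> [blk|].
- have [i [l [j [m [al [al0 d1 d2 lE rE]]]]]] := rank_one_forms
    (L2L2_column true b1) (L2L2_column false b1) (L2L2_row true b1) (L2L2_row false b1)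
    (L2L2_column true b2) (L2L2_column false b2) (L2L2_row true b2) (L2L2_row false b2)
    R1 R2 (blocks_tensor_operators b1 b2 blk).
  have comp := vectors_compatible b1 b2 d1 d2 lE rE.
  exists i, l, j, m, al; split; [exact: al0|exact: comp|].
  exact: (blocks_symbol b1 b2 comp).1 blk.
- move=> [i [l [j [m [al [_ comp F]]]]]].
  exact: (blocks_symbol b1 b2 comp).2 F.
Qed.

End Lists.

(** * The sixteen lists *)

Section Criterion.
Context {R : realType}.
Local Notation T := (circle R).
Local Notation C := R[i].
Local Notation cj := (@conjc R).
Implicit Types (f g : T -> C) (H : 'M[T -> C]_2).
Implicit Types (s r t : bool) (l m al c : C) (i j : form).

Definition dependence_items i l H1 H2 : seq (T -> C) :=
  match i with
  | LeftMul => [:: bar (H1 0 0 - l *: H1 0 1); H1 1 0 - l *: H1 1 1]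
  | LeftMulRev => [:: bar (H1 0 1 - l *: H1 0 0); H1 1 1 - l *: H1 1 0]
  | RightMul => [:: H2 0 0 - cj l *: H2 1 0; bar (H2 0 1 - cj l *: H2 1 1)]
  | RightMulRev => [:: H2 1 0 - cj l *: H2 0 0; bar (H2 1 1 - cj l *: H2 0 1)]
  end.

Definition linear_items i l j m al H1 H2 : seq (T -> C) :=
  dependence_items i l H1 H2 ++ dependence_items j m H2 H1 ++
  [:: bar (left_factor i l (H1 0 0) (H1 0 1) - al *: left_factor j m (H2 0 0) (H2 0 1));
      left_factor i l (H1 1 0) (H1 1 1) - al *: left_factor j m (H2 1 0) (H2 1 1);
      right_factor j m (H1 0 0) (H1 1 0) - al *: right_factor i l (H2 0 0) (H2 1 0);
      bar (right_factor j m (H1 0 1) (H1 1 1) - al *: right_factor i l (H2 0 1) (H2 1 1))].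

(** On the block of the commutator with s = t, the function that must be a
multiplier. *)
Definition diagonal_symbol i l j m al H1 H2 s :=
  cross_symbol H1 H2 s s + block_sign s *: block_symbol i l j m al H1 H2 s.

Lemma all_Hinfty_cat (a b : seq (T -> C)) :
  all_Hinfty (a ++ b) <-> all_Hinfty a /\ all_Hinfty b.
Proof.
elim: a => [|f a IH] /=; first by split=> [|[]].
by rewrite IH; split=> [[? []]|[[]]].
Qed.

Lemma dependence_itemsP i l H1 H2 :
  (forall s t, dependence i l (Hinf s) (Hinf t)
    (entry H1 (~~ s) true) (entry H1 (~~ s) false) (entry H2 true t) (entry H2 false t)) <->
  all_Hinfty (dependence_items i l H1 H2).
Proof.
case: i; split.
- by move=> D; split; [exact: (D false true)|split; [exact: (D true true)|]].
- by move=> [D1 [D2 _]] [] t; [exact: D2|exact: D1].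
- by move=> D; split; [exact: (D false true)|split; [exact: (D true true)|]].
- by move=> [D1 [D2 _]] [] t; [exact: D2|exact: D1].
- by move=> D; split; [exact: (D true true)|split; [exact: (D true false)|]].
- by move=> [D1 [D2 _]] s []; [exact: D1|exact: D2].
- by move=> D; split; [exact: (D true true)|split; [exact: (D true false)|]].
- by move=> [D1 [D2 _]] s []; [exact: D1|exact: D2].
Qed.

Lemma linear_itemsP i l j m al H1 H2 :
  compatible i l j m al H1 H2 <-> all_Hinfty (linear_items i l j m al H1 H2).
Proof.
rewrite /linear_items !all_Hinfty_cat -!dependence_itemsP; split.
- move=> [ci cj' cA cB]; split; [exact: ci|split; [exact: cj'|]].
  split; [exact: (cA false)|split; [exact: (cA true)|]].
  by split; [exact: (cB true)|split; [exact: (cB false)|]].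
- move=> [ci [cj' [A0 [A1 [B1 [B0 _]]]]]]; split; [exact: ci|exact: cj'| |].
  + by case; [exact: A1|exact: A0].
  + by case; [exact: B1|exact: B0].
Qed.

Definition up_to_sign f g := f = g \/ f = - g.

Lemma Hinfty_up_to_sign f g : up_to_sign f g -> Hinfty f <-> Hinfty g.
Proof.
have N (h : T -> C) : Hinfty h -> Hinfty (- h).
  move=> [Lh Hh]; split; first exact: LinftyN.
  exact/Hardy2E/HsN/Hardy2E.
by move=> [->//|->]; split=> /N; rewrite ?opprK.
Qed.

(** In the lists, the symbols of the two blocks come with either sign and in
either order. *)
Lemma list_criterion i l j m al H1 H2 (a : seq (T -> C)) f g :
  a = linear_items i l j m al H1 H2 ->
  (up_to_sign f (diagonal_symbol i l j m al H1 H2 true) /\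
   up_to_sign g (bar (diagonal_symbol i l j m al H1 H2 false))) \/
  (up_to_sign g (diagonal_symbol i l j m al H1 H2 true) /\
   up_to_sign f (bar (diagonal_symbol i l j m al H1 H2 false))) ->
  all_Hinfty (a ++ [:: f; g]) <->
  compatible i l j m al H1 H2 /\
  forall s, Hinf s (diagonal_symbol i l j m al H1 H2 s).
Proof.
have bool_and (P P' P0 : Prop) (Q : bool -> Prop) : (P <-> Q true) -> (P' <-> Q false) ->
    (P0 /\ P /\ P' /\ True <-> P0 /\ forall s, Q s).
  move=> -> ->; split=> [[p [q1 [q0 _]]]|[p q]].
    by split; [exact: p|case; [exact: q1|exact: q0]].
  by split; [exact: p|split; [exact: q|split; [exact: q|]]].
have swap (P P' P0 : Prop) : P0 /\ P /\ P' /\ True <-> P0 /\ P' /\ P /\ True by tauto.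
move=> -> D; rewrite all_Hinfty_cat -linear_itemsP /all_Hinfty.
case: D => -[E1 E0]; last rewrite /= swap.
all: apply: bool_and; first exact: Hinfty_up_to_sign E1; exact: Hinfty_up_to_sign E0.
Qed.

End Criterion.

Lemma or_congr (P P' Q Q' : Prop) : (P <-> P') -> (Q <-> Q') -> P \/ Q <-> P' \/ Q'.
Proof. by move=> -> ->. Qed.

(** The disjuncts are in the order of the lists: the form of the second side
varies slowest. *)
Lemma exists_forms (P : form -> form -> Prop) :
  (exists i j, P i j) <->
  P LeftMul LeftMul \/ P LeftMulRev LeftMul \/ P RightMul LeftMul \/ P RightMulRev LeftMul \/
  P LeftMul LeftMulRev \/ P LeftMulRev LeftMulRev \/ P RightMul LeftMulRev \/ P RightMulRev LeftMulRev \/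
  P LeftMul RightMul \/ P LeftMulRev RightMul \/ P RightMul RightMul \/ P RightMulRev RightMul \/
  P LeftMul RightMulRev \/ P LeftMulRev RightMulRev \/ P RightMul RightMulRev \/ P RightMulRev RightMulRev.
Proof.
split; first by move=> [[] [[] ?]]; tauto.
by repeat (case; [by move=> ?; do 2 eexists; eassumption|]); move=> ?; do 2 eexists; eassumption.
Qed.

Lemma conjcE (R : realType) (c : R[i]) : Num.conj c = conjc c. Proof. by []. Qed.

Lemma barE (R : realType) (f : circle R -> R[i]) z : bar f z = conjc (f z).
Proof. by []. Qed.

Definition conj_push (R : realType) := (@conjcE R, @conjcK R, @conjD R, @conjM R, @conjN R, @conjc0 R).

(** An identity between symbols is a polynomial identity in the values of the
eight entries at a point and their conjugates. *)
Ltac pointwise H1 H2 := let z := fresh in apply/funext => z;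
  rewrite ?expr2 !pointE ?barE ?pointE ?barE;
  move: (H1 0 0 z) (H1 0 1 z) (H1 1 0 z) (H1 1 1 z)
        (H2 0 0 z) (H2 0 1 z) (H2 1 0 z) (H2 1 1 z) => ? ? ? ? ? ? ? ?;
  rewrite ?conj_push; ring.

Ltac sign_match H1 H2 := first [left; solve [pointwise H1 H2] | right; solve [pointwise H1 H2]].

Ltac list_case H1 H2 side :=
  apply: iff_sym;
  match goal with |- _ <-> ?Q ?lam ?mu ?alpha ?i ?j =>
    apply: (@list_criterion _ i lam j mu alpha H1 H2 [:: _; _; _; _; _; _; _; _])
  end;
  rewrite /linear_items /dependence_items /cat /diagonal_symbol /cross_symbol /block_symbol
    /symbol /left_factor /right_factor /residue /entry /block_sign;
  [by congr [:: _; _; _; _; _; _; _; _]; pointwise H1 H2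
  | side; split; sign_match H1 H2].

Theorem theorem4p5 (R : realType) (H1 H2 : 'M[circle R -> R[i]]_2)
    (H1_bounded : forall i j, Linfty (H1 i j))
    (H2_bounded : forall i j, Linfty (H2 i j)) :
  let f1 := H1 0 0 in let u1 := H1 0 1 in
  let g1 := H1 1 0 in let v1 := H1 1 1 in
  let f2 := H2 0 0 in let u2 := H2 0 1 in
  let g2 := H2 1 0 in let v2 := H2 1 1 in
  let lhs :=
    tensor (V (Pminus (bar f1)), Pminus g1) (V (Pminus f2), Pminus (bar u2))
    - tensor (V (Pminus (bar u1)), Pminus v1) (V (Pminus g2), Pminus (bar v2)) in
  let rhs :=
    tensor (V (Pminus (bar f2)), Pminus g2) (V (Pminus f1), Pminus (bar u1))
    - tensor (V (Pminus (bar u2)), Pminus v2) (V (Pminus g1), Pminus (bar v1)) in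
  rank_one lhs -> rank_one rhs ->
  (forall x, L2 x ->
     ae_equal (cauchyR H1 (cauchyR H2 x)) (cauchyR H2 (cauchyR H1 x)))
  <->
  (exists lam mu alpha : R[i], alpha != 0 /\
     (all_Hinfty 
        [:: bar f1 - lam^* *: bar u1;
           g1 - lam *: v1;
           bar f2 - mu^* *: bar u2;
           g2 - mu *: v2;
           bar u1 - alpha^* *: bar u2;
           v1 - alpha *: v2;
           mu *: f1 - g1 - alpha *: (lam *: f2 - g2);
           mu^* *: bar u1 - bar v1 - alpha^* *: (lam^* *: bar u2 - bar v2);
           g2 * (v1 - alpha *: v2) + v2 * ((alpha * lam) *: f2 - mu *: f1);
           bar u2 * bar f1 - bar u1 * bar f2 + mu^* *: (bar u1 * bar u2) - bar v1 * bar u2 + alpha^* *: (bar v2 * bar u2) - (lam^* * alpha^*) *: (bar u2 ^+ 2)]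
      \/
      all_Hinfty 
        [:: bar u1 - lam^* *: bar f1;
           v1 - lam *: g1;
           bar f2 - mu^* *: bar u2;
           g2 - mu *: v2;
           bar f1 - alpha^* *: bar u2;
           g1 - alpha *: v2;
           mu *: f1 - g1 - alpha *: (f2 - lam *: g2);
           mu^* *: bar u1 - bar v1 - alpha^* *: (bar u2 - lam^* *: bar v2);
           g2 * (v1 - (lam * alpha) *: v2) + v2 * (alpha *: f2 - mu *: f1);
           bar u2 * bar f1 - bar u1 * bar f2 - alpha^* *: (bar u2 ^+ 2) + (lam^* * alpha^*) *: (bar v2 * bar u2) + mu^* *: (bar u1 * bar u2) - bar v1 * bar u2]
      \/
      all_Hinfty 
        [:: f2 - lam^* *: g2;
           bar u2 - lam *: bar v2;
           bar f2 - mu^* *: bar u2;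
           g2 - mu *: v2;
           lam *: bar f1 - bar u1 - alpha^* *: bar u2;
           lam^* *: g1 - v1 - alpha *: v2;
           mu *: f1 - g1 - alpha *: g2;
           mu^* *: bar u1 - bar v1 - alpha^* *: bar v2;
           g1 * f2 + v1 * g2 - lam^* *: (g1 * g2) + alpha *: (v2 * g2) - mu *: (v2 * f1);
           lam *: (bar v2 * bar f1) + mu^* *: (bar u1 * bar u2) - bar v1 * bar u2 - alpha^* *: (bar v2 * bar u2) - bar u1 * bar f2]
      \/
      all_Hinfty 
        [:: g2 - lam^* *: f2;
           bar v2 - lam *: bar u2;
           bar f2 - mu^* *: bar u2;
           g2 - mu *: v2;
           bar f1 - lam *: bar u1 - alpha^* *: bar u2;
           g1 - lam^* *: v1 - alpha *: v2;
           mu *: f1 - g1 - alpha *: f2;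
           mu^* *: bar u1 - bar v1 - alpha^* *: bar u2;
           lam^* *: (v1 * f2) - mu *: (v2 * f1) + alpha *: (v2 * f2);
           bar v2 * bar u1 - bar u1 * bar f2 + bar u2 * bar f1 - lam *: (bar u1 * bar u2) + mu^* *: (bar u1 * bar u2) - bar u2 * bar v1 - alpha^* *: (bar u2 ^+ 2)]
      \/
      all_Hinfty 
        [:: bar f1 - lam^* *: bar u1;
           g1 - lam *: v1;
           bar u2 - mu^* *: bar f2;
           v2 - mu *: g2;
           bar u1 - alpha^* *: bar f2;
           v1 - alpha *: g2;
           f1 - mu *: g1 - alpha *: (lam *: f2 - g2);
           bar u1 - mu^* *: bar v1 - alpha^* *: (lam^* *: bar u2 - bar v2);
           bar u2 * bar f1 - mu^* *: (bar v1 * bar f2) + alpha^* *: (bar v2 * bar f2) - (lam^* * alpha^*) *: (bar u2 * bar f2);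
           v1 * g2 - v2 * g1 - f1 * g2 + mu *: (g1 * g2) - alpha *: (g2 ^+ 2) + (lam * alpha) *: (g2 * f2)]
      \/
      all_Hinfty 
        [:: bar u1 - lam^* *: bar f1;
           v1 - lam *: g1;
           bar u2 - mu^* *: bar f2;
           v2 - mu *: g2;
           bar f1 - alpha^* *: bar f2;
           g1 - alpha *: g2;
           f1 - mu *: g1 - alpha *: (f2 - lam *: g2);
           bar u1 - mu^* *: bar v1 - alpha^* *: (bar u2 - lam^* *: bar v2);
           bar u2 * bar f1 - mu^* *: (bar v1 * bar f2) - alpha^* *: (bar u2 * bar f2) + (lam^* * alpha^*) *: (bar v2 * bar f2);
           v1 * g2 - v2 * g1 - g2 * f1 + mu *: (g1 * g2) + alpha *: (g2 * f2) - (lam * alpha) *: (g2 ^+ 2)]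
      \/
      all_Hinfty 
        [:: f2 - lam^* *: g2;
           bar u2 - lam *: bar v2;
           bar u2 - mu^* *: bar f2;
           v2 - mu *: g2;
           lam *: bar f1 - bar u1 - alpha^* *: bar f2;
           lam^* *: g1 - v1 - alpha *: g2;
           f1 - mu *: g1 - alpha *: g2;
           bar u1 - mu^* *: bar v1 - alpha^* *: bar v2;
           lam *: (bar v2 * bar f1) - mu^* *: (bar v1 * bar f2) - alpha^* *: (bar v2 * bar f2);
           g1 * f2 - v2 * g1 + (v1 - lam^* *: g1) * g2 + g2 * (mu *: g1 - f1) + alpha *: (g2 ^+ 2)]
      \/
      all_Hinfty 
        [:: g2 - lam^* *: f2;
           bar v2 - lam *: bar u2;
           bar u2 - mu^* *: bar f2;
           v2 - mu *: g2;
           bar f1 - lam *: bar u1 - alpha^* *: bar f2;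
           g1 - lam^* *: v1 - alpha *: g2;
           f1 - mu *: g1 - alpha *: f2;
           bar u1 - mu^* *: bar v1 - alpha^* *: bar u2;
           bar v2 * bar u1 + bar u2 * bar f1 - lam *: (bar u1 * bar u2) - mu^* *: (bar v1 * bar f2) - alpha^* *: (bar u2 * bar f2);
           g1 * v2 + g2 * f1 - lam^* *: (v1 * f2) - mu *: (g1 * g2) - alpha *: (g2 * f2)]
      \/
      all_Hinfty 
        [:: bar f1 - lam^* *: bar u1;
           g1 - lam *: v1;
           f1 - mu^* *: g1;
           bar u1 - mu *: bar v1;
           bar u1 - alpha^* *: (mu *: bar f2 - bar u2);
           v1 - alpha *: (mu^* *: g2 - v2);
           g1 - alpha *: (lam *: f2 - g2);
           bar v1 - alpha^* *: (lam^* *: bar u2 - bar v2);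
           bar u2 * bar f1 - bar v1 * bar u2 + alpha^* *: ((lam^* *: bar u2 - bar v2) * (bar u2 - mu *: bar f2));
           v1 * g2 - g2 * f1 + alpha *: ((mu^* *: g2 - v2) * (lam *: f2 - g2))]
      \/
      all_Hinfty 
        [:: bar u1 - lam^* *: bar f1;
           v1 - lam *: g1;
           f1 - mu^* *: g1;
           bar u1 - mu *: bar v1;
           bar f1 - alpha^* *: (mu *: bar f2 - bar u2);
           g1 - alpha *: (mu^* *: g2 - v2);
           g1 - alpha *: (f2 - lam *: g2);
           bar v1 - alpha^* *: (bar u2 - lam^* *: bar v2);
           bar u2 * bar f1 - bar v1 * bar u2 + alpha^* *: ((lam^* *: bar v2 - bar u2) * (mu *: bar f2 - bar u2));
           v1 * g2 - g2 * f1 + alpha *: ((mu^* *: g2 - v2) * (f2 - lam *: g2))]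
      \/
      all_Hinfty 
        [:: f2 - lam^* *: g2;
           bar u2 - lam *: bar v2;
           f1 - mu^* *: g1;
           bar u1 - mu *: bar v1;
           lam *: bar f1 - bar u1 - alpha^* *: (mu *: bar f2 - bar u2);
           lam^* *: g1 - v1 - alpha *: (mu^* *: g2 - v2);
           g1 - alpha *: g2;
           bar v1 - alpha^* *: bar v2;
           bar v1 * bar u2 - lam *: (bar v2 * bar f1) - alpha^* *: (bar v2 * bar u2) + (alpha^* * mu) *: (bar v2 * bar f2);
           g1 * f2 - g2 * f1 + (v1 - lam^* *: g1) * g2 + alpha *: (g2 * (mu^* *: g2 - v2))]
      \/
      all_Hinfty 
        [:: g2 - lam^* *: f2;
           bar v2 - lam *: bar u2;
           f1 - mu^* *: g1;
           bar u1 - mu *: bar v1;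
           bar f1 - lam *: bar u1 - alpha^* *: (mu *: bar f2 - bar u2);
           g1 - lam^* *: v1 - alpha *: (mu^* *: g2 - v2);
           g1 - alpha *: f2;
           bar v1 - alpha^* *: bar u2;
           bar v2 * bar u1 - bar v1 * bar u2 + bar u2 * (bar f1 - lam *: bar u1) + alpha^* *: (bar u2 * (bar u2 - mu *: bar f2));
           g2 * f1 - lam^* *: (v1 * f2) - (mu^* * alpha) *: (f2 * g2) + alpha *: (v2 * f2)]
      \/
      all_Hinfty 
        [:: bar f1 - lam^* *: bar u1;
           g1 - lam *: v1;
           g1 - mu^* *: f1;
           bar v1 - mu *: bar u1;
           bar u1 - alpha^* *: (bar f2 - mu *: bar u2);
           v1 - alpha *: (g2 - mu^* *: v2);
           f1 - alpha *: (lam *: f2 - g2);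
           bar u1 - alpha^* *: (lam^* *: bar u2 - bar v2);
           bar u2 * bar f1 - bar v1 * bar u2 + alpha^* *: ((bar v2 - lam^* *: bar u2) * (bar f2 - mu *: bar u2));
           v1 * g2 - g2 * f1 + alpha *: ((g2 - mu^* *: v2) * (lam *: f2 - g2))]
      \/
      all_Hinfty 
        [:: bar u1 - lam^* *: bar f1;
           v1 - lam *: g1;
           g1 - mu^* *: f1;
           bar v1 - mu *: bar u1;
           bar f1 - alpha^* *: (bar f2 - mu *: bar u2);
           g1 - alpha *: (g2 - mu^* *: v2);
           f1 - alpha *: (f2 - lam *: g2);
           bar u1 - alpha^* *: (bar u2 - lam^* *: bar v2);
           (bar f1 - bar v1) * bar u2 + alpha^* *: ((lam^* *: bar v2 - bar u2) * (bar f2 - mu *: bar u2));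
           (v1 - f1) * g2 + alpha *: ((g2 - mu^* *: v2) * (f2 - lam *: g2))]
      \/
      all_Hinfty 
        [:: f2 - lam^* *: g2;
           bar u2 - lam *: bar v2;
           g1 - mu^* *: f1;
           bar v1 - mu *: bar u1;
           lam *: bar f1 - bar u1 - alpha^* *: (bar f2 - mu *: bar u2);
           lam^* *: g1 - v1 - alpha *: (g2 - mu^* *: v2);
           f1 - alpha *: g2;
           bar u1 - alpha^* *: bar v2;
           bar v1 * bar u2 - lam *: (bar f1 * bar v2) - alpha^* *: (bar v2 * (mu *: bar u2 - bar f2));
           g1 * f2 - g2 * f1 + (v1 - lam^* *: g1) * g2 + alpha *: (g2 * (g2 - mu^* *: v2))]
      \/
      all_Hinfty 
        [:: g2 - lam^* *: f2;
           bar v2 - lam *: bar u2;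
           g1 - mu^* *: f1;
           bar v1 - mu *: bar u1;
           bar f1 - lam *: bar u1 - alpha^* *: (bar f2 - mu *: bar u2);
           g1 - lam^* *: v1 - alpha *: (g2 - mu^* *: v2);
           f1 - alpha *: f2;
           bar u1 - alpha^* *: bar u2;
           bar u1 * bar v2 - bar v1 * bar u2 + bar u2 * (bar f1 - lam *: bar u1) + alpha^* *: (bar u2 * (mu *: bar u2 - bar f2));
           f1 * g2 - lam^* *: (v1 * f2) + alpha *: (f2 * (mu^* *: v2 - g2))])).
Proof.
move=> f1 u1 g1 v1 f2 u2 g2 v2 lhs rhs rank_lhs rank_rhs.
have b1 : bounded H1 by move=> r t; exact: H1_bounded.
have b2 : bounded H2 by move=> r t; exact: H2_bounded.
have row (H : 'M[circle R -> R[i]]_2) r :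
    row_vector H r = (V (Pminus (H (slot r) 0)), Pminus (bar (H (slot r) 1))).
  by rewrite /row_vector /hankel_edge /entry barK.
have rank1 : rank_one (tensor (column_vector H1 true) (row_vector H2 true) -
    tensor (column_vector H1 false) (row_vector H2 false)) by rewrite !row; exact: rank_lhs.
have rank2 : rank_one (tensor (column_vector H2 true) (row_vector H1 true) -
    tensor (column_vector H2 false) (row_vector H1 false)) by rewrite !row; exact: rank_rhs.
apply: iff_trans (commute_compatible b1 b2 rank1 rank2) _.
pose Q lam mu alpha i j := compatible i lam j mu alpha H1 H2 /\
  forall s, Hinf s (diagonal_symbol i lam j mu alpha H1 H2 s).
apply: (@iff_trans _ (exists lam mu alpha, alpha != 0 /\ exists i j, Q lam mu alpha i j)).
  split=> [[i [lam [j [mu [alpha [al0 comp sym]]]]]]|[lam [mu [alpha [al0 [i [j [comp sym]]]]]]]].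
    by exists lam, mu, alpha; split; [exact: al0|exists i, j; split; [exact: comp|exact: sym]].
  by exists i, lam, j, mu, alpha; split; [exact: al0|exact: comp|exact: sym].
have ex_congr (P P' : R[i] -> Prop) : (forall c, P c <-> P' c) -> (exists c, P c) <-> (exists c, P' c).
  by move=> PP; split=> -[c /PP]; exists c.
apply: (ex_congr) => lam; apply: (ex_congr) => mu; apply: (ex_congr) => alpha.
apply: and_iff_compat_l; apply: iff_trans (exists_forms (Q lam mu alpha)) _.
rewrite /f1 /u1 /g1 /v1 /f2 /u2 /g2 /v2.
refine (or_congr _ (or_congr _ (or_congr _ (or_congr _ (or_congr _
  (or_congr _ (or_congr _ (or_congr _ (or_congr _ (or_congr _ (or_congr _
  (or_congr _ (or_congr _ (or_congr _ (or_congr _ _))))))))))))))).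
(* In the first four lists, the symbol of the block with s = true comes first. *)
1-4: list_case H1 H2 ltac:(left).
all: list_case H1 H2 ltac:(right).
Qed.
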